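(* For any $z\in\mathbb{D}$, there exist two constants $c_1(z),c_2(z)>0$ such that for any not identically zero harmonic function $f:\mathbb{D}\to\mathbb{C}$ with sub-exponential mean-growth and any $s\in(1,2]$, we have $$c_1(z)\le\frac{\mathrm{Var}_{\mathbb{P}_{K_{\mathbb{D}}}}(g_X(s,z;f))}{\displaystyle\int_{\mathbb{D}}|f(w)|^2(1-|w|^2)^{2s-2}\,dA(w)}\le c_2(z).$$
   Context: $\mathbb{D}$ is the open unit disk in $\mathbb{C}$, $dA$ is Lebesgue measure on $\mathbb{D}$ normalized so that $A(\mathbb{D})=1$, and $K_{\mathbb{D}}(z,w)=(1-z\bar w)^{-2}$ is the Bergman kernel. $\mathrm{Conf}(\mathbb{D})$ is the space of (locally finite) configurations $X$ on $\mathbb{D}$, and $\mathbb{P}_{K_{\mathbb{D}}}$ is the determinantal point process induced by $K_{\mathbb{D}}$: the unique simple point process (Borel probability measure on $\mathrm{Conf}(\mathbb{D})$) whose $n$-th correlation function with respect to $dA$ is $\det(K_{\mathbb{D}}(x_i,x_j))_{1\le i,j\le n}$ for all $n\ge1$. For a complex random variable $Y$, $\mathrm{Var}(Y)=\mathbb{E}|Y-\mathbb{E}Y|^2$. The Poincaré metric is $d_{\mathbb{D}}(x,z)=\log\frac{1+|\varphi_x(z)|}{1-|\varphi_x(z)|}$ with $\varphi_x(z)=\frac{z-x}{1-\bar x z}$. $\mathbb{N}=\{0,1,2,\dots\}$. For $k\in\mathbb{N}$, $z\in\mathbb{D}$: $\mathbb{A}_k(z)=\{x\in\mathbb{D}:k\le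 d_{\mathbb{D}}(z,x)<k+1\}$. A function $\Lambda:\mathbb{N}\to\mathbb{R}_+$ is sub-exponential if $\lim_{t\to\infty}\Lambda(t)e^{-\alpha t}=0$ for every $\alpha>0$. A harmonic $f:\mathbb{D}\to\mathbb{C}$ has sub-exponential mean-growth if there is a sub-exponential $\Lambda:\mathbb{N}\to\mathbb{R}_+$ with $\int_{\mathbb{A}_k(0)}|f(w)|^2\frac{dA(w)}{(1-|w|^2)^2}\le\Lambda(k)e^{2k}$ for all $k\in\mathbb{N}$. For $s>1$: $g_X(s,z;f)=\sum_{k=0}^\infty\ \sum_{x\in X\cap\mathbb{A}_k(z)}e^{-s d_{\mathbb{D}}(z,x)}f(x)$, where for fixed $f$ with sub-exponential mean-growth and fixed $s>1$, $z\in\mathbb{D}$, the outer series over $k$ converges absolutely for $\mathbb{P}_{K_{\mathbb{D}}}$-almost every $X$. *)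

(* Defs.v *)
From HB Require Import structures.
From mathcomp Require Import all_boot all_order all_algebra.
From mathcomp Require Import complex.
From mathcomp Require Import all_classical all_reals all_analysis.
From mathcomp Require Import measurable_realfun.

Set Implicit Arguments.
Unset Strict Implicit.
Unset Printing Implicit Defensive.

Import Order.TTheory GRing.Theory Num.Theory.
Import numFieldNormedType.Exports.

Local Open Scope classical_set_scope.
Local Open Scope complex_scope.
Local Open Scope ring_scope.

(* Points of the complex plane are pairs of reals, which carry the topology and
   the derivatives (R * R) and the Borel sets and Lebesgue measure (plane R,
   convertible to R * R); complex arithmetic takes place in R[i] via [cplx]. *)
Notation plane R := (measurableTypeR R * measurableTypeR R)%type.

Definition cplx (R : realType) (z : R * R) : R[i] := z.1 +i* z.2.

(* R-valued modulus; `|a| would live in R[i] *)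
Definition cmod (R : realType) (a : R[i]) : R := Normc.normc a.

Definition disk (R : realType) : set (R * R) := [set z | cmod (cplx z) < 1].
Arguments disk : clear implicits.

Definition plane_lebesgue (R : realType) : {measure set (plane R) -> \bar R} :=
  (@lebesgue_measure R \x @lebesgue_measure R)%E.

Lemma disk_area_inv_ge0 (R : realType) :
  0 <= (fine (plane_lebesgue R (disk R)))^-1.
Proof. by rewrite invr_ge0 fine_ge0. Qed.

(* dA; it is a measure on the whole plane, always integrated over subsets of
   the disk, which has dA-measure 1 *)
Definition dA (R : realType) : {measure set (plane R) -> \bar R} :=
  mscale (NngNum (disk_area_inv_ge0 R)) (plane_lebesgue R).
Arguments dA : clear implicits.

Definition bergman_kernel (R : realType) (z w : R * R) : R[i] :=
  ((1 - cplx z * (cplx w)^*) ^+ 2)^-1.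

Definition mobius (R : realType) (x z : R * R) : R[i] :=
  (cplx z - cplx x) / (1 - (cplx x)^* * cplx z).

Definition poincare_dist (R : realType) (x z : R * R) : R :=
  ln ((1 + cmod (mobius x z)) / (1 - cmod (mobius x z))).

Definition annulus (R : realType) (k : nat) (z : R * R) : set (R * R) :=
  [set x | disk R x /\ k%:R <= poincare_dist z x < k.+1%:R].

(* Locally finite subsets of the disk: multiplicities are excluded, so that
   every law on this space is a simple point process. *)
Record configuration (R : realType) := Configuration {
  points :> set (R * R);
  points_disk : points `<=` disk R;
  points_locally_finite : forall K : set (R * R),
    compact K -> K `<=` disk R -> finite_set (points `&` K)
}.

Lemma points0_locally_finite (R : realType) (K : set (R * R)) :
  compact K -> K `<=` disk R -> finite_set (set0 `&` K).
Proof. by move=> _ _; rewrite set0I. Qed.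

Definition configuration0 (R : realType) : configuration R :=
  Configuration (@sub0set _ (disk R)) (@points0_locally_finite R).

HB.instance Definition _ (R : realType) := gen_eqMixin (configuration R).
HB.instance Definition _ (R : realType) := gen_choiceMixin (configuration R).
HB.instance Definition _ (R : realType) :=
  isPointed.Build (configuration R) (configuration0 R).

(* The events "X has exactly n points in B", for B a relatively compact Borel
   subset of the disk; they generate the Borel sigma-algebra of the vague
   topology on the space of configurations. *)
Definition counting_events (R : realType) : set (set (configuration R)) :=
  [set E | exists (B : set (plane R)) (K : set (R * R)) (n : nat),
    [/\ measurable B, compact K, K `<=` disk R, B `<=` K &
        E = [set X : configuration R | (points X `&` B #= `I_n)%card]]].

Notation Conf R := (g_sigma_algebraType (@counting_events R)).

Fixpoint disk_iint (R : realType) (n : nat) :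
    (n.-tuple (plane R) -> \bar R) -> \bar R :=
  match n with
  | 0 => fun phi => phi [tuple]
  | n'.+1 => fun phi => (\int[dA R]_(x in disk R)
                           disk_iint (fun t => phi [tuple of x :: t]))%E
  end.

(* rho is the n-th correlation function of P with respect to dA *)
Definition is_correlation_function (R : realType)
    (P : probability (Conf R) R) (n : nat)
    (rho : n.-tuple (plane R) -> R) : Prop :=
  forall phi : n.-tuple (plane R) -> \bar R,
    measurable_fun [set: n.-tuple (plane R)] phi ->
    (forall t, (0 <= phi t)%E) ->
    (\int[P]_X (\esum_(t in [set t : n.-tuple (plane R) |
         uniq t /\ forall i, points X (tnth t i)]) phi t)
     = disk_iint (fun t => phi t * (rho t)%:E))%E.

(* For the hermitian kernels of interest the determinants are real, so that
   taking their real part loses nothing. *)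
Definition determinantal (R : realType) (K : R * R -> R * R -> R[i])
    (P : probability (Conf R) R) : Prop :=
  forall n : nat, (0 < n)%N ->
    @is_correlation_function R P n (fun t =>
      complex.Re (\det (\matrix_(i < n, j < n) K (tnth t i) (tnth t j)))).

Section ComplexVariance.
Variables (d : measure_display) (T : measurableType d) (R : realType).
Variable P : probability T R.
Local Open Scope ereal_scope.

Definition cexpectation (Y : T -> R[i]) : R[i] :=
  fine 'E_P[fun X => complex.Re (Y X)] +i*
  fine 'E_P[fun X => complex.Im (Y X)].

Definition cvariance (Y : T -> R[i]) : \bar R :=
  'E_P[fun X => (cmod (Y X - cexpectation Y) ^+ 2)%R].

End ComplexVariance.

Fixpoint C_on_disk (R : realType) (k : nat) (u : R * R -> R) : Prop :=
  (forall z, disk R z -> {for z, continuous u}) /\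
  match k with
  | 0 => True
  | k'.+1 => forall v : R * R, v = (1, 0) \/ v = (0, 1) ->
      (forall z, disk R z -> derivable u z v) /\
      C_on_disk k' (fun z => 'D_v u z)
  end.

Definition laplacian (R : realType) (u : R * R -> R) (z : R * R) : R :=
  'D_((1, 0) : R * R) (fun w => 'D_((1, 0) : R * R) u w) z +
  'D_((0, 1) : R * R) (fun w => 'D_((0, 1) : R * R) u w) z.

Definition real_harmonic (R : realType) (u : R * R -> R) : Prop :=
  C_on_disk 2 u /\ forall z, disk R z -> laplacian u z = 0.

(* Only the values of f on the disk matter, here and below. *)
Definition harmonic_on_disk (R : realType) (f : R * R -> R[i]) : Prop :=
  real_harmonic (fun z => complex.Re (f z)) /\
  real_harmonic (fun z => complex.Im (f z)).

Definition sub_exponential (R : realType) (L : nat -> R) : Prop :=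
  (forall t, 0 <= L t) /\
  forall a : R, 0 < a -> L t * expR (- a * t%:R) @[t --> \oo] --> 0.

Definition sub_exponential_mean_growth (R : realType) (f : R * R -> R[i]) :
    Prop :=
  exists L : nat -> R, sub_exponential L /\
    forall k : nat,
      (\int[dA R]_(w in annulus k (0%R, 0%R))
         (cmod (f w) ^+ 2 / (1 - cmod (cplx w) ^+ 2) ^+ 2)%:E
       <= (L k * expR (2 * k%:R))%:E)%E.

Definition g_term (R : realType) (s : R) (z : R * R) (f : R * R -> R[i])
    (X : configuration R) (k : nat) : R[i] :=
  \sum_(x \in points X `&` annulus k z)
    (expR (- s * poincare_dist z x))%:C * f x.

(* The sum of the complex series over k is taken componentwise; it has a
   default value for the (negligible) X for which the series diverges. *)
Definition g_series (R : realType) (s : R) (z : R * R) (f : R * R -> R[i])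
    (X : configuration R) : R[i] :=
  limn (series (fun k => complex.Re (g_term s z f X k))) +i*
  limn (series (fun k => complex.Im (g_term s z f X k))).

Definition weighted_norm2 (R : realType) (s : R) (f : R * R -> R[i]) : \bar R :=
  (\int[dA R]_(w in disk R)
     (cmod (f w) ^+ 2 * (1 - cmod (cplx w) ^+ 2) `^ (2 * s - 2))%:E)%E.

(* Main.v *)
Require Import Defs.
From HB Require Import structures.
From mathcomp Require Import all_boot all_order all_algebra.
From mathcomp Require Import complex.
From mathcomp Require Import all_classical all_reals all_analysis.
From mathcomp Require Import measurable_realfun ring lra.
Import Order.TTheory GRing.Theory Num.Theory.
Import numFieldNormedType.Exports.
Set Implicit Arguments.
Unset Strict Implicit.
Unset Printing Implicit Defensive.
Local Open Scope classical_set_scope.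
Local Open Scope ring_scope.

(** The variance and the weighted norm are both sums of the contributions of the real and
    imaginary parts of f, so f may be replaced by a real harmonic function u.

    For a bounded Borel function g vanishing outside a compact subset of the disk, let S_g be
    the sum of g over the points of the configuration. The first two correlation functions give
    Var S_g = V(g) - Q(g), where V(g) is the integral of g(x)^2 K(x,x) dA(x), the variance for
    a Poisson process, and Q(g) is the double integral of g(x) g(y) |K(x,y)|^2. The Schur test
    with the weight h(x) = sqrt(1 - |x|^2) bounds |Q(g)| by c V(g) with c = sqrt(4/5) < 1: its
    hypothesis, that the integral of |K(x,y)|^2 h(y) dA(y) is at most c h(x) K(x,x), is
    [bergman_schur], proved by expanding the kernel into powers. Hence Var S_g lies between
    (1 - c) V(g) and (1 + c) V(g), which is [lstat_variance].

    The k-th term of the series is S_g for the function g_k equal to exp(-s d(z,x)) u(x) on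
    the k-th hyperbolic shell. Its expectation is an integral of u against a radial function
    about z, so the mean value property over hyperbolic disks makes the expectations decay like
    exp(-(s - 1) k) ([gshell_mean_bound]). The growth hypothesis makes the sum of
    exp((s - 1) k) V(g_k) finite, so that a weighted Cauchy-Schwarz inequality dominates the
    squares of all centred partial sums by one integrable function: the series converges
    almost surely, and the variances of the partial sums converge to that of the series
    ([L2_series_limit]). As the shells are disjoint, the sum of the V(g_k) is the integral of
    exp(-2 s d(z,x)) u(x)^2 K(x,x) dA(x) ([shell_series_variance]). Finally exp(-d(z,x)) lies
    between two multiples of 1 - |x|^2 whose factors depend on z only, and as 2 s <= 4 the
    powers of these factors are bounded uniformly in s ([weighted_int_bounds]).

    The mean value property, also used for the orthogonality of the powers, is obtained without
    a change of variables. With phi the automorphism of the disk that maps z to 0 and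
    T = |phi|^2, Green's identity for u and (a - T)_+ ^ 3 relates the first two moments of
    (a - T)_+ for the measure u |phi'|^2 dw by 2 a I_1(a) = 3 I_2(a). Together with
    I_2' = 2 I_1 this gives I_2(a) = C a^3; differentiating twice, the mass of T <= a is
    proportional to a ([radial_mass]), so T maps u |phi'|^2 dw to a multiple of Lebesgue
    measure on [0, 1) ([radial_integral]). *)

(** * Green's identity in the unit disk *)

Section Deriv.
Variable R : realType.
Implicit Types (u : R * R -> R) (z w : R * R).

(** A criterion without difference quotients: for polynomials and truncated powers the
    remainder is explicit, and bounded by a multiple of h^2. *)
Lemma is_derive_quadratic (F : R -> R) (t l C : R) :
  (\forall h \near (0 : R), `|F (t + h) - F t - h * l| <= C * h ^+ 2) ->
  is_derive t 1 F l.
Proof.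
move=> H.
have L : h^-1 *: ((F \o shift t) (h *: (1 : R)) - F t) @[h --> 0^'] --> l.
  apply/cvgrPdist_le => e e0.
  have C1 : 0 < `|C| + 1 by rewrite ltr_wpDl.
  near=> h.
  have h0 : h != 0 by near: h; exact: nbhs_dnbhs_neq.
  have Hh : `|F (t + h) - F t - h * l| <= C * h ^+ 2.
    by near: h; apply: nbhs_dnbhs.
  have he : `|h| <= e / (`|C| + 1).
    by near: h; apply: dnbhs0_le; exact: divr_gt0.
  rewrite /= /shift /= -[h *: 1]/(h * 1) mulr1 [h + t]addrC.
  rewrite -[h^-1 *: _]/(h^-1 * _).
  have -> : l - h^-1 * (F (t + h) - F t) = - (h^-1 * (F (t + h) - F t - h * l)).
    by field.
  rewrite normrN normrM normfV ler_pdivrMl ?normr_gt0//.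
  rewrite (le_trans Hh)//.
  have -> : C * h ^+ 2 = `|h| * (C * `|h|) by rewrite -[h ^+ 2]real_normK ?num_real//; ring.
  rewrite ler_wpM2l//.
  rewrite ler_pdivlMr// in he.
  have := ler_norm C; have := normr_ge0 h; nra.
split.
  by apply/cvg_ex; exists l.
exact: cvg_lim L.
Unshelve. all: by end_near.
Qed.

Lemma is_derive_pos2 (t : R) :
  is_derive t 1 (fun t : R => Num.max t 0 ^+ 2) (2 * Num.max t 0).
Proof.
apply: (@is_derive_quadratic _ _ _ 1); near=> h.
rewrite mul1r ler_norml.
have [|] := lerP t 0; have [|] := lerP (t + h) 0 => h1 h2; 
  apply/andP; split; nra.
Unshelve. all: by end_near.
Qed.

Lemma is_derive_pos3 (t : R) :
  is_derive t 1 (fun t : R => Num.max t 0 ^+ 3) (3 * Num.max t 0 ^+ 2).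
Proof.
have -> : (fun t : R => Num.max t 0 ^+ 3) = (fun t => Num.max t 0 ^+ 2) * id.
  apply/funext => x; rewrite fctE /=; have [|] := lerP x 0 => _; ring.
apply: is_derive_eq.
  by apply: is_deriveM; exact: is_derive_pos2.
rewrite /= -![_ *: _]/(_ * _) mulr1; have [|] := lerP t 0 => _ /=; ring.
Qed.

(** Directional derivatives in the plane are ordinary derivatives along a line, where the
    fundamental theorem of calculus is available. *)
Lemma is_derive_slice1 u z : derivable u z ((1, 0) : R * R) ->
  is_derive z.1 1 (fun x => u (x, z.2)) ('D_((1, 0) : R * R) u z).
Proof.
have E : (fun h : R => h^-1 *: ((u \o shift z) (h *: ((1, 0) : R * R)) - u z)) =
  (fun h : R => h^-1 *: (((fun x => u (x, z.2)) \o shift z.1) (h *: (1 : R)) - u (z.1, z.2))).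
  apply/funext => h /=; rewrite /shift /=.
  congr (_ *: (u _ - u _)); last by case: z.
  by rewrite [LHS]surjective_pairing /= -[h *: 0]/(h * 0) mulr0 add0r.
rewrite /derivable /derive E => d; split => //.
Qed.

Lemma is_derive_slice2 u z : derivable u z ((0, 1) : R * R) ->
  is_derive z.2 1 (fun y => u (z.1, y)) ('D_((0, 1) : R * R) u z).
Proof.
have E : (fun h : R => h^-1 *: ((u \o shift z) (h *: ((0, 1) : R * R)) - u z)) =
  (fun h : R => h^-1 *: (((fun y => u (z.1, y)) \o shift z.2) (h *: (1 : R)) - u (z.1, z.2))).
  apply/funext => h /=; rewrite /shift /=.
  congr (_ *: (u _ - u _)); last by case: z.
  by rewrite [LHS]surjective_pairing /= -[h *: 0]/(h * 0) mulr0 add0r.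
rewrite /derivable /derive E => d; split => //.
Qed.

End Deriv.

Section Plane.
Variable R : realType.
Implicit Types (u : R * R -> R) (z w : R * R).

(** An open set is a countable union of boxes with rational centre and radius 1/(n+1), and
    boxes generate the product sigma-algebra. *)
Lemma open_plane_measurable (A : set (R * R)) :
  open A -> measurable (A : set (plane R)).
Proof.
move=> oA.
pose box (p q : rat) (n : nat) : set (plane R) :=
  (ball (ratr p : R) n.+1%:R^-1 : set (measurableTypeR R)) `*`
  (ball (ratr q : R) n.+1%:R^-1 : set (measurableTypeR R)).
have -> : A = \bigcup_p \bigcup_q \bigcup_n
    (if `[< box p q n `<=` A >] then box p q n else set0).
  apply/seteqP; split => [[x y] Axy|w [p _ [q _ [n _]]]]; last first.
    by case: asboolP => // + /= => /[apply].
  have /nbhs_ballP[e /= e0 He] := open_nbhs_nbhs (conj oA Axy).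
  have [n _ ne] : exists2 n, True & n.+1%:R^-1 < e / 2 :> R.
    have [n Hn] := ltr_add_invr (divr_gt0 e0 (ltr0n R 2)).
    by exists n => //; rewrite add0r in Hn.
  have n0 : 0 < n.+1%:R^-1 :> R by rewrite invr_gt0.
  have dense (c : R) : exists p : rat, ball (ratr p : R) n.+1%:R^-1 c.
    have [p] := rat_in_itvoo (ltr_pwDr n0 (lexx c)).
    rewrite in_itv /= => /andP[p1 p2]; exists p.
    by rewrite -ball_normE /ball_ /= ltr_norml ltrBlDl p2 (@lt_trans _ _ 0)// ?oppr_lt0// subr_gt0.
  have [p Hp] := dense x; have [q Hq] := dense y.
  exists p => //; exists q => //; exists n => //.
  rewrite asboolT //= => -[a b] [/= Ha Hb]; apply: He.
  split => /=.
    apply: (@le_ball _ _ _ (n.+1%:R^-1 + n.+1%:R^-1));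
      first by rewrite [leRHS]splitr lerD// ltW.
    by apply: ball_triangle Ha; exact: ball_sym.
  apply: (@le_ball _ _ _ (n.+1%:R^-1 + n.+1%:R^-1));
      first by rewrite [leRHS]splitr lerD// ltW.
  by apply: ball_triangle Hb; exact: ball_sym.
apply: bigcupT_measurable_rat => p; apply: bigcupT_measurable_rat => q.
apply: bigcupT_measurable => n; case: ifP => // _.
by apply: measurableX; exact: measurable_ball.
Qed.

Lemma continuous_plane_measurable_fun (D : set (R * R)) u :
  open D -> (forall z, D z -> {for z, continuous u}) ->
  measurable_fun (D : set (plane R)) (u : plane R -> R).
Proof.
move=> oD cu; apply: (measurability _ (RGenOpens.measurableE R)).
move=> _ [_ [a [b ->] <-]].
apply: open_plane_measurable.
rewrite openE => z [Dz uz]; rewrite /interior; apply: filterI.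
  exact: open_nbhs_nbhs.
apply: (cu z Dz); apply: open_nbhs_nbhs; split => //.
Qed.

Definition nrm2 w := w.1 ^+ 2 + w.2 ^+ 2.

Lemma nrm2_ge0 w : 0 <= nrm2 w.
Proof. by rewrite addr_ge0// sqr_ge0. Qed.

Lemma diskE w : disk R w <-> nrm2 w < 1.
Proof.
rewrite /disk /= /cmod /cplx /= -/(nrm2 w).
by rewrite -[X in Num.sqrt _ < X]sqrtr1 ltr_sqrt.
Qed.

Lemma mem_diskE w : (w \in disk R) = (nrm2 w < 1).
Proof. by apply/idP/idP; rewrite inE => /diskE. Qed.

Lemma continuous_nrm2 : continuous nrm2.
Proof.
move=> w; apply: cvgD; rewrite expr2; apply: cvgM;
  by [exact: cvg_fst|exact: cvg_snd].
Qed.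

Lemma open_disk : open (disk R).
Proof.
have -> : disk R = nrm2 @^-1` [set x | x < 1].
  by apply/seteqP; split => w /diskE.
by apply: open_comp; [move=> w _; exact: continuous_nrm2|exact: open_lt].
Qed.

Lemma compact_closed_disk (r : R) : compact [set w | nrm2 w <= r].
Proof.
apply: (@subclosed_compact _ _ (`[- (r + 1), r + 1] `*` `[- (r + 1), r + 1])).
- have -> : [set w | nrm2 w <= r] = nrm2 @^-1` [set x | x <= r] by [].
  by apply: closed_comp; [move=> w _; exact: continuous_nrm2|exact: closed_le].
- by apply: compact_setX; exact: segment_compact.
- move=> [x y] /=; rewrite /nrm2 /= => H; rewrite !in_itv /=.
  split; nra.
Qed.

Lemma measurable_disk : measurable (disk R : set (plane R)).
Proof. exact: open_plane_measurable open_disk. Qed.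

Lemma measurable_nrm2 : measurable_fun setT (nrm2 : plane R -> R).
Proof.
apply: measurable_funD; apply: measurable_funX;
  [exact: measurable_fst|exact: measurable_snd].
Qed.

Lemma measurable_ball_nrm2 (r : R) :
  measurable ([set w | nrm2 w <= r] : set (plane R)).
Proof.
have -> : [set w | nrm2 w <= r] = setT `&` nrm2 @^-1` `]-oo, r]%classic.
  by rewrite setTI; apply/seteqP; split => w /=; rewrite in_itv.
exact: measurable_nrm2.
Qed.

Lemma closed_disk_lty (r : R) :
  (plane_lebesgue R [set w | (nrm2 w <= r)%R] < +oo)%E.
Proof.
have sub : [set w | nrm2 w <= r] `<=`
    (`[- (r + 1), r + 1]%classic : set (measurableTypeR R)) `*`
    (`[- (r + 1), r + 1]%classic : set (measurableTypeR R)).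
  move=> [x y] /=; rewrite /nrm2 /= => H; rewrite !in_itv /=.
  split; nra.
apply: (@le_lt_trans _ _ (plane_lebesgue R
    ((`[- (r + 1), r + 1]%classic : set (measurableTypeR R)) `*`
    (`[- (r + 1), r + 1]%classic : set (measurableTypeR R))))).
  apply: (le_measure (plane_lebesgue R) _ _ sub); rewrite inE.
- exact: measurable_ball_nrm2.
- by apply: measurableX; exact: measurable_itv.
rewrite /plane_lebesgue /= product_measure1E/=; [|exact: measurable_itv..].
by rewrite lebesgue_measure_itv /=; case: ifPn => _; rewrite ?mule0// -EFinM ltry.
Qed.

Lemma integrable_continuous_disk (F : R * R -> R) (r : R) : r < 1 ->
  (forall w, disk R w -> {for w, continuous F}) ->
  (forall w, disk R w -> r < nrm2 w -> F w = 0) ->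
  (plane_lebesgue R).-integrable setT (EFin \o (F \_ (disk R))).
Proof.
move=> r1 cF F0.
pose K := [set w : R * R | nrm2 w <= r].
have KD : K `<=` disk R by move=> w Kw; apply/diskE; exact: le_lt_trans Kw r1.
have mK : measurable (K : set (plane R)) by exact: measurable_ball_nrm2.
have -> : F \_ (disk R) = F \_ K.
  apply/funext => w; rewrite !patchE; case: ifPn => [|/negP]; rewrite inE => Dw.
    by case: ifPn => // /negP; rewrite inE => /negP; rewrite -ltNge => /F0 ->.
  by case: ifPn => //; rewrite inE => /KD.
rewrite -restrict_EFin; apply/integrable_restrict => //; rewrite setTI.
apply: measurable_bounded_integrable => //.
- exact: closed_disk_lty.
- apply: measurable_funS KD _ => //; first exact: measurable_disk.
  exact: continuous_plane_measurable_fun open_disk cF.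
- have /compact_bounded[M [_ Mb]] : compact (F @` K).
    apply: continuous_compact; last exact: compact_closed_disk.
    apply: continuous_in_subspaceT => w; rewrite inE => /KD; exact: cF.
  by exists M; split; rewrite ?num_real// => x Mx w Kw; apply: Mb Mx _ _; exists w.
Qed.

(** The integrand is the derivative of g h' - g' h, which vanishes at both ends. *)
Lemma FTC_green_slice (b : R) (g g1 g2 h h1 h2 : R -> R) : 0 < b ->
  (forall x, -b <= x <= b -> is_derive x 1 g (g1 x)) ->
  (forall x, -b <= x <= b -> is_derive x 1 g1 (g2 x)) ->
  (forall x, -b <= x <= b -> is_derive x 1 h (h1 x)) ->
  (forall x, -b <= x <= b -> is_derive x 1 h1 (h2 x)) ->
  (forall x, -b <= x <= b -> {for x, continuous g2}) ->
  (forall x, -b <= x <= b -> {for x, continuous h2}) ->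
  h b = 0 -> h (- b) = 0 -> h1 b = 0 -> h1 (- b) = 0 ->
  (\int[lebesgue_measure]_(x in `[(- b)%R, b]) (g x * h2 x - g2 x * h x)%:E = 0)%E.
Proof.
move=> b0 dg dg1 dh dh1 cg2 ch2 hb hNb h1b h1Nb.
have C f f' x : is_derive x (1 : R) f f' -> {for x, continuous (f : R -> R)}.
  move=> d; apply: differentiable_continuous; apply/derivable1_diffP.
  exact: ex_derive.
have dF x : -b <= x <= b ->
    is_derive x 1 (g * h1 - g1 * h) (g x * h2 x - g2 x * h x).
  move=> xb; apply: is_derive_eq.
    apply: is_deriveB; apply: is_deriveM;
      [exact: dg|exact: dh1|exact: dg1|exact: dh].
  by rewrite /= -![_ *: _]/(_ * _); ring.
have CF x : -b <= x <= b -> {for x, continuous (g * h1 - g1 * h)}.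
  by move=> xb; exact: C (dF x xb).
rewrite (@continuous_FTC2 _ _ (g * h1 - g1 * h)).
- have E x : (g * h1 - g1 * h) x = g x * h1 x - g1 x * h x by [].
  by rewrite !E hb hNb h1b h1Nb !mulr0 subrr subee.
- by lra.
- apply: continuous_in_subspaceT => x; rewrite inE /= in_itv /= => xb.
  apply: cvgB; apply: cvgM; try exact: cg2; try exact: ch2.
    exact: C (dg _ xb).
  exact: C (dh _ xb).
- split.
  + move=> x; rewrite in_itv /= => /andP[x1 x2].
    by apply: ex_derive; apply: dF; rewrite !ltW.
  + by apply: cvg_at_right_filter; apply: CF; lra.
  + by apply: cvg_at_left_filter; apply: CF; lra.
- move=> x; rewrite in_itv /= => /andP[x1 x2].
  rewrite derive1E; apply: derive_val; apply: dF; by rewrite !ltW.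
Qed.

(** On the whole line, for a slice of the disk at height c. Since h vanishes where
    x^2 + c^2 > r, one may integrate over [-b, b], with b^2 + c^2 strictly between r and 1, so
    that the derivatives are only needed in the open disk. *)
Lemma green_slice (r c : R) (g g1 g2 h h1 h2 : R -> R) : r < 1 ->
  (forall x, x ^+ 2 + c ^+ 2 < 1 -> is_derive x 1 g (g1 x)) ->
  (forall x, x ^+ 2 + c ^+ 2 < 1 -> is_derive x 1 g1 (g2 x)) ->
  (forall x, x ^+ 2 + c ^+ 2 < 1 -> is_derive x 1 h (h1 x)) ->
  (forall x, x ^+ 2 + c ^+ 2 < 1 -> is_derive x 1 h1 (h2 x)) ->
  (forall x, x ^+ 2 + c ^+ 2 < 1 -> {for x, continuous g2}) ->
  (forall x, x ^+ 2 + c ^+ 2 < 1 -> {for x, continuous h2}) ->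
  (forall x, x ^+ 2 + c ^+ 2 < 1 -> r < x ^+ 2 + c ^+ 2 ->
     [/\ h x = 0, h1 x = 0 & h2 x = 0]) ->
  (\int[lebesgue_measure]_x (if (x ^+ 2 + c ^+ 2 < 1)%R
     then g x * h2 x - g2 x * h x else 0)%:E = 0)%E.
Proof.
move=> r1 dg dg1 dh dh1 cg2 ch2 h0.
have [yr|yr] := ltP (c ^+ 2) ((1 + r) / 2); last first.
  rewrite integral0_eq// => x _; congr (_%:E).
  case: ifPn => // Dw; have [||-> _ ->] := h0 x => //; last first.
    by rewrite !mulr0 subrr.
  by nra.
pose b := Num.sqrt ((1 + r) / 2 - c ^+ 2).
have b0 : 0 < b by rewrite sqrtr_gt0 subr_gt0.
have b2 : b ^+ 2 = (1 + r) / 2 - c ^+ 2 by rewrite sqr_sqrtr// subr_ge0 ltW.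
have inD x : - b <= x <= b -> x ^+ 2 + c ^+ 2 < 1.
  move=> /andP[x1 x2]; nra.
have Pb x : x ^+ 2 = b ^+ 2 -> h x = 0 /\ h1 x = 0.
  move=> xb; have Dx : x ^+ 2 + c ^+ 2 < 1 by nra.
  by have [|-> ->] := h0 _ Dx => //; nra.
have H : (\int[lebesgue_measure]_(x in `[(- b)%R, b])
    (g x * h2 x - g2 x * h x)%:E = 0)%E.
  apply: (@FTC_green_slice b g g1 g2 h h1 h2 b0) => //.
  - by move=> x /inD; exact: dg.
  - by move=> x /inD; exact: dg1.
  - by move=> x /inD; exact: dh.
  - by move=> x /inD; exact: dh1.
  - by move=> x /inD; exact: cg2.
  - by move=> x /inD; exact: ch2.
  - by have [] := Pb b erefl.
  - by have [] := Pb (- b) (sqrrN b).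
  - by have [] := Pb b erefl.
  - by have [] := Pb (- b) (sqrrN b).
rewrite -[RHS]H [RHS]integral_mkcond; apply: eq_integral => x _.
rewrite restrict_EFin /= patchE mem_setE.
case: ifPn => Dw; case: ifPn => //; rewrite in_itv /= => xb.
  have [||-> _ ->] := h0 x => //; last by rewrite !mulr0 subrr.
  by move: xb; rewrite negb_and -!ltNge => /orP[] xb; nra.
by rewrite inD in Dw.
Qed.

(** The regularity that Green's identity uses, slice by slice: no mixed derivatives, and the
    partial derivatives are named, so that a test function can provide them explicitly. *)
Record slice_C2 (u u1 u2 u11 u22 : R * R -> R) : Prop := SliceC2 {
  slice_d1 : forall z, disk R z ->
    is_derive z.1 1 (fun x => u (x, z.2)) (u1 z);
  slice_d11 : forall z, disk R z ->
    is_derive z.1 1 (fun x => u1 (x, z.2)) (u11 z);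
  slice_d2 : forall z, disk R z ->
    is_derive z.2 1 (fun y => u (z.1, y)) (u2 z);
  slice_d22 : forall z, disk R z ->
    is_derive z.2 1 (fun y => u2 (z.1, y)) (u22 z);
  slice_c : forall z, disk R z -> {for z, continuous u};
  slice_c11 : forall z, disk R z -> {for z, continuous u11};
  slice_c22 : forall z, disk R z -> {for z, continuous u22}
}.

Definition slice_harmonic (u : R * R -> R) : Prop :=
  exists u1 u2 u11 u22, slice_C2 u u1 u2 u11 u22 /\
    forall z, disk R z -> u11 z + u22 z = 0.

Lemma real_harmonic_slice u : real_harmonic u -> slice_harmonic u.
Proof.
move=> [[cu Hu] lapu].
have [du1 [cu1 Hu1]] := Hu (1, 0) (or_introl erefl).
have [du2 [cu2 Hu2]] := Hu (0, 1) (or_intror erefl).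
have [du11 [cu11 _]] := Hu1 (1, 0) (or_introl erefl).
have [du22 [cu22 _]] := Hu2 (0, 1) (or_intror erefl).
exists (fun w => 'D_((1, 0) : R * R) u w), (fun w => 'D_((0, 1) : R * R) u w),
  (fun z => 'D_((1, 0) : R * R) (fun w => 'D_((1, 0) : R * R) u w) z),
  (fun z => 'D_((0, 1) : R * R) (fun w => 'D_((0, 1) : R * R) u w) z).
split; last exact: lapu.
split.
- by move=> z Dz; apply: is_derive_slice1; exact: du1.
- by move=> z Dz; apply: is_derive_slice1; exact: du11.
- by move=> z Dz; apply: is_derive_slice2; exact: du2.
- by move=> z Dz; apply: is_derive_slice2; exact: du22.
- exact: cu.
- exact: cu11.
- exact: cu22.
Qed.

(** Green's second identity without boundary: by Fubini it follows from its version on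
    horizontal lines for the first pair of derivatives and on vertical lines for the second;
    the Laplacian of u then drops out. *)
Lemma green_identity (u P P1 P2 P11 P22 : R * R -> R) (r : R) : r < 1 ->
  slice_harmonic u -> slice_C2 P P1 P2 P11 P22 ->
  (forall z, disk R z -> r < nrm2 z ->
     [/\ P z = 0, P1 z = 0, P2 z = 0, P11 z = 0 & P22 z = 0]) ->
  (\int[plane_lebesgue R]_w
     (((fun w => (u w * (P11 w + P22 w))%R) \_ (disk R)) w)%:E = 0)%E.
Proof.
move=> r1 [u1 [u2 [u11 [u22 [[du1 du11 du2 du22 cu cu11 cu22] lapu]]]]].
move=> [dP1 dP11 dP2 dP22 cP cP11 cP22] P0.
have iP1 : (plane_lebesgue R).-integrable setT
    (EFin \o ((fun w => u w * P11 w - u11 w * P w) \_ (disk R))).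
  apply: (@integrable_continuous_disk _ r) => //.
    by move=> w Dw; apply: cvgB; apply: cvgM;
      [exact: cu|exact: cP11|exact: cu11|exact: cP].
  by move=> w Dw /(P0 w Dw)[-> _ _ -> _]; rewrite !mulr0 subrr.
have iP2 : (plane_lebesgue R).-integrable setT
    (EFin \o ((fun w => u w * P22 w - u22 w * P w) \_ (disk R))).
  apply: (@integrable_continuous_disk _ r) => //.
    by move=> w Dw; apply: cvgB; apply: cvgM;
      [exact: cu|exact: cP22|exact: cu22|exact: cP].
  by move=> w Dw /(P0 w Dw)[-> _ _ _ ->]; rewrite !mulr0 subrr.
have C1 (F : R * R -> R) x y : {for (x, y), continuous F} ->
    {for x, continuous (fun x => F (x, y))}.
  move=> cF; apply: (@cvg_comp _ _ _ (fun x => (x, y)) F); last exact: cF.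
  exact: (cvg_pair (@cvg_id _ _) (@cvg_cst _ _ _ _ _)).
have C2 (F : R * R -> R) x y : {for (x, y), continuous F} ->
    {for y, continuous (fun y => F (x, y))}.
  move=> cF; apply: (@cvg_comp _ _ _ (fun y => (x, y)) F); last exact: cF.
  exact: (cvg_pair (@cvg_cst _ _ _ _ _) (@cvg_id _ _)).
have inD x y : x ^+ 2 + y ^+ 2 < 1 -> disk R (x, y) by move=> ?; apply/diskE.
have patchD (F : R * R -> R) x y : (F \_ (disk R)) (x, y) =
    if x ^+ 2 + y ^+ 2 < 1 then F (x, y) else 0.
  by rewrite patchE mem_diskE.
have zero1 y : (\int[lebesgue_measure]_x
    (((fun w => u w * P11 w - u11 w * P w) \_ (disk R)) (x, y))%:E = 0)%E.
  under eq_integral do rewrite patchD.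
  apply: (@green_slice r y (fun x => u (x, y)) (fun x => u1 (x, y))
    (fun x => u11 (x, y)) (fun x => P (x, y)) (fun x => P1 (x, y))
    (fun x => P11 (x, y)) r1) => x /inD Dx.
  - exact: (du1 (x, y)).
  - exact: (du11 (x, y)).
  - exact: (dP1 (x, y)).
  - exact: (dP11 (x, y)).
  - by apply: C1; exact: cu11.
  - by apply: C1; exact: cP11.
  - by case/(P0 _ Dx) => h h' _ h'' _; split.
have zero2 x : (\int[lebesgue_measure]_y
    (((fun w => u w * P22 w - u22 w * P w) \_ (disk R)) (x, y))%:E = 0)%E.
  under eq_integral do rewrite patchD addrC.
  apply: (@green_slice r x (fun y => u (x, y)) (fun y => u2 (x, y))
    (fun y => u22 (x, y)) (fun y => P (x, y)) (fun y => P2 (x, y))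
    (fun y => P22 (x, y)) r1) => y; rewrite addrC => /inD Dx.
  - exact: (du2 (x, y)).
  - exact: (du22 (x, y)).
  - exact: (dP2 (x, y)).
  - exact: (dP22 (x, y)).
  - by apply: C2; exact: cu22.
  - by apply: C2; exact: cP22.
  - by case/(P0 _ Dx) => h _ h' _ h''; split.
transitivity (\int[plane_lebesgue R]_w
   ((((fun w => u w * P11 w - u11 w * P w) \_ (disk R)) w)%:E +
    (((fun w => u w * P22 w - u22 w * P w) \_ (disk R)) w)%:E))%E.
  apply: eq_integral => w _; rewrite -EFinD !patchE; congr (_%:E).
  case: ifPn; rewrite ?addr0// inE => /lapu => H.
  have -> : u22 w = - u11 w by move/eqP: H; rewrite addrC addr_eq0 => /eqP.
  ring.
rewrite integralD//.
rewrite -[X in (X + _ = _)%E](integral21_prod_meas1 iP1).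
rewrite -[X in (_ + X = _)%E](integral12_prod_meas1 iP2).
rewrite (eq_integral (cst 0%E)); last by move=> y _; exact: zero1.
rewrite integral0 add0e.
rewrite (eq_integral (cst 0%E)); last by move=> y _; exact: zero2.
by rewrite integral0.
Qed.

End Plane.

(** * The Moebius map and a compactly supported test function *)

Section MobiusMap.
Variable R : realType.
Implicit Types (z w : R * R).

(** For the disk automorphism phi_z(w) = (w - z) / (1 - conj z w): mobp = |w - z|^2 and
    mobq = |1 - conj z w|^2, so that mobT = |phi_z(w)|^2 and mobJ = |phi_z'(w)|^2. All of
    them are rational functions of the four real coordinates. *)
Definition mobp z w := (w.1 - z.1) ^+ 2 + (w.2 - z.2) ^+ 2.
Definition mobq z w :=
  (1 - z.1 * w.1 - z.2 * w.2) ^+ 2 + (z.1 * w.2 - z.2 * w.1) ^+ 2.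
Definition mobT z w := mobp z w / mobq z w.
Definition mobJ z w := ((1 - nrm2 z) / mobq z w) ^+ 2.

Lemma mobq_lb z w : nrm2 z < 1 -> nrm2 w < 1 ->
  (1 - nrm2 z) ^+ 2 / 4 <= mobq z w.
Proof.
rewrite /nrm2 /mobq; case: z => z1 z2; case: w => w1 w2 /= hz hw.
have h : (1 - (z1 ^+ 2 + z2 ^+ 2)) / 2 <= 1 - z1 * w1 - z2 * w2.
  have := sqr_ge0 (z1 - w1); have := sqr_ge0 (z2 - w2); nra.
have h1 : 0 <= (1 - (z1 ^+ 2 + z2 ^+ 2)) / 2 by lra.
have h2 := sqr_ge0 (z1 * w2 - z2 * w1).
nra.
Qed.

Lemma mobq_gt0 z w : nrm2 z < 1 -> nrm2 w < 1 -> 0 < mobq z w.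
Proof.
move=> hz hw; apply: lt_le_trans (mobq_lb hz hw).
by rewrite divr_gt0// exprn_gt0// subr_gt0.
Qed.

Lemma mobq_ub z w : nrm2 z < 1 -> nrm2 w < 1 -> mobq z w <= 4.
Proof.
rewrite /nrm2 /mobq; case: z => z1 z2; case: w => w1 w2 /= hz hw.
have := sqr_ge0 (z1 + w1); have := sqr_ge0 (z2 + w2).
have := sqr_ge0 z1; have := sqr_ge0 z2; have := sqr_ge0 w1; have := sqr_ge0 w2.
have -> : (1 - z1 * w1 - z2 * w2) ^+ 2 + (z1 * w2 - z2 * w1) ^+ 2 =
  1 - 2 * (z1 * w1 + z2 * w2) + (z1 ^+ 2 + z2 ^+ 2) * (w1 ^+ 2 + w2 ^+ 2) by ring.
nra.
Qed.

Lemma onem_mobT z w : nrm2 z < 1 -> nrm2 w < 1 ->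
  1 - mobT z w = (1 - nrm2 z) * (1 - nrm2 w) / mobq z w.
Proof.
move=> hz hw; have q0 := lt0r_neq0 (mobq_gt0 hz hw).
rewrite /mobT -[X in X - _](divff q0) -mulrBl; congr (_ / _).
by rewrite /mobp /mobq /nrm2; ring.
Qed.

Lemma mobT_ge0 z w : 0 <= mobT z w.
Proof. by rewrite divr_ge0// addr_ge0// sqr_ge0. Qed.

Lemma mobT_lt1 z w : nrm2 z < 1 -> nrm2 w < 1 -> mobT z w < 1.
Proof.
move=> hz hw; rewrite -subr_gt0 onem_mobT// divr_gt0 ?mulr_gt0 ?subr_gt0//.
exact: mobq_gt0.
Qed.

(** Square of the radius of a Euclidean disk about 0 that contains the hyperbolic disk
    mobT z w <= a. *)
Definition mobr (a : R) z := 1 - (1 - a) * (1 - nrm2 z) / 4.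

Lemma mobr_lt1 a z : a < 1 -> nrm2 z < 1 -> mobr a z < 1.
Proof. by move=> ha hz; rewrite /mobr ltrBlDr ltrDl divr_gt0// mulr_gt0// subr_gt0. Qed.

Lemma mobT_le_nrm2 a z w : a < 1 -> nrm2 z < 1 -> nrm2 w < 1 ->
  mobT z w <= a -> nrm2 w <= mobr a z.
Proof.
move=> ha hz hw hT; have q0 := mobq_gt0 hz hw.
have : (1 - a) * mobq z w <= (1 - nrm2 z) * (1 - nrm2 w).
  by rewrite -ler_pdivlMr// -onem_mobT// lerB.
have := mobq_lb hz hw; rewrite /mobr.
set q := mobq z w; set n := nrm2 z; set m := nrm2 w => h1 h2.
have n0 : 0 < 1 - n by rewrite subr_gt0.
suff : (1 - n) * ((1 - a) * (1 - n) / 4) <= (1 - n) * (1 - m).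
  by rewrite ler_pM2l//; lra.
apply: le_trans h2.
have -> : (1 - n) * ((1 - a) * (1 - n) / 4) = (1 - a) * ((1 - n) ^+ 2 / 4) by ring.
by rewrite ler_wpM2l// subr_ge0 ltW.
Qed.

(** Partial derivatives of mobp, mobq and mobT in the two coordinates of w. *)
Definition mobp1 z w := 2 * (w.1 - z.1).
Definition mobp2 z w := 2 * (w.2 - z.2).
Definition mobq1 z w := 2 * (nrm2 z * w.1 - z.1).
Definition mobq2 z w := 2 * (nrm2 z * w.2 - z.2).
Definition mobT1 z w :=
  (mobp1 z w * mobq z w - mobp z w * mobq1 z w) / mobq z w ^+ 2.
Definition mobT2 z w :=
  (mobp2 z w * mobq z w - mobp z w * mobq2 z w) / mobq z w ^+ 2.
Definition mobT11 z w := ((2 * mobq z w - mobp z w * (2 * nrm2 z)) * mobq z w -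
  2 * mobq1 z w * (mobp1 z w * mobq z w - mobp z w * mobq1 z w)) / mobq z w ^+ 3.
Definition mobT22 z w := ((2 * mobq z w - mobp z w * (2 * nrm2 z)) * mobq z w -
  2 * mobq2 z w * (mobp2 z w * mobq z w - mobp z w * mobq2 z w)) / mobq z w ^+ 3.

(** As phi_z is holomorphic, the gradient of |phi_z|^2 has squared length
    4 |phi_z|^2 |phi_z'|^2 and its Laplacian is 4 |phi_z'|^2. *)
Lemma mobT_grad2 z w : mobq z w != 0 ->
  mobT1 z w ^+ 2 + mobT2 z w ^+ 2 = 4 * mobT z w * mobJ z w.
Proof.
rewrite /mobT1 /mobT2 /mobT /mobJ => q0; apply/eqP; rewrite -subr_eq0.
set q := mobq z w in q0 *.
have -> : ((mobp1 z w * q - mobp z w * mobq1 z w) / q ^+ 2) ^+ 2 +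
    ((mobp2 z w * q - mobp z w * mobq2 z w) / q ^+ 2) ^+ 2 -
    4 * (mobp z w / q) * ((1 - nrm2 z) / q) ^+ 2 =
  ((mobp1 z w * q - mobp z w * mobq1 z w) ^+ 2 +
   (mobp2 z w * q - mobp z w * mobq2 z w) ^+ 2 -
   4 * mobp z w * q * (1 - nrm2 z) ^+ 2) / q ^+ 4 by field.
rewrite mulf_eq0; apply/orP; left; apply/eqP.
by rewrite /q /mobp1 /mobp2 /mobq1 /mobq2 /mobp /mobq /nrm2; ring.
Qed.

Lemma mobT_laplacian z w : mobq z w != 0 ->
  mobT11 z w + mobT22 z w = 4 * mobJ z w.
Proof.
rewrite /mobT11 /mobT22 /mobJ => q0; apply/eqP; rewrite -subr_eq0.
set q := mobq z w in q0 *.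
set A := (_ - _) / _; set B := (_ - _) / _.
have -> : A + B - 4 * ((1 - nrm2 z) / q) ^+ 2 =
  (A * q ^+ 3 + B * q ^+ 3 - 4 * (1 - nrm2 z) ^+ 2 * q) / q ^+ 3 by field.
rewrite mulf_eq0; apply/orP; left; apply/eqP.
rewrite /A /B !divfK ?expf_neq0//.
by rewrite /q /mobp1 /mobp2 /mobq1 /mobq2 /mobp /mobq /nrm2; ring.
Qed.

Lemma is_derive_div (f g : R -> R) (x df dg : R) : g x != 0 ->
  is_derive x 1 f df -> is_derive x 1 g dg ->
  is_derive x 1 (fun x => f x / g x) ((df * g x - f x * dg) / g x ^+ 2).
Proof.
move=> g0 hf hg.
have hV : is_derive x 1 (fun x => (g x)^-1) (- (g x) ^- 2 *: dg).
  exact: is_deriveV.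
have := is_deriveM hf hV => h; apply: is_derive_eq.
by rewrite /= -![_ *: _]/(_ * _); field.
Qed.

Lemma is_derive_quadr (F : R -> R) (t l C : R) :
  (forall h, F (t + h) - F t - h * l = C * h ^+ 2) -> is_derive t 1 F l.
Proof.
move=> H; apply: (@is_derive_quadratic _ _ _ _ `|C|); near=> h.
by rewrite H normrM normrX real_normK ?num_real.
Unshelve. all: by end_near.
Qed.

(** Both coordinates at once: along a line mobp and mobq are quadratic polynomials with
    second derivatives 2 and 2 |z|^2. *)
Lemma mobT_slice_derive (p p1 q q1 : R -> R) (m x : R) : q x != 0 ->
  (forall x : R, is_derive x 1 p (p1 x)) ->
  (forall x : R, is_derive x 1 q (q1 x)) ->
  (forall x : R, is_derive x 1 p1 2) ->
  (forall x : R, is_derive x 1 q1 (2 * m)) ->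
  is_derive x 1 (fun x => p x / q x) ((p1 x * q x - p x * q1 x) / q x ^+ 2) /\
  is_derive x 1 (fun x => (p1 x * q x - p x * q1 x) / q x ^+ 2)
    (((2 * q x - p x * (2 * m)) * q x -
       2 * q1 x * (p1 x * q x - p x * q1 x)) / q x ^+ 3).
Proof.
move=> q0 dp dq dp1 dq1; split; first exact: is_derive_div.
have dN : is_derive x 1 (fun x => p1 x * q x - p x * q1 x)
    (2 * q x - p x * (2 * m)).
  have h := is_deriveB (is_deriveM (dp1 x) (dq x)) (is_deriveM (dp x) (dq1 x)).
  by apply: is_derive_eq; rewrite -![_ *: _]/(_ * _); ring.
have dq2 : is_derive x 1 (fun x => q x ^+ 2) (2 * q x * q1 x).
  have h := is_deriveM (dq x) (dq x).
  have -> : (fun x => q x ^+ 2) = q * q by apply/funext => y; rewrite expr2.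
  by apply: is_derive_eq; rewrite -![_ *: _]/(_ * _); ring.
have h := @is_derive_div _ (fun x => q x ^+ 2) _ _ _ (expf_neq0 2 q0) dN dq2.
by apply: is_derive_eq; field.
Qed.

Lemma mobT_slice1 z w : mobq z w != 0 ->
  is_derive w.1 1 (fun x => mobT z (x, w.2)) (mobT1 z w) /\
  is_derive w.1 1 (fun x => mobT1 z (x, w.2)) (mobT11 z w).
Proof.
case: w => w1 w2 /= q0.
apply: (@mobT_slice_derive (fun x => mobp z (x, w2)) (fun x => mobp1 z (x, w2))
  (fun x => mobq z (x, w2)) (fun x => mobq1 z (x, w2)) (nrm2 z) w1 q0) => x.
- by apply: (@is_derive_quadr _ _ _ 1) => h; rewrite /mobp /mobp1 /=; ring.
- apply: (@is_derive_quadr _ _ _ (nrm2 z)) => h.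
  by rewrite /mobq /mobq1 /nrm2 /=; ring.
- by apply: (@is_derive_quadr _ _ _ 0) => h; rewrite /mobp1 /=; ring.
- by apply: (@is_derive_quadr _ _ _ 0) => h; rewrite /mobq1 /=; ring.
Qed.

Lemma mobT_slice2 z w : mobq z w != 0 ->
  is_derive w.2 1 (fun x => mobT z (w.1, x)) (mobT2 z w) /\
  is_derive w.2 1 (fun x => mobT2 z (w.1, x)) (mobT22 z w).
Proof.
case: w => w1 w2 /= q0.
apply: (@mobT_slice_derive (fun x => mobp z (w1, x)) (fun x => mobp2 z (w1, x))
  (fun x => mobq z (w1, x)) (fun x => mobq2 z (w1, x)) (nrm2 z) w2 q0) => x.
- by apply: (@is_derive_quadr _ _ _ 1) => h; rewrite /mobp /mobp2 /=; ring.
- apply: (@is_derive_quadr _ _ _ (nrm2 z)) => h.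
  by rewrite /mobq /mobq2 /nrm2 /=; ring.
- by apply: (@is_derive_quadr _ _ _ 0) => h; rewrite /mobp2 /=; ring.
- by apply: (@is_derive_quadr _ _ _ 0) => h; rewrite /mobq2 /=; ring.
Qed.

(** Continuity at a point under a name of its own, so that the tactic below can recognize it
    and follow the structure of the expression. *)
Definition cont_at (w : R * R) (f : R * R -> R) := {for w, continuous f}.

Lemma cont_cst w (c : R) : cont_at w (fun=> c). Proof. exact: cvg_cst. Qed.
Lemma cont_fst w : cont_at w (fun w => w.1). Proof. exact: cvg_fst. Qed.
Lemma cont_snd w : cont_at w (fun w => w.2). Proof. exact: cvg_snd. Qed.
Lemma contD w f g : cont_at w f -> cont_at w g -> cont_at w (fun w => f w + g w).
Proof. by move=> cf cg; apply: cvgD. Qed.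
Lemma contN w f : cont_at w f -> cont_at w (fun w => - f w).
Proof. by move=> cf; apply: cvgN. Qed.
Lemma contM w f g : cont_at w f -> cont_at w g -> cont_at w (fun w => f w * g w).
Proof. by move=> cf cg; apply: cvgM. Qed.
Lemma contX w f n : cont_at w f -> cont_at w (fun w => f w ^+ n).
Proof.
move=> cf; elim: n => [|n IH]; first exact: cont_cst.
have -> : (fun w => f w ^+ n.+1) = (fun w => f w * f w ^+ n).
  by apply/funext => x; rewrite exprS.
exact: contM.
Qed.
Lemma contV w f : f w != 0 -> cont_at w f -> cont_at w (fun w => (f w)^-1).
Proof. by move=> f0 cf; apply: cvgV. Qed.
Lemma cont_pos w f : cont_at w f -> cont_at w (fun w => Num.max (f w) 0).
Proof.
move=> cf; have -> : (fun w => Num.max (f w) 0) =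
    (fun w => (f w + `|f w|) * 2^-1).
  apply/funext => x; have [h|h] := lerP (f x) 0.
    by rewrite ler0_norm// subrr mul0r.
  by rewrite gtr0_norm// mulrDl -splitr.
apply: contM; last exact: cont_cst.
by apply: contD => //; apply: cvg_norm.
Qed.
Lemma cont_comp w (g : R -> R) f : {for f w, continuous g} ->
  cont_at w f -> cont_at w (fun w => g (f w)).
Proof. by move=> cg cf; apply: (@cvg_comp _ _ _ f g) cf cg. Qed.

End MobiusMap.

Ltac cont := repeat (cbv beta; match goal with
  | |- cont_at _ (fun _ => ?c) => exact (@cont_cst _ _ c)
  | |- cont_at _ (fun w => @?f w + @?g w) => refine (@contD _ _ f g _ _)
  | |- cont_at _ (fun w => @?f w * @?g w) => refine (@contM _ _ f g _ _)
  | |- cont_at _ (fun w => - @?f w) => refine (@contN _ _ f _)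
  | |- cont_at _ (fun w => @?f w ^+ ?n) => refine (@contX _ _ f n _)
  | |- cont_at _ (fun w => (@?f w)^-1) => refine (@contV _ _ f _ _)
  | |- cont_at _ (fun w => Num.max (@?f w) 0) => refine (@cont_pos _ _ f _)
  | |- cont_at ?w ?g => let v := eval cbv beta in (g w) in
    match v with fst _ => exact (@cont_fst _ w) | snd _ => exact (@cont_snd _ w) end
  end).

Section MobiusContinuity.
Variable R : realType.
Implicit Types (z w : R * R).

Lemma cont_mobp z w : cont_at w (mobp z).
Proof. by rewrite /mobp; cont. Qed.
Lemma cont_mobq z w : cont_at w (mobq z).
Proof. by rewrite /mobq; cont. Qed.
Ltac contpq := repeat (cont; match goal with
  | |- cont_at ?w ?g => let v := eval cbv beta in (g w) in match v with
      mobp ?z _ => exact (@cont_mobp z w) | mobq ?z _ => exact (@cont_mobq z w) end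
  | |- is_true (_ != _) => by rewrite ?expf_neq0
  end).
Lemma cont_mobT z w : mobq z w != 0 -> cont_at w (mobT z).
Proof. by move=> q0; rewrite /mobT; contpq. Qed.
Lemma cont_mobJ z w : mobq z w != 0 -> cont_at w (mobJ z).
Proof. by move=> q0; rewrite /mobJ; contpq. Qed.
Lemma cont_mobT1 z w : mobq z w != 0 -> cont_at w (mobT1 z).
Proof. by move=> q0; rewrite /mobT1 /mobp1 /mobq1; contpq. Qed.
Lemma cont_mobT2 z w : mobq z w != 0 -> cont_at w (mobT2 z).
Proof. by move=> q0; rewrite /mobT2 /mobp2 /mobq2; contpq. Qed.
Lemma cont_mobT11 z w : mobq z w != 0 -> cont_at w (mobT11 z).
Proof. by move=> q0; rewrite /mobT11 /mobp1 /mobq1; contpq. Qed.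
Lemma cont_mobT22 z w : mobq z w != 0 -> cont_at w (mobT22 z).
Proof. by move=> q0; rewrite /mobT22 /mobp2 /mobq2; contpq. Qed.

Definition pos (t : R) := Num.max t 0.

Lemma is_derive_posT3 (f : R -> R) (x df ddf a : R) (f1 : R -> R) :
  is_derive x 1 f (f1 x) -> is_derive x 1 f1 ddf ->
  is_derive x 1 (fun x => pos (a - f x) ^+ 3) (- 3 * pos (a - f x) ^+ 2 * f1 x) /\
  is_derive x 1 (fun x => - 3 * pos (a - f x) ^+ 2 * f1 x)
    (6 * pos (a - f x) * f1 x ^+ 2 - 3 * pos (a - f x) ^+ 2 * ddf).
Proof.
move=> df1 df2.
have da : is_derive x 1 (fun x => a - f x) (- f1 x).
  have h := is_deriveB (is_derive_cst a x 1) df1.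
  by apply: is_derive_eq; rewrite sub0r.
split.
  have h := @is_derive1_comp _ (fun t => Num.max t 0 ^+ 3) (fun x => a - f x) _ _ _
    (is_derive_pos3 (a - f x)) da.
  by apply: (is_derive_eq h); rewrite /pos; ring.
have h2 := @is_derive1_comp _ (fun t => Num.max t 0 ^+ 2) (fun x => a - f x) _ _ _
    (is_derive_pos2 (a - f x)) da.
have h := is_deriveM (is_deriveM (is_derive_cst (-3 : R) x 1) h2) df2.
by apply: (is_derive_eq h); rewrite -![_ *: _]/(_ * _) /pos /cst !fctE /=; ring.
Qed.

(** The cube makes the truncation twice continuously differentiable. *)
Lemma mob_test_slice_C2 z (a : R) : nrm2 z < 1 -> slice_C2
  (fun w => pos (a - mobT z w) ^+ 3)
  (fun w => - 3 * pos (a - mobT z w) ^+ 2 * mobT1 z w)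
  (fun w => - 3 * pos (a - mobT z w) ^+ 2 * mobT2 z w)
  (fun w => 6 * pos (a - mobT z w) * mobT1 z w ^+ 2 -
            3 * pos (a - mobT z w) ^+ 2 * mobT11 z w)
  (fun w => 6 * pos (a - mobT z w) * mobT2 z w ^+ 2 -
            3 * pos (a - mobT z w) ^+ 2 * mobT22 z w).
Proof.
move=> hz.
have q0 w : disk R w -> mobq z w != 0.
  by move=> /diskE hw; rewrite gt_eqF// mobq_gt0.
split.
- move=> [w1 w2] Dw; have [d1 d11] := mobT_slice1 (q0 _ Dw).
  by have [] := @is_derive_posT3 (fun x => mobT z (x, w2)) w1 0 _ a _ d1 d11.
- move=> [w1 w2] Dw; have [d1 d11] := mobT_slice1 (q0 _ Dw).
  by have [] := @is_derive_posT3 (fun x => mobT z (x, w2)) w1 0 _ a _ d1 d11.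
- move=> [w1 w2] Dw; have [d1 d11] := mobT_slice2 (q0 _ Dw).
  by have [] := @is_derive_posT3 (fun x => mobT z (w1, x)) w2 0 _ a _ d1 d11.
- move=> [w1 w2] Dw; have [d1 d11] := mobT_slice2 (q0 _ Dw).
  by have [] := @is_derive_posT3 (fun x => mobT z (w1, x)) w2 0 _ a _ d1 d11.
- by move=> w /q0 Dw; rewrite -/(cont_at _ _) /pos; cont; exact: cont_mobT.
- by move=> w /q0 Dw; rewrite -/(cont_at _ _) /pos; cont; 
    [exact: cont_mobT|exact: cont_mobT1|exact: cont_mobT|exact: cont_mobT11].
- by move=> w /q0 Dw; rewrite -/(cont_at _ _) /pos; cont; 
    [exact: cont_mobT|exact: cont_mobT2|exact: cont_mobT|exact: cont_mobT22].
Qed.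

Lemma slice_harmonic_affine (k c : R) u :
  slice_harmonic u -> slice_harmonic (fun w => k * u w + c).
Proof.
move=> [u1 [u2 [u11 [u22 [[d1 d11 d2 d22 cu cu11 cu22] lap]]]]].
exists (fun w => k * u1 w), (fun w => k * u2 w),
  (fun w => k * u11 w), (fun w => k * u22 w).
have A (f : R -> R) (x df : R) : is_derive x 1 f df ->
    is_derive x 1 (fun x => k * f x + c) (k * df).
  move=> h; have h1 := is_deriveD (is_deriveM (is_derive_cst k x 1) h)
    (is_derive_cst c x 1).
  by apply: (is_derive_eq h1); rewrite -![_ *: _]/(_ * _) /cst /=; ring.
have A0 (f : R -> R) (x df : R) : is_derive x 1 f df ->
    is_derive x 1 (fun x => k * f x) (k * df).
  move=> h; have h1 := is_deriveM (is_derive_cst k x 1) h.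
  by apply: (is_derive_eq h1); rewrite -![_ *: _]/(_ * _) /cst /=; ring.
split; last by move=> z Dz; rewrite -mulrDr lap// mulr0.
split.
- by move=> z Dz; apply: A; exact: d1.
- by move=> z Dz; apply: A0; exact: d11.
- by move=> z Dz; apply: A; exact: d2.
- by move=> z Dz; apply: A0; exact: d22.
- move=> z Dz; apply: (@contD _ z (fun w => k * u w) (fun=> c)).
    by apply: (@contM _ z (fun=> k)); [exact: cont_cst|exact: cu].
  exact: cont_cst.
- by move=> z Dz; apply: (@contM _ z (fun=> k)); [exact: cont_cst|exact: cu11].
- by move=> z Dz; apply: (@contM _ z (fun=> k)); [exact: cont_cst|exact: cu22].
Qed.

Lemma mobr_support a z w : a < 1 -> nrm2 z < 1 -> disk R w ->
  mobr a z < nrm2 w -> pos (a - mobT z w) = 0.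
Proof.
move=> ha hz /diskE hw hr; apply/max_idPr; rewrite subr_le0 leNgt.
apply/negP => /ltW/(mobT_le_nrm2 ha hz hw); by rewrite leNgt hr.
Qed.

(** Green's identity against (a - T)_+ ^ 3, with T = mobT z. By the formulas for the gradient
    and the Laplacian of T, the Laplacian of this test function is 12 mobJ times
    2 T (a - T)_+ - (a - T)_+ ^ 2, and T (a - T)_+ = a (a - T)_+ - (a - T)_+ ^ 2. The outcome is
    a relation between the first two moments of (a - T)_+ for the measure u mobJ dw. *)
Lemma mob_moment_eq z (a : R) u : nrm2 z < 1 -> a < 1 -> slice_harmonic u ->
  (\int[plane_lebesgue R]_w
     (((fun w => (u w * mobJ z w * (2 * a * pos (a - mobT z w) -
        3 * pos (a - mobT z w) ^+ 2))%R) \_ (disk R)) w)%:E = 0)%E.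
Proof.
move=> hz ha hu.
(* dividing u by 12 removes the common factor of the Laplacian *)
have /= := @green_identity R _ _ _ _ _ _ _ (mobr_lt1 ha hz)
  (slice_harmonic_affine (12^-1) 0 hu) (mob_test_slice_C2 a hz).
move=> <-; last first.
  move=> w Dw hr; rewrite (mobr_support ha hz Dw hr) !expr0n /=.
  by rewrite !mulr0 !mul0r subrr; split.
apply: eq_integral => w _; congr (_%:E); rewrite !patchE mem_diskE.
case: ifPn => // hw; have q0 := lt0r_neq0 (mobq_gt0 hz hw).
have Jq := mobT_laplacian q0; have Tq := mobT_grad2 q0.
set p := pos _; have pT : p * mobT z w = p * (a - p).
  rewrite /p /pos; have [h|h] := lerP (a - mobT z w) 0; first by rewrite !mul0r.
  congr (_ * _); ring.
have -> : 6 * p * mobT1 z w ^+ 2 - 3 * p ^+ 2 * mobT11 z w +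
   (6 * p * mobT2 z w ^+ 2 - 3 * p ^+ 2 * mobT22 z w) =
   6 * p * (mobT1 z w ^+ 2 + mobT2 z w ^+ 2) -
   3 * p ^+ 2 * (mobT11 z w + mobT22 z w) by ring.
rewrite Jq Tq.
have -> : 6 * p * (4 * mobT z w * mobJ z w) - 3 * p ^+ 2 * (4 * mobJ z w) =
  24 * (p * mobT z w) * mobJ z w - 12 * p ^+ 2 * mobJ z w by ring.
by rewrite pT; field.
Qed.

End MobiusContinuity.

(** * The mean value property over hyperbolic disks *)

Section ODE.
Variable R : realType.

(** Halving the interval n times divides the bound on the increment by 2^n. *)
Lemma quadratic_increments_cst (G : R -> R) (K s t : R) :
  (forall x y, s <= x -> x <= y -> y <= t -> `|G y - G x| <= K * (y - x) ^+ 2) ->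
  s <= t -> G t = G s.
Proof.
move=> H st.
have B n : forall x y, s <= x -> x <= y -> y <= t ->
    `|G y - G x| <= K * (y - x) ^+ 2 / 2 ^+ n.
  elim: n => [|n IH] x y sx xy yt; first by rewrite expr0 divr1 H.
  pose m := (x + y) / 2.
  have -> : G y - G x = (G y - G m) + (G m - G x) by ring.
  apply: le_trans (ler_normD _ _) _.
  have h1 : `|G y - G m| <= K * (y - m) ^+ 2 / 2 ^+ n by apply: IH; rewrite /m; lra.
  have h2 : `|G m - G x| <= K * (m - x) ^+ 2 / 2 ^+ n by apply: IH; rewrite /m; lra.
  apply: le_trans (lerD h1 h2) _.
  rewrite le_eqVlt; apply/orP; left; apply/eqP.
  have e0 : (2 : R) ^+ n != 0 by rewrite expf_neq0.
  by rewrite [2 ^+ n.+1]exprS /m; move: (2 ^+ n) e0 => X X0; field.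
apply/eqP; rewrite -subr_eq0 -normr_le0; apply/ler_addgt0Pr => e e0; rewrite add0r.
pose k := K * (t - s) ^+ 2.
have [n ne] : exists n : nat, `|k| / e < n%:R.
  exists (Num.truncn (`|k| / e)).+1; exact: truncnS_gt.
apply: le_trans (B n s t _ _ _) _ => //.
have n2 : (n%:R : R) <= 2 ^+ n by rewrite -natrX ler_nat ltnW// ltn_expl.
rewrite ler_pdivrMr ?exprn_gt0//; apply: le_trans (ler_norm _) _.
rewrite -/k; rewrite ltr_pdivrMr// in ne.
by apply: le_trans (ltW ne) _; rewrite mulrC ler_wpM2l// ltW.
Qed.

(** I1 and I2 stand for the moments of order 1 and 2 of (a - T)_+. The inequalities in the
    second hypothesis say that I2' = 2 I1 without assuming any regularity; with
    2 a I1 = 3 I2 this is the equation a I2' = 3 I2, whose solutions are multiples of a^3.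
    Concretely, I2 / a^3 has quadratic increments on every [s, t] inside the interval. *)
Lemma cubic_growth (I1 I2 : R -> R) (a0 : R) :
  (forall a, 0 < a -> a < a0 -> 0 <= I2 a) ->
  (forall a b, 0 < a -> a < b -> b < a0 ->
     2 * (b - a) * I1 a <= I2 b - I2 a <= 2 * (b - a) * I1 b) ->
  (forall a, 0 < a -> a < a0 -> 2 * a * I1 a = 3 * I2 a) ->
  exists2 C, 0 <= C & forall a, 0 < a -> a < a0 -> I1 a = C * a ^+ 2.
Proof.
move=> I20 inc rel.
have I1E a : 0 < a -> a < a0 -> I1 a = 3 * I2 a / (2 * a).
  by move=> ha ha0; rewrite -rel//; field; rewrite gt_eqF.
have I10 a : 0 < a -> a < a0 -> 0 <= I1 a.
  by move=> ha ha0; rewrite I1E// divr_ge0// mulr_ge0 ?I20// ltW.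
have nd a b : 0 < a -> a <= b -> b < a0 -> I2 a <= I2 b.
  move=> ha; rewrite le_eqVlt => /orP[/eqP->//|ab] hb.
  have /andP[h _] := inc a b ha ab hb.
  have := I10 a ha (lt_trans ab hb) => h1.
  by rewrite -subr_ge0 (le_trans _ h)// !mulr_ge0// subr_ge0 ltW.
pose G a := I2 a / a ^+ 3.
have GE s t : 0 < s -> s <= t -> t < a0 -> G t = G s.
  move=> s0 st ta.
  apply: (@quadratic_increments_cst G (I2 t * (3 * t) / s ^+ 6)) => // x y sx xy yt.
  move: xy; rewrite le_eqVlt => /orP[/eqP->|xy].
    by rewrite !subrr normr0 expr0n mulr0.
  have x0 : 0 < x by lra.
  have y0 : 0 < y by lra.
  have ya : y < a0 by lra.
  have xa : x < a0 by lra.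
  have /andP[] := inc x y x0 xy ya; rewrite !I1E// => h1 h2.
  have xny : x != 0 by rewrite gt_eqF.
  have yny : y != 0 by rewrite gt_eqF.
  have sny : s != 0 by rewrite gt_eqF.
  have lo : - (I2 x * ((y - x) ^+ 2 * (y + 2 * x))) <= (G y - G x) * (x ^+ 3 * y ^+ 3).
    have -> : (G y - G x) * (x ^+ 3 * y ^+ 3) =
      (I2 y - I2 x - 2 * (y - x) * (3 * I2 x / (2 * x))) * x ^+ 3
       - I2 x * ((y - x) ^+ 2 * (y + 2 * x)) by rewrite /G; field; rewrite xny yny.
    by rewrite lerBrDr addNr mulr_ge0 ?subr_ge0// exprn_ge0// ltW.
  have hi : (G y - G x) * (x ^+ 3 * y ^+ 3) <= I2 y * ((y - x) ^+ 2 * (x + 2 * y)).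
    have -> : (G y - G x) * (x ^+ 3 * y ^+ 3) =
      I2 y * ((y - x) ^+ 2 * (x + 2 * y)) -
      (2 * (y - x) * (3 * I2 y / (2 * y)) - (I2 y - I2 x)) * y ^+ 3
       by rewrite /G; field; rewrite xny yny.
    by rewrite lerBlDr lerDl mulr_ge0 ?subr_ge0// exprn_ge0// ltW.
  have xy3 : 0 < x ^+ 3 * y ^+ 3 by rewrite mulr_gt0// exprn_gt0.
  have s6 : s ^+ 6 <= x ^+ 3 * y ^+ 3.
    have -> : s ^+ 6 = s ^+ 3 * s ^+ 3 by ring.
    have sx3 : s ^+ 3 <= x ^+ 3 by rewrite lerXn2r ?nnegrE//; lra.
    have sy3 : s ^+ 3 <= y ^+ 3 by rewrite lerXn2r ?nnegrE//; lra.
    by rewrite ler_pM// exprn_ge0// ltW.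
  have I2y : 0 <= I2 y by rewrite I20.
  have I2x : 0 <= I2 x by rewrite I20.
  have I2xy : I2 x <= I2 y by apply: nd => //; exact: ltW.
  have I2yt : I2 y <= I2 t by apply: nd.
  have sq := sqr_ge0 (y - x).
  have key : `|(G y - G x) * (x ^+ 3 * y ^+ 3)| <= I2 t * (3 * t) * (y - x) ^+ 2.
    have B c : 0 <= c -> c <= 3 * t -> forall i, 0 <= i -> i <= I2 t ->
        i * ((y - x) ^+ 2 * c) <= I2 t * (3 * t) * (y - x) ^+ 2.
      move=> c0 ct i i0 it.
      have -> : i * ((y - x) ^+ 2 * c) = (i * c) * (y - x) ^+ 2 by ring.
      by rewrite ler_wpM2r// ler_pM.
    rewrite ler_norml; apply/andP; split.
      apply: le_trans lo; rewrite lerN2; apply: B => //; lra.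
    by apply: le_trans hi _; apply: B => //; lra.
  rewrite normrM (gtr0_norm xy3) in key.
  have -> : I2 t * (3 * t) / s ^+ 6 * (y - x) ^+ 2 =
    I2 t * (3 * t) * (y - x) ^+ 2 / s ^+ 6 by field.
  rewrite ler_pdivlMr ?exprn_gt0//; apply: le_trans key.
  by rewrite ler_wpM2l.
have [a00|a00] := ltP 0 a0; last first.
  by exists 0 => // a ha haa; exfalso; have := lt_trans ha haa; rewrite ltNge a00.
exists (3 / 2 * G (a0 / 2)); first by rewrite mulr_ge0// divr_ge0// ?I20 ?exprn_ge0//; lra.
move=> a ha haa.
have -> : G (a0 / 2) = G a.
  by have [h|h] := leP (a0 / 2) a; [rewrite (GE (a0 / 2) a)|rewrite (GE a (a0 / 2))]; lra.
by rewrite I1E// /G; field; rewrite gt_eqF.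
Qed.

(** The same with one derivative less: M, the moment of order 0, is squeezed between the
    difference quotients of I1 = C a^2. *)
Lemma linear_growth (I1 M : R -> R) (C a0 : R) :
  (forall a, 0 < a -> a < a0 -> I1 a = C * a ^+ 2) ->
  (forall a b, 0 < a -> a < b -> b < a0 ->
     (b - a) * M a <= I1 b - I1 a <= (b - a) * M b) ->
  forall a, 0 < a -> a < a0 -> M a = 2 * C * a.
Proof.
move=> I1E inc.
have S a b : 0 < a -> a < b -> b < a0 -> M a <= C * (a + b) <= M b.
  move=> ha ab hb; have := inc a b ha ab hb; rewrite !I1E//; last lra; last lra.
  have -> : C * b ^+ 2 - C * a ^+ 2 = (b - a) * (C * (a + b)) by ring.
  by rewrite !ler_pM2l// subr_gt0.
move=> a ha haa; apply/eqP; rewrite eq_le; apply/andP; split.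
  apply/ler_addgt0Pr => e e0.
  pose d := Num.min ((a0 - a) / 2) (e / (`|C| + 1)).
  have C1 : 0 < `|C| + 1 by rewrite ltr_wpDl.
  have d0 : 0 < d by rewrite lt_min !divr_gt0// subr_gt0.
  have d1 : d <= (a0 - a) / 2 by rewrite ge_min lexx.
  have d2 : d <= e / (`|C| + 1) by rewrite ge_min lexx orbT.
  rewrite ler_pdivlMr// in d2.
  have /andP[h _] : M a <= C * (a + (a + d)) <= M (a + d) by apply: S; lra.
  by apply: le_trans h _; have := ler_norm C; nra.
apply/ler_addgt0Pr => e e0.
pose d := Num.min (a / 2) (e / (`|C| + 1)).
have C1 : 0 < `|C| + 1 by rewrite ltr_wpDl.
have d0 : 0 < d by rewrite lt_min !divr_gt0.
have d1 : d <= a / 2 by rewrite ge_min lexx.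
have d2 : d <= e / (`|C| + 1) by rewrite ge_min lexx orbT.
rewrite ler_pdivlMr// in d2.
have /andP[_ h] : M (a - d) <= C * (a - d + a) <= M a by apply: S; lra.
by rewrite -lerBlDr; apply: le_trans h; have := ler_norm C; nra.
Qed.

End ODE.

Section Density.
Local Open Scope ereal_scope.
Context d (T : measurableType d) (R : realType).
Variables (mu : {measure set T -> \bar R}) (f : T -> R).

Definition density (mf : measurable_fun setT f) (f0 : forall x, (0 <= f x)%R)
  (A : set T) := \int[mu]_(x in A) (f x)%:E.

Hypotheses (mf : measurable_fun setT f) (f0 : forall x, (0 <= f x)%R).

Let density0 : density mf f0 set0 = 0.
Proof. exact: integral_set0. Qed.

Let density_ge0 A : 0 <= density mf f0 A.
Proof. by apply: integral_ge0 => x _; rewrite lee_fin. Qed.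

Let mEf : measurable_fun setT (EFin \o f).
Proof. exact/measurable_EFinP. Qed.

Let density_sigma_additive : semi_sigma_additive (density mf f0).
Proof. by apply: semi_sigma_additive_nng_induced => // x; rewrite lee_fin. Qed.

HB.instance Definition _ := isMeasure.Build _ _ _ (density mf f0)
  density0 density_ge0 density_sigma_additive.

Import HBNNSimple.

(** True for simple functions by definition of the density, hence for all by monotone
    convergence. *)
Lemma ge0_integral_density (g : T -> \bar R) :
  measurable_fun setT g -> (forall x, 0 <= g x) ->
  \int[density mf f0]_x g x = \int[mu]_x (g x * (f x)%:E).
Proof.
move=> mg g0.
pose h := nnsfun_approx measurableT mg.
have hg x : (h n x)%:E @[n --> \oo] --> g x.
  by apply: cvg_nnsfun_approx => // y _; exact: g0.
have nd x m n : (m <= n)%N -> (h m x <= h n x)%R.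
  by move=> mn; exact/lefP/nd_nnsfun_approx.
transitivity (limn (fun n => \int[density mf f0]_x (h n x)%:E)).
  rewrite -monotone_convergence//.
  - by apply: eq_integral => x _; apply/esym/cvg_lim => //; exact: hg.
  - by move=> n; exact/measurable_EFinP.
  - by move=> n x _; rewrite lee_fin.
  - by move=> x _ m n mn; rewrite lee_fin nd.
transitivity (limn (fun n => \int[mu]_x ((h n x)%:E * (f x)%:E))); last first.
  rewrite -monotone_convergence//.
  - apply: eq_integral => x _; apply/cvg_lim => //.
    by apply: cvgeZr; [|exact: hg].
  - move=> n; apply: emeasurable_funM => //; exact/measurable_EFinP.
  - by move=> n x _; rewrite mule_ge0// lee_fin.
  - by move=> x _ m n mn; rewrite lee_wpmul2r ?lee_fin ?nd.
apply/congr_lim/funext => n.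
transitivity (\sum_(y \in range (h n)) y%:E * density mf f0 (h n @^-1` [set y])).
  under eq_integral do rewrite fimfunE -fsumEFin//.
  rewrite ge0_integral_fsum//; last 2 first.
  - by move=> y; exact/measurable_EFinP/measurable_funM.
  - by move=> y x _; rewrite nnfun_muleindic_ge0.
  apply: eq_fsbigr => r _; rewrite integralZl_indic_nnsfun// integral_indic//=.
  by rewrite setIT.
under [RHS]eq_integral => x _.
  rewrite fimfunE -fsumEFin// ge0_mule_fsuml => [|y]; last exact: nnfun_muleindic_ge0.
  over.
rewrite ge0_integral_fsum//; last 2 first.
- by move=> y; apply: emeasurable_funM => //; exact/measurable_EFinP/measurable_funM.
- by move=> y x _; rewrite mule_ge0 ?nnfun_muleindic_ge0// lee_fin.
apply: eq_fsbigr => r rhn.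
under [RHS]eq_integral do rewrite EFinM -muleA.
rewrite ge0_integralZl//.
- congr (_ * _); rewrite /density integral_mkcond; apply: eq_integral => x _.
  rewrite restrict_EFin -EFinM; congr _%:E.
  by rewrite patchE indicE; case: ifPn => _; rewrite ?mul1r ?mul0r.
- by apply: emeasurable_funM => //; exact/measurable_EFinP.
- by move=> t _; rewrite mule_ge0 ?lee_fin.
- by move: rhn; rewrite inE => -[t _ <-]; rewrite lee_fin.
Qed.

End Density.

Section MeanValue.
Variable R : realType.
Implicit Types (z w : R * R).
Local Notation mu := (plane_lebesgue R).

(** Since mobJ z is the Jacobian of phi_z, the integral of radf u z phi is the integral of
    u against phi(|phi_z(w)|^2) in the coordinate phi_z(w): a radial average of u about z. *)
Definition radf (u : R * R -> R) z (phi : R -> R) : R * R -> R :=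
  (fun w => u w * mobJ z w * phi (mobT z w)) \_ (disk R).
Definition radint u z phi : R := \int[mu]_w (radf u z phi w).

Lemma patch_diskE (F : R * R -> R) w :
  (F \_ (disk R)) w = if nrm2 w < 1 then F w else 0.
Proof. by rewrite patchE mem_diskE. Qed.

Lemma measurable_mobT z : nrm2 z < 1 ->
  measurable_fun (disk R : set (plane R)) (mobT z : plane R -> R).
Proof.
move=> hz; apply: continuous_plane_measurable_fun; first exact: open_disk.
move=> w /diskE hw; apply: cont_mobT; by rewrite gt_eqF// mobq_gt0.
Qed.

Lemma measurable_mobJ z : nrm2 z < 1 ->
  measurable_fun (disk R : set (plane R)) (mobJ z : plane R -> R).
Proof.
move=> hz; apply: continuous_plane_measurable_fun; first exact: open_disk.
move=> w /diskE hw; apply: cont_mobJ; by rewrite gt_eqF// mobq_gt0.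
Qed.

Definition cont_disk (u : R * R -> R) :=
  forall w, disk R w -> {for w, continuous u}.

Lemma measurable_cont_disk u (D : set (R * R)) : cont_disk u -> D `<=` disk R ->
  measurable_fun (D : set (plane R)) (u : plane R -> R).
Proof.
move=> cu DD; apply: measurable_funS DD _; first exact: measurable_disk.
exact: continuous_plane_measurable_fun (@open_disk R) cu.
Qed.

Lemma measurable_radf u z phi : nrm2 z < 1 -> cont_disk u ->
  measurable_fun setT phi -> measurable_fun setT (radf u z phi : plane R -> R).
Proof.
move=> hz cu mphi; apply/(measurable_restrictT _ (@measurable_disk R)).
apply: measurable_funM; last first.
  apply: (measurable_comp (F := setT)) => //; exact: measurable_mobT.
apply: measurable_funM; last exact: measurable_mobJ.
exact: measurable_cont_disk.
Qed.

Lemma mobJ_ge0 z w : 0 <= mobJ z w.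
Proof. exact: sqr_ge0. Qed.

(** phi vanishes beyond a and is bounded by M, hence it is dominated by the multiple
    M / (b - a) of the continuous function (b - t)_+ as soon as a < b. *)
Lemma integrable_radf u z (phi : R -> R) (a M : R) : nrm2 z < 1 -> a < 1 -> cont_disk u ->
  measurable_fun setT phi -> (forall t : R, a < t -> phi t = 0) ->
  (forall t : R, `|phi t| <= M) ->
  mu.-integrable setT (EFin \o radf u z phi).
Proof.
move=> hz ha cu mphi phi0 phiM.
pose b := (1 + a) / 2.
have ab : a < b by rewrite /b; lra.
have b1 : b < 1 by rewrite /b; lra.
pose k := M / (b - a).
have ik : mu.-integrable setT
    (EFin \o ((fun w => `|u w| * mobJ z w * (k * pos (b - mobT z w))) \_ (disk R))).
  apply: (@integrable_continuous_disk _ _ (mobr b z)).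
  - exact: mobr_lt1.
  - move=> w Dw; have hw := (diskE w).1 Dw.
    have q0 : mobq z w != 0 by rewrite gt_eqF// mobq_gt0.
    rewrite -/(cont_at w _) /pos; cont.
    + by apply: (@cvg_norm _ _ _ (nbhs w)); exact: cu.
    + exact: cont_mobJ.
    + exact: cont_mobT.
  - by move=> w Dw hr; rewrite (mobr_support b1 hz Dw hr) !mulr0.
apply: le_integrable ik => //.
  by apply/measurable_EFinP; exact: measurable_radf.
move=> w _ /=; rewrite lee_fin /radf !patch_diskE; case: ifPn => hw; last by rewrite !normr0.
have M0 : 0 <= M by apply: le_trans (phiM 0); exact: normr_ge0.
have k0 : 0 <= k by rewrite divr_ge0// subr_ge0 ltW.
rewrite [leRHS]ger0_norm; last first.
  by rewrite mulr_ge0// mulr_ge0// ?mobJ_ge0// /pos le_max lexx orbT.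
rewrite 2!normrM (ger0_norm (mobJ_ge0 _ _)).
apply: ler_wpM2l; first by apply: mulr_ge0 => //; exact: mobJ_ge0.
have [hT|hT] := ltP a (mobT z w).
  by rewrite phi0// normr0 mulr_ge0// /pos le_max lexx orbT.
apply: le_trans (phiM _) _.
rewrite /k mulrAC ler_pdivlMr ?subr_gt0// ler_wpM2l// /pos le_max; lra.
Qed.

Lemma integrable_radfB u z phi psi : mu.-integrable setT (EFin \o radf u z phi) ->
  mu.-integrable setT (EFin \o radf u z psi) ->
  mu.-integrable setT (EFin \o radf u z (fun t => phi t - psi t)).
Proof.
move=> h1 h2; apply: eq_integrable (integrableB measurableT h1 h2) => // w _ /=.
by rewrite -EFinB /radf !patch_diskE; congr (_%:E); case: ifPn => _; ring.
Qed.

Lemma integrable_radfZ u z phi k : mu.-integrable setT (EFin \o radf u z phi) ->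
  mu.-integrable setT (EFin \o radf u z (fun t => k * phi t)).
Proof.
move=> h1; apply: eq_integrable (integrableZl measurableT k h1) => // w _ /=.
by rewrite -EFinM /radf !patch_diskE; congr (_%:E); case: ifPn => _; ring.
Qed.

Lemma radintB u z phi psi : mu.-integrable setT (EFin \o radf u z phi) ->
  mu.-integrable setT (EFin \o radf u z psi) ->
  radint u z (fun t => phi t - psi t) = radint u z phi - radint u z psi.
Proof.
move=> h1 h2; rewrite /radint -RintegralB//.
apply: eq_Rintegral => w _; rewrite /radf !patch_diskE; case: ifPn => _; ring.
Qed.

Lemma radintZ u z phi k : mu.-integrable setT (EFin \o radf u z phi) ->
  radint u z (fun t => k * phi t) = k * radint u z phi.
Proof.
move=> h1; rewrite /radint -RintegralZl//.
apply: eq_Rintegral => w _; rewrite /radf !patch_diskE; case: ifPn => _; ring.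
Qed.

Lemma le_radint u z phi psi : mu.-integrable setT (EFin \o radf u z phi) ->
  mu.-integrable setT (EFin \o radf u z psi) ->
  (forall w, nrm2 w < 1 ->
     u w * mobJ z w * phi (mobT z w) <= u w * mobJ z w * psi (mobT z w)) ->
  radint u z phi <= radint u z psi.
Proof.
move=> h1 h2 H; apply: le_Rintegral => // w _.
by rewrite /radf !patch_diskE; case: ifPn => // /H.
Qed.

Lemma measurable_pos_sub (a : R) : measurable_fun setT (fun t : R => pos (a - t)).
Proof. by apply: measurable_maxr => //; apply: measurable_funB. Qed.

Lemma pos_ge0 (t : R) : 0 <= pos t.
Proof. by rewrite /pos le_max lexx orbT. Qed.

Definition indle (a : R) : R -> R := \1_(`]-oo, a]%classic).

Lemma indleE (a t : R) : indle a t = (t <= a)%R%:R.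
Proof. by rewrite /indle indicE mem_setE in_itv. Qed.

Lemma measurable_indle a : measurable_fun setT (indle a).
Proof. by apply: measurable_indic; exact: measurable_itv. Qed.

Lemma integrable_radf_indle u z a : nrm2 z < 1 -> a < 1 -> cont_disk u ->
  mu.-integrable setT (EFin \o radf u z (indle a)).
Proof.
move=> hz ha cu; apply: (@integrable_radf _ _ _ a 1) => //.
- exact: measurable_indle.
- by move=> t; rewrite indleE ltNge; case: (t <= a).
- by move=> t; rewrite indleE; case: (t <= a); rewrite ?normr1 ?normr0.
Qed.

(** The moments of order 2, 1 and 0 of (a - T)_+ under the measure u mobJ dw, positive on
    T < a0, satisfy the hypotheses of the two growth lemmas: the inequalities between
    increments hold pointwise, and the relation between orders 1 and 2 is Green's identity. *)
Lemma radial_mass u z (a0 : R) : nrm2 z < 1 -> a0 <= 1 -> slice_harmonic u ->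
  (forall w, nrm2 w < 1 -> mobT z w < a0 -> 0 <= u w) ->
  exists2 C, 0 <= C &
    forall a, 0 < a -> a < a0 -> radint u z (indle a) = C * a.
Proof.
move=> hz ha0 hu u0.
have cu : cont_disk u by case: hu => ? [? [? [? [[]]]]].
(* (a - t)_+ is bounded only for t >= 0, hence the inner positive part *)
pose P n (a : R) t := pos (a - pos t) ^+ n.
have mP n a : measurable_fun setT (P n a).
  apply: measurable_funX; apply: (measurableT_comp (measurable_pos_sub a)).
  exact: measurable_maxr.
have iP n a : (0 < n)%N -> a < a0 -> mu.-integrable setT (EFin \o radf u z (P n a)).
  move=> n0 haa; apply: (@integrable_radf _ _ _ a (pos a ^+ n)) => //.
  - exact: lt_le_trans haa ha0.
  - move=> t tat; rewrite /P; have -> : pos (a - pos t) = 0; last by rewrite expr0n; case: n n0.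
    apply/max_idPr; rewrite subr_le0 /pos le_max ltW//.
  - move=> t; rewrite ger0_norm ?exprn_ge0 ?pos_ge0//.
    apply: lerXn2r; rewrite ?nnegrE ?pos_ge0//.
    by rewrite /pos ge_max !le_max lexx orbT gerBl le_max lexx orbT.
have icut a : a < a0 -> mu.-integrable setT (EFin \o radf u z (indle a)).
  by move=> haa; apply: integrable_radf_indle => //; exact: lt_le_trans haa ha0.
pose I1 a := radint u z (P 1%N a); pose I2 a := radint u z (P 2%N a).
have uJ w t : nrm2 w < 1 -> mobT z w < a0 -> 0 <= t -> 0 <= u w * mobJ z w * t.
  by move=> hw hT t0; have h := u0 w hw hT; rewrite mulr_ge0// mulr_ge0// mobJ_ge0.
have mono phi psi b : b < a0 ->
    mu.-integrable setT (EFin \o radf u z phi) ->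
    mu.-integrable setT (EFin \o radf u z psi) ->
    (forall t, 0 <= t -> t <= b -> phi t <= psi t) ->
    (forall t, b < t -> phi t = 0 /\ psi t = 0) ->
    radint u z phi <= radint u z psi.
  move=> hb i1 i2 le out; apply: le_radint => // w hw.
  have [hT|hT] := leP (mobT z w) b; last by have [-> ->] := out _ hT.
  rewrite -subr_ge0 -mulrBr; apply: uJ => //; first exact: le_lt_trans hb.
  by rewrite subr_ge0 le// mobT_ge0.
have P0 n a t : (0 < n)%N -> a < t -> P n a t = 0.
  move=> n0 tat; rewrite /P; have -> : pos (a - pos t) = 0.
    by apply/max_idPr; rewrite subr_le0 /pos le_max ltW.
  by rewrite expr0n; case: n n0.
have PE n a t : 0 <= t -> P n a t = pos (a - t) ^+ n.
  by move=> t0; rewrite /P; have -> : pos t = t by exact/max_idPl.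
have cut0 a t : a < t -> indle a t = 0 by rewrite indleE ltNge; case: (t <= a).
have rel a : 0 < a -> a < a0 -> 2 * a * I1 a = 3 * I2 a.
  move=> ha haa; apply/eqP; rewrite -subr_eq0; apply/eqP.
  rewrite -radintZ ?iP// -radintZ ?iP// -radintB ?integrable_radfZ ?iP//.
  rewrite /radint /Rintegral.
  have := mob_moment_eq hz (lt_le_trans haa ha0) hu => H.
  rewrite -[RHS]/(fine 0%E) -[in RHS]H; congr fine.
  apply: eq_integral => w _; rewrite /radf !patch_diskE; congr (_%:E).
  by case: ifPn => // _; rewrite !PE ?mobT_ge0// expr1.
have [C C0 I1E] : exists2 C, 0 <= C &
    forall a, 0 < a -> a < a0 -> I1 a = C * a ^+ 2.
  apply: (@cubic_growth _ I1 I2) => //.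
    move=> a ha haa; apply: Rintegral_ge0 => w _; rewrite /radf patch_diskE.
    case: ifPn => // hw; have [hT|hT] := ltP a (mobT z w); first by rewrite P0// mulr0.
    by apply: uJ => //; [exact: le_lt_trans haa|rewrite exprn_ge0// pos_ge0].
  move=> a b ha ab hb.
  have haa : a < a0 by exact: lt_trans hb.
  rewrite -radintB ?iP// -!radintZ ?iP//.
  apply/andP; split; apply: (mono _ _ b) => //;
    try (by apply: integrable_radfZ; exact: iP);
    try (by apply: integrable_radfB; exact: iP).
  - move=> t t0 tb; rewrite !PE// /pos.
    have [|] := lerP (a - t) 0; have [|] := lerP (b - t) 0; nra.
  - by move=> t tb; rewrite !P0// ?mulr0 ?subrr//; exact: lt_trans tb.
  - move=> t t0 tb; rewrite !PE// /pos.
    have [|] := lerP (a - t) 0; have [|] := lerP (b - t) 0; nra.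
  - by move=> t tb; rewrite !P0// ?mulr0 ?subrr//; exact: lt_trans tb.
exists (2 * C); first by rewrite mulr_ge0.
apply: (@linear_growth _ I1 (fun a => radint u z (indle a)) C a0 I1E).
move=> a b ha ab hb.
have haa : a < a0 by exact: lt_trans hb.
rewrite -radintB ?iP// -!radintZ ?icut//.
apply/andP; split; apply: (mono _ _ b) => //;
  try (by apply: integrable_radfZ; exact: icut);
  try (by apply: integrable_radfB; exact: iP).
- move=> t t0 tb; rewrite !PE// !expr1 indleE /pos.
  have [h1|h1] := lerP (a - t) 0; have [h2|h2] := lerP (b - t) 0;
    case: (lerP t a) => h3 /=; rewrite ?mulr1 ?mulr0; lra.
- by move=> t tb; rewrite !P0// ?cut0 ?mulr0 ?subrr//; exact: lt_trans tb.
- move=> t t0 tb; rewrite !PE// !expr1 indleE tb /pos.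
  have [h1|h1] := lerP (a - t) 0; have [h2|h2] := lerP (b - t) 0;
    rewrite /= mulr1; lra.
- by move=> t tb; rewrite !P0// ?cut0 ?mulr0 ?subrr//; exact: lt_trans tb.
Qed.

Lemma radf_ge0 u z (a0 a : R) w : a < a0 ->
  (forall w, nrm2 w < 1 -> mobT z w < a0 -> 0 <= u w) ->
  0 <= radf u z (indle a) w.
Proof.
move=> haa u0; rewrite /radf patch_diskE; case: ifPn => // hw.
rewrite indleE; have [h|h] := leP (mobT z w) a; last by rewrite mulr0.
by rewrite mulr1 mulr_ge0 ?mobJ_ge0// u0//; exact: le_lt_trans haa.
Qed.

(** A total version, because the pushforward requires a function measurable on the whole
    plane. *)
Definition mobT0 z : R * R -> R := mobT z \_ (disk R).

Lemma measurable_mobT0 z : nrm2 z < 1 ->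
  measurable_fun setT (mobT0 z : plane R -> R).
Proof.
by move=> hz; apply/(measurable_restrictT _ (@measurable_disk R)); exact: measurable_mobT.
Qed.

Lemma mobT0_ge0 z w : 0 <= mobT0 z w.
Proof. by rewrite /mobT0 patch_diskE; case: ifPn => // _; exact: mobT_ge0. Qed.

(** By the previous lemma, the image under T of u mobJ dw, cut off at T <= a, gives the
    intervals ]-oo, t[ the same mass as C times Lebesgue measure on [0, a]; so the two measures
    coincide. *)
Lemma radial_integral_ge0 u z (a0 : R) : nrm2 z < 1 -> a0 <= 1 -> slice_harmonic u ->
  (forall w, nrm2 w < 1 -> mobT z w < a0 -> 0 <= u w) ->
  exists2 C, 0 <= C &
    forall (a : R) (F : R -> \bar R), 0 < a -> a < a0 ->
    measurable_fun setT F -> (forall t, 0 <= F t)%E ->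
    (\int[mu]_w (F (mobT0 z w) * (radf u z (indle a) w)%:E) =
     C%:E * \int[lebesgue_measure]_(t in `[0%R, a]) F t)%E.
Proof.
move=> hz ha0 hu u0.
have cu : cont_disk u by case: hu => ? [? [? [? [[]]]]].
have [C C0 HC] := radial_mass hz ha0 hu u0.
exists C => // a F a00 haa mF F0.
have mf : measurable_fun setT (radf u z (indle a) : plane R -> R).
  by apply: measurable_radf => //; exact: measurable_indle.
have f0 w : 0 <= radf u z (indle a) w by exact: radf_ge0 haa u0.
have icut b : b < a0 -> mu.-integrable setT (EFin \o radf u z (indle b)).
  by move=> hb; apply: integrable_radf_indle => //; exact: lt_le_trans hb ha0.
have cutI b : 0 < b -> b < a0 -> (\int[mu]_w (radf u z (indle b) w)%:E = (C * b)%:E)%E.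
  move=> hb hb0; rewrite -HC// /radint /Rintegral fineK//.
  exact: integrable_fin_num (icut b hb0).
have mT0 := measurable_mobT0 hz.
pose nu0 : {measure set (measurableTypeR R) -> \bar R} :=
  pushforward (density mu mf f0) (mobT0 z : plane R -> measurableTypeR R).
pose nu := nu0 mT0.
have mi : measurable_fun setT (\1_(`[0%R, a]%classic) : measurableTypeR R -> R).
  by apply: measurable_indic; exact: measurable_itv.
have i0 (x : measurableTypeR R) : 0 <= (\1_(`[0%R, a]%classic) x : R) by [].
pose nu2 : {measure set (measurableTypeR R) -> \bar R} :=
  mscale (NngNum C0) (density (@lebesgue_measure R) mi i0).
have nu2E' A : measurable A -> nu2 A = (C%:E * lebesgue_measure (A `&` `[0%R, a]%classic))%E.
  move=> mA; by rewrite /nu2 /= /mscale /= /density integral_indic// setIC.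
have radf_le b c w : b <= c -> c < a0 -> radf u z (indle b) w <= radf u z (indle c) w.
  move=> bc hc; rewrite /radf !patch_diskE; case: ifPn => // hw.
  rewrite !indleE; have [hb|hb] := leP (mobT z w) b.
    by rewrite (le_trans hb bc).
  rewrite mulr0; have [h|h] := leP (mobT z w) c; rewrite ?mulr0// mulr1.
  by rewrite mulr_ge0 ?mobJ_ge0// u0//; exact: le_lt_trans h hc.
have mrad b : measurable_fun setT (EFin \o (radf u z (indle b) : plane R -> R)).
  apply/measurable_EFinP; apply: measurable_radf => //; exact: measurable_indle.
have mpre t : measurable ((mobT0 z : plane R -> R) @^-1` `]-oo, t[%classic).
  by rewrite -[X in measurable X]setTI; apply (mT0 measurableT); exact: measurable_itv.
have nuE t : 0 < t -> (\int[mu]_(w in (mobT0 z : plane R -> R) @^-1` `]-oo, t[)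
    (radf u z (indle a) w)%:E = (C * Num.min t a)%:E)%E.
  move=> t0; set m := Num.min t a.
  have m0 : 0 < m by rewrite lt_min t0.
  have ma : m <= a by rewrite ge_min lexx orbT.
  set r := (X in X = _).
  have hi : (r <= (C * m)%:E)%E.
    rewrite -cutI//; last exact: le_lt_trans haa.
    rewrite /r integral_mkcond; apply: ge0_le_integral => //; try exact: mrad.
    - move=> w _; rewrite patchE; case: ifPn => _ //; rewrite lee_fin; exact: f0.
    - apply/(measurable_restrictT _ (mpre t)); exact: measurable_funTS (mrad a).
    - move=> w _; rewrite patchE; case: ifPn => [|_]; last first.
        rewrite lee_fin; apply: radf_ge0 u0; exact: le_lt_trans haa.
      rewrite inE /= in_itv /= => hT; rewrite lee_fin.
      move: hT; rewrite /mobT0 /radf !patch_diskE; case: ifPn => // hw hT.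
      rewrite !indleE /m le_min (ltW hT) /=; exact: lexx.
  (* T < t against T <= t: approach t from below *)
  have lo s : 0 < s -> s < m -> ((C * s)%:E <= r)%E.
    move=> s0 sm; have sa : s < a by exact: lt_le_trans ma.
    have st : s < t by apply: lt_le_trans sm _; rewrite ge_min lexx.
    rewrite -cutI//; last exact: lt_trans haa.
    rewrite /r [leRHS]integral_mkcond; apply: ge0_le_integral => //; try exact: mrad.
    - by move=> w _; rewrite lee_fin; apply: radf_ge0 u0; exact: lt_trans haa.
    - apply/(measurable_restrictT _ (mpre t)); exact: measurable_funTS (mrad a).
    - move=> w _; rewrite patchE; case: ifPn => [_|].
        by rewrite lee_fin radf_le// ltW.
      rewrite notin_setE /= in_itv /= => /negP; rewrite -leNgt => hT.
      move: hT; rewrite /mobT0 /radf !patch_diskE; case: ifPn => // hw hT.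
      by have -> : indle s (mobT z w) = 0;
        rewrite ?mulr0// indleE leNgt (lt_le_trans st hT).
  have r0 : (0 <= r)%E by apply: integral_ge0 => w _; rewrite lee_fin.
  case: r hi lo r0 => [r| |]; [|by rewrite leye_eq|by []].
  rewrite !lee_fin => hi lo r0; congr (_%:E); apply/eqP; rewrite eq_le hi /= leNgt.
  apply/negP => rC.
  have C1 : 0 < C.
    by rewrite lt_neqAle C0 andbT; apply/eqP => C00; rewrite -C00 mul0r ltNge r0 in rC.
  pose s := (r / C + m) / 2.
  have rCm : r / C < m by rewrite ltr_pdivrMr// mulrC.
  have rC0 : 0 <= r / C by rewrite divr_ge0// ltW.
  have : C * s <= r by rewrite -lee_fin lo// /s; lra.
  have -> : C * s = (r + C * m) / 2 by rewrite /s; field; rewrite gt_eqF.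
  by lra.
have nuE' t : 0 < t -> nu `]-oo, t[%classic = (C * Num.min t a)%:E by exact: nuE.
have nu2E t : 0 < t -> (nu2 `]-oo, t[%classic = (C * Num.min t a)%:E)%E.
  move=> t0; rewrite nu2E'; last exact: measurable_itv.
  rewrite EFinM; congr (_ * _)%E.
  have [ta|ta] := ltP t a.
    have -> : `]-oo, t[%classic `&` `[0, a]%classic = `[0, t[%classic :> set R.
      apply/seteqP; split => x /=; rewrite !in_itv /=; first by case => xt /andP[-> _].
      by move=> /andP[-> xt]; split => //; exact/ltW/(lt_trans xt).
    by rewrite lebesgue_measure_itv /= lte_fin t0 oppr0 adde0.
  have [ta'|ta'] := eqVneq t a.
    rewrite ta'; have -> : `]-oo, a[%classic `&` `[0, a]%classic = `[0, a[%classic :> set R.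
      apply/seteqP; split => x /=; rewrite !in_itv /=; first by case => xt /andP[-> _].
      by move=> /andP[-> xt]; split => //; exact/ltW.
    by rewrite lebesgue_measure_itv /= lte_fin a00 oppr0 adde0.
  have -> : `]-oo, t[%classic `&` `[0, a]%classic = `[0, a]%classic :> set R.
    apply/seteqP; split => x /=; rewrite !in_itv /=; first by case.
    move=> /andP[-> xa]; split => //; apply: le_lt_trans xa _.
    by rewrite lt_neqAle eq_sym ta' ta.
  by rewrite lebesgue_measure_itv /= lte_fin a00 oppr0 adde0.
have key A : measurable A -> nu A = nu2 A.
  apply: (@measure_unique _ R (measurableTypeR R) (@RGenInftyO.G R) (fun n => `]-oo, n%:R[%classic)).
  - exact: RGenInftyO.measurableE.
  - move=> X Y [x ->] [y ->]; exists (Num.min x y).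
    by apply/seteqP; split => t /=; rewrite !in_itv /= lt_min; [move=> [-> ->]|move=> /andP[]].
  - by move=> n; exists n%:R.
  - rewrite -subTset => x _; exists (Num.truncn `|x|).+1 => //=; rewrite in_itv /=.
    by apply: le_lt_trans (ler_norm x) _; exact: truncnS_gt.
  - move=> _ [t ->]; have [t0|t0] := ltP 0 t.
      by rewrite nu2E// -nuE.
    have -> : nu2 `]-oo, t[%classic = 0%E.
      rewrite nu2E'; last exact: measurable_itv.
      have -> : `]-oo, t[%classic `&` `[0, a]%classic = set0 :> set R.
        rewrite -subset0 => x /=; rewrite !in_itv /= => -[xt /andP[x0 _]].
        by have := le_lt_trans x0 xt; rewrite ltNge t0.
      by rewrite measure0 mule0.
    rewrite /nu /nu0 /= /pushforward.
    have -> : (mobT0 z : plane R -> R) @^-1` `]-oo, t[%classic = set0; last exact: measure0.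
    rewrite -subset0 => w /=; rewrite in_itv /= => hT.
    by have := lt_le_trans hT t0; rewrite ltNge mobT0_ge0.
  - move=> n; case: n => [|n]; last by rewrite nuE'// ltry.
    rewrite /nu /nu0 /= /pushforward.
    have -> : (mobT0 z : plane R -> R) @^-1` `]-oo, 0%R[%classic = set0.
      rewrite -subset0 => w /=; rewrite in_itv /= => hT.
      by have := mobT0_ge0 z w; rewrite leNgt hT.
    by rewrite measure0.
have -> : (\int[mu]_w (F (mobT0 z w) * (radf u z (indle a) w)%:E) = \int[nu]_t F t)%E.
  rewrite ge0_integral_pushforward//.
  rewrite preimage_setT ge0_integral_density//; last by move=> x; exact: F0.
  exact: measurableT_comp.
rewrite (eq_measure_integral nu2); last by move=> A mA _; exact: key.
rewrite ge0_integral_mscale//=; congr (_ * _)%E.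
rewrite ge0_integral_density// [RHS]integral_mkcond; apply: eq_integral => x _.
by rewrite patchE indicE; case: ifPn => _; rewrite ?mule1 ?mule0.
Qed.

Lemma slice_harmonic_cst (c : R) : slice_harmonic (fun _ : R * R => c).
Proof.
exists (fun=> 0), (fun=> 0), (fun=> 0), (fun=> 0).
split; last by move=> *; rewrite addr0.
by split=> *; try exact: is_derive_cst; exact: cvg_cst.
Qed.

Lemma cont_disk_bounded u (r : R) : cont_disk u -> r < 1 ->
  exists2 M, 0 <= M & forall w, nrm2 w <= r -> `|u w| <= M.
Proof.
move=> cu r1; pose K := [set w : R * R | nrm2 w <= r].
have KD : K `<=` disk R by move=> w Kw; apply/diskE; exact: le_lt_trans Kw r1.
have /compact_bounded[M [_ Mb]] : compact (u @` K).
  apply: continuous_compact; last exact: compact_closed_disk.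
  by apply: continuous_in_subspaceT => w; rewrite inE => /KD; exact: cu.
exists (`|M| + 1); first by rewrite addr_ge0.
move=> w Kw; apply: (Mb (`|M| + 1)); last by exists w.
by apply: le_lt_trans (ler_norm _) _; rewrite ltrDl.
Qed.

Lemma lebesgue_cc0 (a : R) : 0 < a ->
  (lebesgue_measure (`[0%R, a]%classic : set (measurableTypeR R)) = a%:E)%E.
Proof. by move=> a0; rewrite lebesgue_measure_itv /= lte_fin a0 oppr0 adde0. Qed.

(** The mean value property: every radial integral of a harmonic function about z is the
    integral of the profile F times a constant that depends on u and z only. On a smaller disk
    u becomes positive after adding a constant M; both u + M and 1 are covered by the positive
    case. The constant found for the cutoff b is identified as twice the mass of T <= 1/2, and so
    does not depend on b. *)
Theorem radial_integral u z : nrm2 z < 1 -> slice_harmonic u ->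
  exists C : R, forall (a : R) (F : R -> R), 0 < a -> a < 1 ->
    measurable_fun setT F -> (forall t, 0 <= F t) ->
    (\int[lebesgue_measure]_(t in `[0%R, a]) (F t)%:E < +oo)%E ->
    mu.-integrable setT (fun w => (F (mobT0 z w) * radf u z (indle a) w)%:E) /\
    (\int[mu]_w (F (mobT0 z w) * radf u z (indle a) w)%:E =
     C%:E * \int[lebesgue_measure]_(t in `[0%R, a]) (F t)%:E)%E.
Proof.
move=> hz hu.
have cu : cont_disk u by case: hu => ? [? [? [? [[]]]]].
have local (a : R) : 0 < a -> a < 1 ->
    exists C : R, forall F : R -> R,
    measurable_fun setT F -> (forall t, 0 <= F t) ->
    (\int[lebesgue_measure]_(t in `[0%R, a]) (F t)%:E < +oo)%E ->
    mu.-integrable setT (fun w => (F (mobT0 z w) * radf u z (indle a) w)%:E) /\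
    (\int[mu]_w (F (mobT0 z w) * radf u z (indle a) w)%:E =
     C%:E * \int[lebesgue_measure]_(t in `[0%R, a]) (F t)%:E)%E.
  move=> a0 a1; pose b := (1 + a) / 2.
  have ab : a < b by rewrite /b; lra.
  have b1 : b < 1 by rewrite /b; lra.
  have [M M0 uM] := cont_disk_bounded cu (mobr_lt1 b1 hz).
  have uMb w : nrm2 w < 1 -> mobT z w < b -> 0 <= 1 * u w + M.
    move=> hw hT; have := uM w (mobT_le_nrm2 b1 hz hw (ltW hT)).
    by rewrite ler_norml mul1r => /andP[h _]; lra.
  have [C1 C10 H1] := radial_integral_ge0 hz
    (ltW b1) (slice_harmonic_affine 1 M hu) uMb.
  have [C2 C20 H2] := @radial_integral_ge0 (fun w => 1) z b hz
    (ltW b1) (slice_harmonic_cst 1) (fun _ _ _ => ler01).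
  exists (C1 - M * C2) => F mF F0 iF.
  set I := (\int[lebesgue_measure]_(t in _) _)%E in iF *.
  have I0 : (0 <= I)%E by apply: integral_ge0 => t _; rewrite lee_fin.
  have mEF : measurable_fun setT (EFin \o F) by exact/measurable_EFinP.
  have {}H1 := H1 a (EFin \o F) a0 ab mEF (fun t => F0 t).
  have {}H2 := H2 a (EFin \o F) a0 ab mEF (fun t => F0 t).
  have mFT : measurable_fun setT (fun w : plane R => F (mobT0 z w)).
    exact: (measurableT_comp mF (measurable_mobT0 hz)).
  have i1 (v : R * R -> R) (C : R) : 0 <= C -> cont_disk v ->
     (forall w, nrm2 w < 1 -> mobT z w < b -> 0 <= v w) ->
     (\int[mu]_w ((F (mobT0 z w))%:E * (radf v z (indle a) w)%:E) = C%:E * I)%E ->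
     mu.-integrable setT (fun w => (F (mobT0 z w) * radf v z (indle a) w)%:E).
    move=> C0 cv v0 HI; apply/integrableP; split.
      apply/measurable_EFinP; apply: measurable_funM => //.
      by apply: measurable_radf => //; exact: measurable_indle.
    under eq_integral => w _.
      rewrite gee0_abs ?lee_fin ?mulr_ge0 ?(radf_ge0 _ ab v0)// EFinM.
      over.
    by rewrite -[ltLHS]/(\int[mu]_w ((F (mobT0 z w))%:E * (radf v z (indle a) w)%:E))%E HI lte_mul_pinfty// lee_fin.
  have cst_cont (c : R) : cont_disk (fun _ => c) by move=> w _; exact: cvg_cst.
  have j2 := i1 (fun=> 1) _ C20 (cst_cont 1) (fun _ _ _ => ler01) H2.
  have cuM : cont_disk (fun w => 1 * u w + M).
    by case: (slice_harmonic_affine 1 M hu) => ? [? [? [? [[]]]]].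
  have {}j1 := i1 _ _ C10 cuM uMb H1.
  have E w : (F (mobT0 z w) * radf u z (indle a) w)%:E =
      ((F (mobT0 z w) * radf (fun w => 1 * u w + M) z (indle a) w)%:E -
       M%:E * (F (mobT0 z w) * radf (fun=> 1) z (indle a) w)%:E)%E.
    rewrite -EFinM -EFinB; congr (_%:E).
    by rewrite /radf !patch_diskE; case: ifPn => _; ring.
  have j3 := integrableZl measurableT M j2.
  split.
    by apply: eq_integrable (integrableB measurableT j1 j3) => // w _; rewrite E.
  under eq_integral do rewrite E.
  rewrite integralB// integralZl//.
  under eq_integral do rewrite EFinM.
  rewrite H1; under eq_integral do rewrite EFinM.
  rewrite H2 -/I; have If : I \is a fin_num by rewrite ge0_fin_numE.
  by rewrite -(fineK If) -!EFinM -EFinB; congr (_%:E); ring.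
exists (2 * radint u z (indle (1 / 2))) => a F a0 a1 mF F0 iF.
pose b := Num.max a (1 / 2).
have b0 : 0 < b by rewrite lt_max a0.
have b1 : b < 1 by rewrite gt_max a1 /=; lra.
have ab : a <= b by rewrite le_max lexx.
have [C HC] := local b b0 b1.
have cutcut (c : R) (G : R -> R) w : c <= b ->
    G (mobT0 z w) * indle c (mobT0 z w) * radf u z (indle b) w =
    G (mobT0 z w) * radf u z (indle c) w.
  move=> cb; rewrite /radf /mobT0 !patch_diskE; case: ifPn => hw; last by rewrite !mulr0.
  rewrite !indleE; have [h|h] := leP (mobT z w) c; last by rewrite !mulr0 mul0r.
  by rewrite (le_trans h cb) !mulr1.
have cutI (c : R) (G : R -> R) : c <= b ->
    (\int[lebesgue_measure]_(t in `[0%R, b]) (G t * indle c t)%:E =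
     \int[lebesgue_measure]_(t in `[0%R, c]) (G t)%:E)%E.
  move=> cb; rewrite integral_mkcond [RHS]integral_mkcond; apply: eq_integral => t _.
  rewrite !patchE !mem_setE !in_itv /= indleE.
  have [t0|t0] //= := leP 0 t; have [tc|tc] := leP t c.
    by rewrite (le_trans tc cb) mulr1.
  by rewrite mulr0 if_same.
have half : C = 2 * radint u z (indle (1 / 2)).
  have hb : 1 / 2 <= b by rewrite le_max lexx orbT.
  have [||_] := HC (indle (1 / 2)) (measurable_indle _).
  - by move=> t; rewrite indleE.
  - under eq_integral do rewrite -[indle _ _]mul1r.
    rewrite (cutI _ (fun=> 1) hb) integral_cst//= mul1e lebesgue_cc0 ?ltry//; lra.
  under eq_integral do rewrite -[indle _ _ in X in X * _]mul1r (cutcut _ (fun=> 1) _ hb) mul1r.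
  under [X in (_ = _ * X)%E]eq_integral do rewrite -[indle _ _]mul1r.
  rewrite (cutI _ (fun=> 1) hb) integral_cst//= mul1e lebesgue_cc0; last lra.
  rewrite /radint /Rintegral => ->; rewrite /= ; lra.
rewrite -half; have [|||] := HC (fun t => F t * indle a t).
- by apply: measurable_funM => //; exact: measurable_indle.
- by move=> t; rewrite indleE mulr_ge0.
- by rewrite cutI.
rewrite cutI// => h1 h2; split.
  by apply: eq_integrable h1 => // w _; rewrite cutcut.
by rewrite -h2; apply: eq_integral => w _; rewrite cutcut.
Qed.

End MeanValue.

(** * Powers, partial sums of the Bergman kernel, and the area of the disk *)

Section Powers.
Variable R : realType.
Implicit Types (x w : R * R).

(** Real and imaginary parts of (w conj x)^d. *)
Fixpoint pw x w (d : nat) : R * R :=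
  if d is d'.+1 then
    ((pw x w d').1 * (x.1 * w.1 + x.2 * w.2) - (pw x w d').2 * (x.1 * w.2 - x.2 * w.1),
     (pw x w d').1 * (x.1 * w.2 - x.2 * w.1) + (pw x w d').2 * (x.1 * w.1 + x.2 * w.2))
  else (1, 0).

Lemma pwD x w m n : pw x w (m + n) =
  ((pw x w m).1 * (pw x w n).1 - (pw x w m).2 * (pw x w n).2,
   (pw x w m).1 * (pw x w n).2 + (pw x w m).2 * (pw x w n).1).
Proof.
elim: m => [|m IH]; first by rewrite add0n /= !mul1r !mul0r subr0 addr0; case: (pw _ _ _).
by rewrite addSn /= IH /=; congr (_, _); ring.
Qed.

Lemma pw_norm x w n :
  (pw x w n).1 ^+ 2 + (pw x w n).2 ^+ 2 = (nrm2 x * nrm2 w) ^+ n.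
Proof.
elim: n => [|n IH]; first by rewrite /= expr0; ring.
rewrite [RHS]exprS -IH /= /nrm2; ring.
Qed.

(** Real part of zeta^m times the conjugate of zeta^n, for zeta = w conj x: a power of
    |zeta|^2 times a power of zeta or of its conjugate. *)
Lemma pw_mul x w m n :
  (pw x w m).1 * (pw x w n).1 + (pw x w m).2 * (pw x w n).2 =
  (nrm2 x * nrm2 w) ^+ minn m n * (pw x w (maxn m n - minn m n)).1.
Proof.
wlog mn : m n / (m <= n)%N.
  move=> H; have [mn|] := boolP (m <= n)%N; first exact: H.
  rewrite -ltnNge => /ltnW nm.
  by rewrite minnC maxnC -H//; ring.
rewrite (minn_idPl mn) (maxn_idPr mn) -pw_norm.
by rewrite -{1 2}(subnKC mn) pwD /=; ring.
Qed.

Lemma pw_slice x d (z : R * R) :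
  [/\ is_derive z.1 1 (fun t => (pw x (t, z.2) d).1)
        (d%:R * (x.1 * (pw x z d.-1).1 + x.2 * (pw x z d.-1).2)),
      is_derive z.1 1 (fun t => (pw x (t, z.2) d).2)
        (d%:R * (x.1 * (pw x z d.-1).2 - x.2 * (pw x z d.-1).1)),
      is_derive z.2 1 (fun t => (pw x (z.1, t) d).1)
        (d%:R * (x.2 * (pw x z d.-1).1 - x.1 * (pw x z d.-1).2)) &
      is_derive z.2 1 (fun t => (pw x (z.1, t) d).2)
        (d%:R * (x.2 * (pw x z d.-1).2 + x.1 * (pw x z d.-1).1))].
Proof.
case: z => z1 z2 /=.
elim: d => [|d [h1 h2 h3 h4]].
  by split; (apply: (is_derive_eq (is_derive_cst _ _ _)); rewrite mul0r).
have L (k l t : R) : is_derive t 1 (fun t => k * t + l) k.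
  by apply: (@is_derive_quadr _ _ _ _ 0) => h; ring.
have D1 := L x.1 (x.2 * z2) z1.
have D2 : is_derive z1 1 (fun t => x.1 * z2 - x.2 * t) (- x.2).
  by have := L (- x.2) (x.1 * z2) z1; have -> : (fun t => - x.2 * t + x.1 * z2) =
    (fun t => x.1 * z2 - x.2 * t) by apply/funext => t; ring.
have D3 : is_derive z2 1 (fun t => x.1 * z1 + x.2 * t) x.2.
  by have := L x.2 (x.1 * z1) z2; have -> : (fun t => x.2 * t + x.1 * z1) =
    (fun t => x.1 * z1 + x.2 * t) by apply/funext => t; ring.
have D4 : is_derive z2 1 (fun t => x.1 * t - x.2 * z1) x.1.
  by have := L x.1 (- (x.2 * z1)) z2.
have Rec : d%:R * (pw x (z1, z2) d).1 = d%:R * ((pw x (z1, z2) d.-1).1 * (x.1 * z1 + x.2 * z2)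
     - (pw x (z1, z2) d.-1).2 * (x.1 * z2 - x.2 * z1)) :> R.
  by case: (d) => [|k]; [rewrite !mul0r|].
have Rec2 : d%:R * (pw x (z1, z2) d).2 = d%:R * ((pw x (z1, z2) d.-1).1 * (x.1 * z2 - x.2 * z1)
     + (pw x (z1, z2) d.-1).2 * (x.1 * z1 + x.2 * z2)) :> R.
  by case: (d) => [|k]; [rewrite !mul0r|].
split.
- have h := is_deriveB (is_deriveM h1 D1) (is_deriveM h2 D2).
  apply: (is_derive_eq h); rewrite -![_ *: _]/(_ * _) /= -natr1.
  rewrite [RHS]mulrDl mul1r [X in _ = X + _](_ : _ = x.1 * (d%:R * (pw x (z1, z2) d).1) +
     x.2 * (d%:R * (pw x (z1, z2) d).2)); last by ring.
  by rewrite Rec Rec2; ring.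
- have h := is_deriveD (is_deriveM h1 D2) (is_deriveM h2 D1).
  apply: (is_derive_eq h); rewrite -![_ *: _]/(_ * _) /= -natr1.
  rewrite [RHS]mulrDl mul1r [X in _ = X + _](_ : _ = x.1 * (d%:R * (pw x (z1, z2) d).2) -
     x.2 * (d%:R * (pw x (z1, z2) d).1)); last by ring.
  by rewrite Rec Rec2; ring.
- have h := is_deriveB (is_deriveM h3 D3) (is_deriveM h4 D4).
  apply: (is_derive_eq h); rewrite -![_ *: _]/(_ * _) /= -natr1.
  rewrite [RHS]mulrDl mul1r [X in _ = X + _](_ : _ = x.2 * (d%:R * (pw x (z1, z2) d).1) -
     x.1 * (d%:R * (pw x (z1, z2) d).2)); last by ring.
  by rewrite Rec Rec2; ring.
- have h := is_deriveD (is_deriveM h3 D4) (is_deriveM h4 D3).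
  apply: (is_derive_eq h); rewrite -![_ *: _]/(_ * _) /= -natr1.
  rewrite [RHS]mulrDl mul1r [X in _ = X + _](_ : _ = x.2 * (d%:R * (pw x (z1, z2) d).2) +
     x.1 * (d%:R * (pw x (z1, z2) d).1)); last by ring.
  by rewrite Rec Rec2; ring.
Qed.

Lemma cont_pw x d w : cont_at w (fun w => (pw x w d).1) /\
  cont_at w (fun w => (pw x w d).2).
Proof.
elim: d => [|d [IH1 IH2]] /=; first by split; exact: cont_cst.
by split; cont.
Qed.

Lemma pw_harmonic x d : slice_harmonic (fun w => (pw x w d).1).
Proof.
have E (f g : R -> R) (k a b t df dg : R) : is_derive t 1 f df ->
    is_derive t 1 g dg -> is_derive t 1 (fun t => k * (a * f t + b * g t)) (k * (a * df + b * dg)).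
  move=> hf hg; have := is_deriveM (is_derive_cst k t 1)
   (is_deriveD (is_deriveM (is_derive_cst a t 1) hf) (is_deriveM (is_derive_cst b t 1) hg)) => h.
  by apply: (is_derive_eq h); rewrite -![_ *: _]/(_ * _) /cst ?fctE /=; ring.
exists (fun z => d%:R * (x.1 * (pw x z d.-1).1 + x.2 * (pw x z d.-1).2)).
exists (fun z => d%:R * (x.2 * (pw x z d.-1).1 + - x.1 * (pw x z d.-1).2)).
exists (fun z => d%:R * (x.1 * (d.-1%:R * (x.1 * (pw x z d.-2).1 + x.2 * (pw x z d.-2).2))
   + x.2 * (d.-1%:R * (x.1 * (pw x z d.-2).2 - x.2 * (pw x z d.-2).1)))).
exists (fun z => d%:R * (x.2 * (d.-1%:R * (x.2 * (pw x z d.-2).1 - x.1 * (pw x z d.-2).2))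
   + - x.1 * (d.-1%:R * (x.2 * (pw x z d.-2).2 + x.1 * (pw x z d.-2).1)))).
split; last by move=> z _; ring.
have cp := cont_pw x.
split => z _; rewrite -?/(cont_at z _).
- by have [] := pw_slice x d z.
- by have [h1 h2 _ _] := pw_slice x d.-1 z; exact: E.
- by have [_ _ h _] := pw_slice x d z; apply: (is_derive_eq h); rewrite mulNr.
- by have [_ _ h1 h2] := pw_slice x d.-1 z; exact: E.
- by have [] := cp d z.
- by cont; have [] := cp d.-2 z.
- by cont; have [] := cp d.-2 z.
Qed.

(** Real and imaginary parts of the sum of (n + 1) zeta^n over n < N, a partial sum of the
    Bergman kernel (1 - zeta)^(-2) at zeta = w conj x. *)
Definition bsum1 x w N := \sum_(n < N) n.+1%:R * (pw x w n).1.
Definition bsum2 x w N := \sum_(n < N) n.+1%:R * (pw x w n).2.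

(** (1 - zeta)^2 times the partial sum is 1 - (N + 1) zeta^N + N zeta^(N + 1). *)
Lemma bsum_closed x w N :
  let a := x.1 * w.1 + x.2 * w.2 in let b := x.1 * w.2 - x.2 * w.1 in
  (((1 - a) ^+ 2 - b ^+ 2) * bsum1 x w N + 2 * (1 - a) * b * bsum2 x w N =
    1 - N.+1%:R * (pw x w N).1 + N%:R * (pw x w N.+1).1) /\
  (((1 - a) ^+ 2 - b ^+ 2) * bsum2 x w N - 2 * (1 - a) * b * bsum1 x w N =
    - (N.+1%:R * (pw x w N).2) + N%:R * (pw x w N.+1).2).
Proof.
move=> a b; rewrite /bsum1 /bsum2; elim: N => [|N [IH1 IH2]].
  by rewrite !big_ord0 /=; split; ring.
rewrite !big_ord_recr /=; split.
  rewrite mulrDr [X in _ + X]mulrDr addrACA IH1 /= -/a -/b -!natr1; ring.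
rewrite mulrDr [X in _ - X]mulrDr [X in _ + X]opprD addrACA IH2 /= -/a -/b -!natr1; ring.
Qed.

Lemma bsum_norm x w N : mobq x w ^+ 2 * (bsum1 x w N ^+ 2 + bsum2 x w N ^+ 2) =
  (1 - N.+1%:R * (pw x w N).1 + N%:R * (pw x w N.+1).1) ^+ 2 +
  (- (N.+1%:R * (pw x w N).2) + N%:R * (pw x w N.+1).2) ^+ 2.
Proof.
have [<- <-] := bsum_closed x w N; rewrite /mobq /=; ring.
Qed.

(** Write r = s^2: then n s^n stays bounded, and another factor s^n tends to 0. *)
Lemma cvg_natmul_expr (r : R) : 0 <= r -> r < 1 ->
  (n%:R * r ^+ n) @[n --> \oo] --> (0 : R).
Proof.
move=> r0 r1; pose s := Num.sqrt r.
have s0 : 0 <= s by exact: sqrtr_ge0.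
have s1 : s < 1 by rewrite -sqrtr1 ltr_sqrt.
have rs : r = s * s by rewrite -expr2 sqr_sqrtr.
have d0 : 0 < 1 - s by rewrite subr_gt0.
have B n : n%:R * s ^+ n <= (1 - s)^-1.
  rewrite -[leRHS]mul1r ler_pdivlMr//.
  apply: (@le_trans _ _ ((1 - s) * \sum_(i < n) s ^+ i)); last first.
    have -> : (1 - s) * \sum_(i < n) s ^+ i = 1 - s ^+ n.
      by rewrite -[RHS]opprB subrX1 -mulNr opprB.
    by rewrite lerBlDr lerDl exprn_ge0.
  rewrite mulrC ler_pM2l//; apply: (@le_trans _ _ (\sum_(i < n) s ^+ n)).
    by rewrite sumr_const card_ord mulr_natl.
  apply: ler_sum => i _; rewrite ler_wiXn2l ?(ltW s1)//; exact: ltnW.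
apply: (@squeeze_cvgr _ _ _ _ (fun=> 0) (geometric (1 - s)^-1 s)).
- near=> n; rewrite mulr_ge0 ?exprn_ge0//= rs exprMn mulrA.
  by rewrite ler_wpM2r// exprn_ge0.
- exact: cvg_cst.
- by apply: cvg_geometric; rewrite ger0_norm.
Unshelve. all: by end_near.
Qed.

Lemma abs_pw_le x w n : nrm2 x * nrm2 w < 1 ->
  `|(pw x w n).1| <= Num.sqrt (nrm2 x * nrm2 w) ^+ n /\
  `|(pw x w n).2| <= Num.sqrt (nrm2 x * nrm2 w) ^+ n.
Proof.
move=> r1; have r0 : 0 <= nrm2 x * nrm2 w by rewrite mulr_ge0 ?nrm2_ge0.
have H := pw_norm x w n.
have E : (nrm2 x * nrm2 w) ^+ n = (Num.sqrt (nrm2 x * nrm2 w) ^+ n) ^+ 2.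
  by rewrite -exprM mulnC exprM sqr_sqrtr.
have S0 : 0 <= Num.sqrt (nrm2 x * nrm2 w) ^+ n by rewrite exprn_ge0// sqrtr_ge0.
split; rewrite -(@ler_pXn2r _ 2)// ?nnegrE// real_normK ?num_real// -E -H;
  by rewrite ?lerDl ?lerDr sqr_ge0.
Qed.

Lemma cvg_natmul_pw x w : nrm2 x * nrm2 w < 1 ->
  (n%:R * (pw x w n).1 @[n --> \oo] --> (0 : R)) /\
  (n%:R * (pw x w n).2 @[n --> \oo] --> (0 : R)) /\
  ((pw x w n).1 @[n --> \oo] --> (0 : R)) /\ ((pw x w n).2 @[n --> \oo] --> (0 : R)).
Proof.
move=> r1; set s := Num.sqrt (nrm2 x * nrm2 w).
have s0 : 0 <= s by exact: sqrtr_ge0.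
have s1 : s < 1 by rewrite -sqrtr1 ltr_sqrt.
have Z (f : nat -> R) : (forall n, `|f n| <= n%:R * s ^+ n) -> f @ \oo --> (0 : R).
  move=> H; apply/norm_cvg0P; apply: (@squeeze_cvgr _ _ _ _ (fun=> 0) (fun n => n%:R * s ^+ n)).
  - by near=> n; rewrite normr_ge0 H.
  - exact: cvg_cst.
  - exact: cvg_natmul_expr.
have Z' (f : nat -> R) : (forall n, `|f n| <= s ^+ n) -> f @ \oo --> (0 : R).
  move=> H; apply/norm_cvg0P; apply: (@squeeze_cvgr _ _ _ _ (fun=> 0) (geometric 1 s)).
  - by near=> n; rewrite normr_ge0 /= mul1r H.
  - exact: cvg_cst.
  - by apply: cvg_geometric; rewrite ger0_norm.
have H n := abs_pw_le n r1.
split; [|split; [|split]]; [apply: Z|apply: Z|apply: Z'|apply: Z'] => n;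
  rewrite ?normrM ?normr_nat ?ler_wpM2l//; by have [] := H n.
Unshelve. all: by end_near.
Qed.

Lemma cvg_bsum x w : nrm2 x * nrm2 w < 1 -> mobq x w != 0 ->
  (bsum1 x w N ^+ 2 + bsum2 x w N ^+ 2) @[N --> \oo] --> (mobq x w ^+ 2)^-1.
Proof.
move=> r1 q0; have [h1 [h2 [h3 h4]]] := cvg_natmul_pw r1.
have -> : (fun N => bsum1 x w N ^+ 2 + bsum2 x w N ^+ 2) = (fun N => (mobq x w ^+ 2)^-1 *
  ((1 - (N%:R * (pw x w N).1 + (pw x w N).1) + (N.+1%:R * (pw x w N.+1).1 - (pw x w N.+1).1)) ^+ 2 +
  (- (N%:R * (pw x w N).2 + (pw x w N).2) + (N.+1%:R * (pw x w N.+1).2 - (pw x w N.+1).2)) ^+ 2)).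
  apply/funext => N; apply: (@mulfI _ (mobq x w ^+ 2)); first by rewrite expf_neq0.
  rewrite mulVKf ?expf_neq0// bsum_norm -!natr1; congr (_ ^+ 2 + _ ^+ 2); ring.
have S (f : nat -> R) (l : R) : f @ \oo --> l -> f n.+1 @[n --> \oo] --> l.
  by move=> h; have := h; rewrite -(@cvg_shiftS _ f).
rewrite -[X in _ --> X]mulr1; apply: cvgM; first exact: cvg_cst.
have E1 : (1 : R) = (1 - (0 + 0) + (0 - 0)) ^+ 2 + (- (0 + 0) + (0 - 0)) ^+ 2 by ring.
rewrite [X in _ --> X]E1.
have A : 1 - (N%:R * (pw x w N).1 + (pw x w N).1) + (N.+1%:R * (pw x w N.+1).1 - (pw x w N.+1).1)
   @[N --> \oo] --> (1 - (0 + 0) + (0 - 0) : R).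
  apply: cvgD; first by apply: cvgB; [exact: cvg_cst|exact: cvgD].
  by apply: cvgB; [exact: (S _ _ h1)|exact: (S _ _ h3)].
have B : - (N%:R * (pw x w N).2 + (pw x w N).2) + (N.+1%:R * (pw x w N.+1).2 - (pw x w N.+1).2)
   @[N --> \oo] --> (- (0 + 0) + (0 - 0) : R).
  apply: cvgD; first by apply: cvgN; exact: cvgD.
  by apply: cvgB; [exact: (S _ _ h2)|exact: (S _ _ h4)].
by apply: cvgD; rewrite !expr2; apply: cvgM.
Qed.

Lemma is_derive_pow n (t : R) : is_derive t 1 (fun t : R => t ^+ n) (n%:R * t ^+ n.-1).
Proof.
have -> : (fun t : R => t ^+ n) = id ^+ n.
  by apply/funext => y; elim: n => [|n IH]; rewrite ?expr0// !exprS IH.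
by have h := is_deriveX n (is_derive_id t 1); apply: (is_derive_eq h); rewrite -[_ *: _]/(_ * _) mulr1.
Qed.

(** Taylor coefficients of (1 - t)^(-3/2). *)
Fixpoint b32 (n : nat) : R :=
  if n is n'.+1 then b32 n' * ((n'%:R + 3 / 2) / n'.+1%:R) else 1.

Lemma b32_ge0 n : 0 <= b32 n.
Proof. by elim: n => //= n IH; rewrite mulr_ge0// divr_ge0// addr_ge0. Qed.

(** The ratio ((n + 3/2) / (n + 1))^2 is at least (n + 9/5) / (n + 4/5), which makes the bound
    inductive; it is sharp at n = 0. *)
Lemma b32_lb n : 5 / 4 * (n%:R + 4 / 5) <= b32 n ^+ 2.
Proof.
elim: n => [|n IH] /=; first by rewrite expr1n; lra.
rewrite exprMn; set k : R := n%:R in IH *.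
have k0 : 0 <= k by [].
have -> : n.+1%:R = k + 1 :> R by rewrite -natr1.
have k1 : 0 < k + 1 by lra.
apply: (@le_trans _ _ (5 / 4 * (k + 4 / 5) * ((k + 3 / 2) / (k + 1)) ^+ 2)); last first.
  by rewrite ler_wpM2r// sqr_ge0.
rewrite expr_div_n mulrA ler_pdivlMr ?exprn_gt0//; nra.
Qed.

(** The quotient of the two sequences tends to Gamma(3/2) = sqrt pi / 2, so that a constant
    below 1 is possible; 4/5 is a convenient rational number above pi / 4. *)
Lemma b32_coef n : (n.+1%:R / Num.sqrt n.+2%:R : R) <= Num.sqrt (4 / 5) * b32 n.
Proof.
rewrite -(@ler_pXn2r _ 2)// ?nnegrE ?divr_ge0 ?mulr_ge0 ?b32_ge0//.
have h45 : (0 : R) <= 4 / 5 by lra.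
rewrite expr_div_n exprMn (sqr_sqrtr h45) sqr_sqrtr//.
rewrite ler_pdivrMr ?ltr0n//.
have := b32_lb n; set k : R := n%:R => h; have k0 : 0 <= k by [].
have -> : n.+1%:R = k + 1 :> R by rewrite -natr1.
have -> : n.+2%:R = k + 2 :> R by rewrite -2!natr1; ring.
by nra.
Qed.

(** For P a partial sum of the Taylor series, (1 - x) P' <= 3/2 P on [0, 1], so that
    P^2 (1 - x)^3 is nonincreasing, and it is at most 1 at the origin. *)
Lemma b32_series N (t : R) : 0 <= t -> t < 1 ->
  (\sum_(n < N) b32 n * t ^+ n) ^+ 2 * (1 - t) ^+ 3 <= 1.
Proof.
move=> t0 t1.
pose P (x : R) : R := \sum_(n < N) b32 n * x ^+ n.
pose dP (x : R) : R := \sum_(n < N) b32 n * (n%:R * x ^+ n.-1).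
have DP (x : R) : is_derive x 1 P (dP x).
  rewrite /P /dP; move: N {P dP} => k; elim: k => [|n IH].
    have -> : (fun x : R => \sum_(n < 0) b32 n * x ^+ n) = cst 0.
      by apply/funext => y; rewrite big_ord0.
    by apply: (is_derive_eq (is_derive_cst _ _ _)); rewrite big_ord0.
  have -> : (fun x : R => \sum_(i < n.+1) b32 i * x ^+ i) =
      (fun x : R => \sum_(i < n) b32 i * x ^+ i) + (fun x : R => b32 n * x ^+ n).
    by apply/funext => y; rewrite big_ord_recr.
  rewrite big_ord_recr /=; apply: is_deriveD.
  have h := is_deriveM (is_derive_cst (b32 n) x 1) (is_derive_pow n x).
  by apply: (is_derive_eq h); rewrite -![_ *: _]/(_ * _) /cst ?fctE /=; ring.
have P0 (x : R) : 0 <= x -> 0 <= P x.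
  by move=> x0; apply: sumr_ge0 => i _; rewrite mulr_ge0 ?b32_ge0// exprn_ge0.
have ode (x : R) : 0 <= x -> (1 - x) * dP x <= 3 / 2 * P x.
  move=> x0; rewrite /dP /P; move: N {P dP DP P0} => [|k]; first by rewrite !big_ord0 !mulr0.
  suff -> : (1 - x) * \sum_(n < k.+1) b32 n * (n%:R * x ^+ n.-1) =
     3 / 2 * \sum_(n < k.+1) b32 n * x ^+ n - (k%:R + 3 / 2) * b32 k * x ^+ k.
    by rewrite lerBlDr lerDl !mulr_ge0 ?b32_ge0 ?exprn_ge0// addr_ge0.
  elim: k => [|k IH]; first by rewrite !big_ord_recr !big_ord0 /=; field.
  rewrite big_ord_recr [in RHS]big_ord_recr mulrDr IH [X in _ = X - _]mulrDr /=.
  rewrite -natr1 exprS; move: (x ^+ k) => y; field.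
  by rewrite addrC natr1.
pose G (x : R) : R := P x ^+ 2 * (1 - x) ^+ 3.
pose dG (x : R) : R := P x * (1 - x) ^+ 2 * (2 * ((1 - x) * dP x) - 3 * P x).
have DG (x : R) : is_derive x 1 G (dG x).
  have D1 : is_derive x 1 (fun x : R => 1 - x) (-1).
    have h := is_deriveB (is_derive_cst (1 : R) x 1) (is_derive_id x 1).
    by apply: (is_derive_eq h); rewrite sub0r.
  have h := is_deriveM (is_deriveX 2 (DP x)) (is_deriveX 3 D1).
  by apply: (is_derive_eq h); rewrite -![_ *: _]/(_ * _) /dG !fctE /=; ring.
have [c] : exists2 c, c \in `[0, t]%R & G t - G 0 = dG c * (t - 0).
  apply: MVT_segment => //.
  apply: continuous_subspaceT => x; apply: differentiable_continuous.
  by apply/derivable1_diffP; exact: ex_derive.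
rewrite in_itv /= subr0 => /andP[c0 ct] E.
have c1 : c <= 1 by exact: le_trans ct (ltW t1).
have : G t <= G 0.
  rewrite -subr_le0 E mulr_le0_ge0// /dG mulr_ge0_le0//.
    by apply: mulr_ge0; [exact: P0|exact: sqr_ge0].
  by have := ode c c0; lra.
move=> h; apply: le_trans h _; rewrite /G subr0 expr1n mulr1 /P.
case: (N) => [|k]; first by rewrite big_ord0 expr0n.
rewrite big_ord_recl /= big1 => [|i _]; last by rewrite expr0n /= mulr0.
by rewrite expr0 mulr1 addr0 expr1n.
Qed.

Lemma bergman_sum_le N (t : R) : 0 <= t -> t < 1 ->
  \sum_(n < N) n.+1%:R / Num.sqrt n.+2%:R * t ^+ n <=
  Num.sqrt (4 / 5) / Num.sqrt (1 - t) ^+ 3.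
Proof.
move=> t0 t1; apply: (@le_trans _ _ (Num.sqrt (4 / 5) * \sum_(n < N) b32 n * t ^+ n)).
  rewrite mulr_sumr; apply: ler_sum => n _; rewrite mulrA.
  by rewrite ler_wpM2r ?exprn_ge0// b32_coef.
rewrite ler_wpM2l ?sqrtr_ge0//.
have d0 : 0 < 1 - t by rewrite subr_gt0.
have s0 : 0 < Num.sqrt (1 - t) by rewrite sqrtr_gt0.
have S0 : 0 <= \sum_(n < N) b32 n * t ^+ n.
  by apply: sumr_ge0 => n _; rewrite mulr_ge0 ?b32_ge0 ?exprn_ge0.
rewrite -[leRHS]mul1r ler_pdivlMr ?exprn_gt0//.
rewrite -(@ler_pXn2r _ 2)// ?nnegrE ?mulr_ge0 ?exprn_ge0 ?sqrtr_ge0//.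
rewrite exprMn expr1n -exprM mulnC exprM sqr_sqrtr ?(ltW d0)//.
exact: b32_series.
Qed.

(** The absolute value makes the weight nonnegative on the whole line. *)
Definition rweight (n : nat) (t : R) : R := `|t| ^+ n * Num.sqrt (1 - t).

Lemma rweight_ge0 n t : 0 <= rweight n t.
Proof. by rewrite mulr_ge0 ?exprn_ge0// sqrtr_ge0. Qed.

Lemma measurable_rweight n : measurable_fun setT (rweight n).
Proof.
apply: measurable_funM.
  by apply: measurable_funX; exact: normr_measurable.
have ms : measurable_fun setT (@Num.sqrt R).
  by apply: continuous_measurable_fun; exact: sqrt_continuous.
by apply: (measurableT_comp ms); exact: measurable_funB.
Qed.

(** The arithmetic-geometric mean inequality sqrt(1 - t) <= (l (1 - t) + 1/l) / 2 turns the
    integral into one of a polynomial; l = sqrt(n + 2) is the optimal choice. *)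
Lemma rweight_moment n (a : R) : 0 < a -> a < 1 ->
  (\int[lebesgue_measure]_(t in `[0%R, a]) (rweight n t)%:E <=
   (n.+1%:R * Num.sqrt n.+2%:R)^-1%:E)%E.
Proof.
move=> a0 a1; pose l := Num.sqrt n.+2%:R : R.
have l0 : 0 < l by rewrite sqrtr_gt0.
have l2 : l ^+ 2 = n.+2%:R by rewrite sqr_sqrtr.
pose g (t : R) : R := t ^+ n * ((l * (1 - t) + l^-1) / 2).
pose G (t : R) : R := t ^+ n.+1 * ((l + l^-1) / 2 / n.+1%:R) - t ^+ n.+2 * (l / 2 / n.+2%:R).
have DG (t : R) : is_derive t 1 G (g t).
  have h := is_deriveB (is_deriveM (is_derive_pow n.+1 t) (is_derive_cst ((l + l^-1) / 2 / n.+1%:R) t 1))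
    (is_deriveM (is_derive_pow n.+2 t) (is_derive_cst (l / 2 / n.+2%:R) t 1)).
  apply: (is_derive_eq h); rewrite -![_ *: _]/(_ * _) /cst ?fctE /= /g.
  rewrite exprS; move: (t ^+ n) => y.
  have n1 : n.+1%:R != 0 :> R by rewrite pnatr_eq0.
  have n2 : n.+2%:R != 0 :> R by rewrite pnatr_eq0.
  have l1 : l != 0 by rewrite gt_eqF.
  move: (n.+1%:R) (n.+2%:R) (t ^+ n.+2) n1 n2 => u v y2 n1 n2.
  by field; rewrite n1 n2 l1.
have CG (t : R) : {for t, continuous G}.
  apply: differentiable_continuous.
  by apply/derivable1_diffP; exact: ex_derive.
have cg (t : R) : {for t, continuous g}.
  apply: cvgM; first exact: exprn_continuous.
  apply: cvgM; last exact: cvg_cst.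
  apply: cvgD; last exact: cvg_cst.
  by apply: cvgM; [exact: cvg_cst|apply: cvgB; [exact: cvg_cst|exact: cvg_id]].
have mg : measurable_fun setT g by apply: continuous_measurable_fun => t; exact: cg.
have g0 (t : R) : 0 <= t -> t <= 1 -> 0 <= g t.
  move=> t0 t1; rewrite mulr_ge0 ?exprn_ge0// divr_ge0// addr_ge0 ?invr_ge0 ?(ltW l0)//.
  by rewrite mulr_ge0 ?(ltW l0)// subr_ge0.
apply: (@le_trans _ _ (\int[lebesgue_measure]_(t in `[0%R, 1%R]) (g t)%:E)%E).
  rewrite integral_mkcond [leRHS]integral_mkcond; apply: ge0_le_integral => //.
  - move=> t _; rewrite patchE; case: ifPn => // _; rewrite lee_fin; exact: rweight_ge0.
  - apply/(measurable_restrictT _ (measurable_itv _)); apply/measurable_EFinP.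
    exact: measurable_funTS (measurable_rweight n).
  - apply/(measurable_restrictT _ (measurable_itv _)); apply/measurable_EFinP.
    exact: measurable_funTS mg.
  - move=> t _; rewrite !patchE !mem_setE !in_itv /=.
    have [t0|t0] //= := leP 0 t; have [ta|ta] /= := leP t a; last first.
      by case: ifP => // t1; rewrite lee_fin g0.
    have t1 : t <= 1 by exact: le_trans ta (ltW a1).
    rewrite t1 lee_fin /rweight /g ger0_norm// ler_wpM2l ?exprn_ge0//.
    have d0 : 0 <= 1 - t by rewrite subr_ge0.
    have := sqr_sqrtr d0; have := sqrtr_ge0 (1 - t).
    move: (Num.sqrt (1 - t)) => s s0 <-.
    have -> : (l * s ^+ 2 + l^-1) / 2 = s + (l * s - 1) ^+ 2 / (2 * l).
      by field; rewrite gt_eqF.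
    by rewrite lerDl divr_ge0 ?sqr_ge0// mulr_ge0// ltW.
rewrite (@continuous_FTC2 _ g G) //.
- rewrite -EFinB lee_fin /G !expr1n !expr0n /= !mul0r subrr subr0 !mul1r.
  have -> : (l + l^-1) / 2 / n.+1%:R - l / 2 / n.+2%:R = (n.+1%:R * l)^-1; last exact: lexx.
  have n1 : n.+1%:R != 0 :> R by rewrite pnatr_eq0.
  have n2 : n.+1%:R = l ^+ 2 - 1 :> R by rewrite l2 -[n.+2%:R]natr1 addrK.
  rewrite -l2; rewrite n2 in n1 *.
  by field; rewrite gt_eqF// n1.
- by apply: continuous_subspaceT => t; exact: cg.
- split.
  + by move=> t _; exact: ex_derive.
  + by apply: cvg_at_right_filter; exact: CG.
  + by apply: cvg_at_left_filter; exact: CG.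
- by move=> t _; rewrite derive1E; exact: derive_val.
Qed.

Local Notation mu := (plane_lebesgue R).

Lemma mobT_0 w : mobT (0, 0) w = nrm2 w.
Proof.
have q1 : mobq (0, 0) w = 1 by rewrite /mobq /=; ring.
by rewrite /mobT q1 /mobp /nrm2 /=; field.
Qed.

Lemma mobJ_0 w : mobJ (0, 0) w = 1.
Proof.
have q1 : mobq (0, 0) w = 1 by rewrite /mobq /=; ring.
by rewrite /mobJ q1 /nrm2 /=; field.
Qed.

Lemma nrm2_00 : nrm2 ((0, 0) : R * R) < 1.
Proof. by rewrite /nrm2 /= expr0n /= addr0. Qed.

Definition disk_area : R := fine (plane_lebesgue R (disk R)).

Lemma radf_0 u phi w : radf u (0, 0) phi w =
  if nrm2 w < 1 then u w * phi (nrm2 w) else 0.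
Proof. by rewrite /radf patch_diskE mobJ_0 mobT_0 mulr1. Qed.

(** The mean value property for the constant 1 shows that the disk |w|^2 <= a has area C a;
    letting a tend to 1 identifies C with the area of the disk, so that the normalization of
    dA requires no computation of pi. *)
Lemma disk_area_props :
  [/\ 0 < disk_area, mu (disk R) = disk_area%:E &
      forall a : R, 0 < a -> a < 1 -> mu [set w | (nrm2 w <= a)%R] = (disk_area * a)%:E].
Proof.
have [C HC] := radial_integral nrm2_00 (@slice_harmonic_cst R 1).
have ballE (a : R) : 0 < a -> a < 1 -> mu [set w | (nrm2 w <= a)%R] = (C * a)%:E.
  move=> a0 a1; have [||_] := HC a (fun=> 1) a0 a1 (@measurable_cst _ _ _ _ _ _).
  - by move=> t; rewrite ler01.
  - by rewrite integral_cst//= mul1e lebesgue_cc0// ltry.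
  rewrite [in RHS]integral_cst//= mul1e lebesgue_cc0// -EFinM => <-.
  rewrite -[LHS]mul1e -[LHS]integral_cst; last exact: measurable_ball_nrm2.
  rewrite integral_mkcond; apply: eq_integral => w _.
  rewrite [LHS]patchE mul1r radf_0 mul1r indleE.
  case: ifPn; rewrite ?inE ?notin_setE /= => h.
    by rewrite (le_lt_trans h a1) h.
  by move/negP/negPf: h => ->; case: ifP.
have fin : (mu (disk R) < +oo)%E.
  apply: le_lt_trans (closed_disk_lty 1); apply: le_measure; rewrite ?inE.
  - exact: measurable_disk.
  - exact: measurable_ball_nrm2.
  - by move=> w /diskE /ltW.
have E : mu (disk R) = disk_area%:E by rewrite fineK// ge0_fin_numE.
have C0 : 0 <= C.
  have h : (0 <= (C * (1 / 2))%:E)%E by rewrite -ballE ?measure_ge0//; lra.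
  by move: h; rewrite lee_fin; lra.
have CE : disk_area = C.
  apply/eqP; rewrite eq_le; apply/andP; split.
    rewrite -lee_fin -E.
    have cv : mu [set w | (nrm2 w <= 1 - n.+2%:R^-1)%R] @[n --> \oo] --> mu (disk R).
      have -> : disk R = \bigcup_n [set w | (nrm2 w <= 1 - n.+2%:R^-1)%R].
        apply/seteqP; split => [w /diskE hw|w [n _ /= h]]; last first.
          by apply/diskE; apply: le_lt_trans h _; rewrite ltrBlDr ltrDl invr_gt0.
        have [n hn] := ltr_add_invr hw; exists n => //=.
        have : n.+2%:R^-1 <= n.+1%:R^-1 :> R by rewrite lef_pV2 ?posrE// ler_nat.
        by move: hn; move: (n.+2%:R^-1) (n.+1%:R^-1) => a b; lra.
      apply: nondecreasing_cvg_mu.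
      - by move=> n; exact: measurable_ball_nrm2.
      - by apply: bigcupT_measurable => n; exact: measurable_ball_nrm2.
      - move=> m n mn; apply/subsetPset => w /= h; apply: le_trans h _.
        by rewrite lerB// lef_pV2 ?posrE// ler_nat.
    rewrite -(cvg_lim _ cv)//; apply: lime_le; first by apply/cvg_ex; exists (mu (disk R)).
    near=> n; rewrite ballE; last first.
    - by rewrite ltrBlDr ltrDl invr_gt0.
    - by rewrite subr_gt0 invf_lt1// ltr1n.
    by rewrite lee_fin ler_piMr// gerBl invr_ge0.
  apply/ler_addgt0Pr => e e0.
  pose d := Num.min (1 / 2) (e / (C + 1)).
  have C1 : 0 < C + 1 by rewrite ltr_wpDl.
  have d0 : 0 < d by rewrite lt_min !divr_gt0.
  have d1 : d <= 1 / 2 by rewrite ge_min lexx.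
  have d2 : d * (C + 1) <= e by rewrite -ler_pdivlMr// ge_min lexx orbT.
  have : C * (1 - d) <= disk_area.
    rewrite -lee_fin -ballE -?E; [|lra|lra].
    apply: le_measure; rewrite ?inE; [exact: measurable_ball_nrm2|exact: measurable_disk|].
    by move=> w /= h; apply/diskE; apply: le_lt_trans h _; lra.
  by nra.
rewrite -CE in ballE *; split => //.
rewrite lt_neqAle CE C0 andbT -CE; apply/negP => /eqP A0.
(* the square with side [0, 1/2] has positive area and lies in the disk nrm2 w <= 1/2 *)
have : mu [set w | (nrm2 w <= 1 / 2)%R] = 0%E by rewrite ballE ?mul0r -?A0 ?mul0r//; lra.
apply/eqP; rewrite gt_eqF//.
apply: (@lt_le_trans _ _ (mu ((`[0, 1/2]%classic : set (measurableTypeR R)) `*`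
   (`[0, 1/2]%classic : set (measurableTypeR R))))).
  rewrite /plane_lebesgue /= product_measure1E/=; [|exact: measurable_itv..].
  by rewrite lebesgue_cc0 ?mule_gt0 ?lte_fin//; lra.
apply: le_measure; rewrite ?inE.
- by apply: measurableX; exact: measurable_itv.
- exact: measurable_ball_nrm2.
- by move=> [w1 w2] /=; rewrite !in_itv /= /nrm2 /=; nra.
Unshelve. all: by end_near.
Qed.

End Powers.

(** * The Schur estimate for the Bergman kernel *)

Section Schur.
Variable R : realType.
Implicit Types (x w : R * R).
Local Notation mu := (plane_lebesgue R).

Lemma mobT0_0 w : nrm2 w < 1 -> mobT0 (0, 0) w = nrm2 w.
Proof. by move=> hw; rewrite /mobT0 patch_diskE hw mobT_0. Qed.

Lemma integral_cst1 (a : R) : 0 < a ->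
  (\int[lebesgue_measure]_(t in `[0%R, a]) (1%R)%:E = a%:E)%E.
Proof. by move=> a0; rewrite integral_cst//= mul1e lebesgue_cc0. Qed.

Lemma radial_constant u C (a : R) :
  (forall (a : R) (F : R -> R), 0 < a -> a < 1 ->
    measurable_fun setT F -> (forall t, 0 <= F t) ->
    (\int[lebesgue_measure]_(t in `[0%R, a]) (F t)%:E < +oo)%E ->
    mu.-integrable setT (fun w => (F (mobT0 (0, 0) w) * radf u (0, 0) (indle a) w)%:E) /\
    (\int[mu]_w (F (mobT0 (0, 0) w) * radf u (0, 0) (indle a) w)%:E =
     C%:E * \int[lebesgue_measure]_(t in `[0%R, a]) (F t)%:E)%E) ->
  0 < a -> a < 1 -> mu.-integrable setT (EFin \o radf u (0, 0) (indle a)) /\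
    (\int[mu]_w (radf u (0, 0) (indle a) w)%:E = (C * a)%:E)%E.
Proof.
move=> HC a0 a1; have [||] := HC a (fun=> 1) a0 a1 (@measurable_cst _ _ _ _ _ _).
- by move=> t; rewrite ler01.
- by rewrite integral_cst1// ltry.
rewrite integral_cst1// => h1 h2; split.
  by apply: eq_integrable h1 => // w _; rewrite mul1r.
by rewrite EFinM -h2; apply: eq_integral => w _; rewrite mul1r.
Qed.

Lemma radf1_indle (a : R) w : a < 1 ->
  radf (fun=> 1) (0, 0) (indle a) w = \1_[set w | nrm2 w <= a] w.
Proof.
move=> a1; rewrite radf_0 mul1r indleE indicE.
have -> : (w \in [set w | nrm2 w <= a]) = (nrm2 w <= a) by apply/idP/idP; rewrite inE.
by case: ifPn => // h; case: leP => // h2; have := le_lt_trans h2 a1; rewrite (negPf h).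
Qed.

Lemma integral_radf1 (a : R) : 0 < a -> a < 1 ->
  (\int[mu]_w (radf (fun=> 1) (0, 0) (indle a) w)%:E = (disk_area R * a)%:E)%E.
Proof.
move=> a0 a1; have [_ _ H] := disk_area_props R; rewrite -H//.
under eq_integral do rewrite radf1_indle//.
rewrite integral_indic ?setIT//; exact: measurable_ball_nrm2.
Qed.

(** Orthogonality of the powers: for d > 0 the mean of Re zeta^d is 0. The constant C of the
    mean value property is computed on small disks |w|^2 <= b, where |zeta^d| <= sqrt b; hence
    |C| is at most sqrt b times the area, for every b. *)
Lemma pw_radial_integral x d k (a : R) : nrm2 x < 1 -> 0 < a -> a < 1 ->
  mu.-integrable setT (fun w => (rweight k (mobT0 (0, 0) w) *
     radf (fun w => (pw x w d).1) (0, 0) (indle a) w)%:E) /\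
  (\int[mu]_w (rweight k (mobT0 (0, 0) w) *
     radf (fun w => (pw x w d).1) (0, 0) (indle a) w)%:E =
   ((d == 0%N)%:R * disk_area R)%:E *
     \int[lebesgue_measure]_(t in `[0%R, a]) (rweight k t)%:E)%E.
Proof.
move=> hx a0 a1.
have [C HC] := radial_integral (nrm2_00 R) (pw_harmonic x d).
have [A0 _ HA] := disk_area_props R.
have -> : (d == 0%N)%:R * disk_area R = C.
  case: eqP => [d0|/eqP d0].
    rewrite mul1r; have := integral_radf1 (a := 1 / 2).
    have [||_] := radial_constant (a := 1 / 2) HC; [lra|lra|].
    rewrite d0 /= => -> /= H; have : (C * (1 / 2))%:E = (disk_area R * (1 / 2))%:E.
      by apply: H; lra.
    by move=> [] h; lra.
  rewrite mul0r; apply/eqP; rewrite eq_sym -normr_le0.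
  have B (b : R) : 0 < b -> b < 1 -> `|C| <= Num.sqrt b * disk_area R.
    move=> b0 b1; have [i1 e1] := radial_constant HC b0 b1.
    have H1 : (`|(C * b)%:E| <= (Num.sqrt b * (disk_area R * b))%:E)%E.
      rewrite -e1 EFinM -integral_radf1//.
      apply: le_trans (le_abse_integral _ _ _) _ => //; first exact: (measurable_int _ i1).
      have m1 : measurable_fun setT (fun w : plane R => radf (fun=> 1) (0, 0) (indle b) w).
        apply: measurable_radf; [exact: nrm2_00| |exact: measurable_indle].
        by move=> w _; exact: cvg_cst.
      have p1 w : 0 <= radf (fun=> 1) (0, 0) (indle b) w.
        by rewrite radf_0; case: ifP => // _; rewrite mul1r indleE.
      rewrite -ge0_integralZl ?lee_fin ?sqrtr_ge0//;
        [|exact/measurable_EFinP|by move=> w _; rewrite lee_fin].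
      apply: ge0_le_integral => //.
      - exact: measurableT_comp (measurable_int _ i1).
      - by apply: measurable_funeM; exact/measurable_EFinP.
      - move=> w _; rewrite -EFinM abse_EFin lee_fin !radf_0; case: ifPn => hw; last first.
          by rewrite normr0 mulr0.
        rewrite indleE; have [h|h] := leP (nrm2 w) b; last by rewrite !mulr0 normr0.
        rewrite !mulr1; have r1 : nrm2 x * nrm2 w < 1.
          by apply: le_lt_trans hw; rewrite ler_piMl ?nrm2_ge0// ltW.
        have [hp _] := abs_pw_le d r1; apply: le_trans hp _.
        have s1 : Num.sqrt (nrm2 x * nrm2 w) <= Num.sqrt b.
          rewrite ler_sqrt//; last exact: ltW.
          by apply: le_trans h; rewrite ler_piMl ?nrm2_ge0// ltW.
        apply: le_trans _ s1; case: (d) d0 => // d' _.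
        rewrite exprS ler_piMr ?sqrtr_ge0// exprn_ile1 ?sqrtr_ge0//.
        by rewrite -[leRHS]sqrtr1 ler_sqrt// ltW.
    move: H1; rewrite abse_EFin lee_fin normrM (gtr0_norm b0) mulrA.
    by rewrite ler_pM2r.
  apply/ler_addgt0Pr => e e0; rewrite add0r.
  pose s := Num.min (1 / 2) (e / disk_area R).
  have s0 : 0 < s by rewrite lt_min !divr_gt0.
  have s1 : s <= 1 / 2 by rewrite ge_min lexx.
  have s2 : s * disk_area R <= e by rewrite -ler_pdivlMr// ge_min lexx orbT.
  apply: le_trans s2; have := B (s ^+ 2); rewrite sqrtr_sqr (gtr0_norm s0).
  by apply; [rewrite exprn_gt0|nra].
apply: HC => //; first exact: measurable_rweight.
  by move=> t; exact: rweight_ge0.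
by apply: le_lt_trans (rweight_moment _ a0 a1) _; rewrite ltry.
Qed.

Lemma bsum_sq x w N : bsum1 x w N ^+ 2 + bsum2 x w N ^+ 2 =
  \sum_(n < N) \sum_(m < N) (n.+1%:R * m.+1%:R * nrm2 x ^+ minn n m) *
    (nrm2 w ^+ minn n m * (pw x w (maxn n m - minn n m)).1).
Proof.
rewrite /bsum1 /bsum2 !expr2 !big_distrlr /= -big_split /=.
apply: eq_bigr => n _; rewrite -big_split /=; apply: eq_bigr => m _.
have := pw_mul x w n m; rewrite exprMn => H.
rewrite -mulrA mulrCA [RHS]mulrA.
transitivity (n.+1%:R * m.+1%:R * (nrm2 x ^+ minn n m * nrm2 w ^+ minn n m *
   (pw x w (maxn n m - minn n m)).1)); last by ring.
by rewrite -H; ring.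
Qed.

(** Expanding the square, only the diagonal terms survive by orthogonality; the moments of the
    weight sqrt(1 - t) turn the coefficients (n + 1)^2 into (n + 1) / sqrt(n + 2), which is the
    series bounded above. *)
Lemma integral_bsum x N (a : R) : nrm2 x < 1 -> 0 < a -> a < 1 ->
  (\int[mu]_w (radf (fun w => (bsum1 x w N ^+ 2 + bsum2 x w N ^+ 2) *
      Num.sqrt (1 - nrm2 w)) (0, 0) (indle a) w)%:E <=
   (disk_area R * (Num.sqrt (4 / 5) / Num.sqrt (1 - nrm2 x) ^+ 3))%:E)%E.
Proof.
move=> hx a0 a1; have [A0 _ _] := disk_area_props R.
pose f n m w := rweight (minn n m) (mobT0 (0, 0) w) *
  radf (fun w => (pw x w (maxn n m - minn n m)).1) (0, 0) (indle a) w.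
pose k n m : R := n.+1%:R * m.+1%:R * nrm2 x ^+ minn n m.
have fi n m := pw_radial_integral (maxn n m - minn n m) (minn n m) hx a0 a1.
have E w : (radf (fun w => (bsum1 x w N ^+ 2 + bsum2 x w N ^+ 2) *
      Num.sqrt (1 - nrm2 w)) (0, 0) (indle a) w)%:E =
    (\sum_(n < N) \sum_(m < N) (k n m)%:E * (f n m w)%:E)%E.
  transitivity ((\sum_(n < N) \sum_(m < N) k n m * f n m w)%:E); last first.
    rewrite -sumEFin; apply: eq_bigr => n _; rewrite -sumEFin.
    by apply: eq_bigr => m _; rewrite EFinM.
  congr (_%:E); rewrite radf_0; case: ifPn => hw; last first.
    rewrite big1// => n _; rewrite big1// => m _.
    by rewrite /f radf_0 (negPf hw) !mulr0.
  rewrite bsum_sq !mulr_suml; apply: eq_bigr => n _; rewrite !mulr_suml.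
  apply: eq_bigr => m _; rewrite /f radf_0 hw mobT0_0// /rweight ger0_norm ?nrm2_ge0//.
  by rewrite /k; ring.
under eq_integral do rewrite E.
rewrite integral_sum//; last first.
  move=> n; apply: integrable_sum => // m _; apply: integrableZl => //.
  by have [] := fi n m.
under eq_bigr => n _.
  rewrite integral_sum//; last first.
    by move=> m; apply: integrableZl => //; have [] := fi n m.
  under eq_bigr => m _.
    rewrite integralZl//; last by have [] := fi n m.
    rewrite (fi n m).2; over.
  over.
pose M n := fine (\int[lebesgue_measure]_(t in `[0%R, a]) (rweight n t)%:E)%E.
have ME n : (\int[lebesgue_measure]_(t in `[0%R, a]) (rweight n t)%:E = (M n)%:E)%E.
  rewrite fineK// ge0_fin_numE; last first.
    by apply: integral_ge0 => t _; rewrite lee_fin rweight_ge0.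
  by apply: le_lt_trans (rweight_moment _ a0 a1) _; rewrite ltry.
have Mle n : M n <= (n.+1%:R * Num.sqrt n.+2%:R)^-1.
  by rewrite -lee_fin -ME rweight_moment.
under eq_bigr => n _.
  rewrite (bigD1 n)//= minnn maxnn subnn eqxx mul1r ME.
  rewrite big1 ?adde0; last first.
    move=> m mn; have -> : (maxn n m - minn n m == 0)%N = false.
      apply/negbTE; rewrite subn_eq0 -ltnNge.
      by case: (ltngtP n m) mn => // /val_inj ->; rewrite eqxx.
    by rewrite mul0r mul0e mule0.
  rewrite -!EFinM; over.
rewrite sumEFin lee_fin.
apply: le_trans (_ : _ <= disk_area R *
  (\sum_(n < N) n.+1%:R / Num.sqrt n.+2%:R * nrm2 x ^+ n)) _; last first.
  by rewrite ler_pM2l// bergman_sum_le// nrm2_ge0.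
rewrite mulr_sumr; apply: ler_sum => n _.
rewrite /k minnn.
have -> : n.+1%:R * n.+1%:R * nrm2 x ^+ n * (disk_area R * M n) =
  disk_area R * (n.+1%:R * n.+1%:R * M n * nrm2 x ^+ n) by ring.
rewrite ler_pM2l// ler_wpM2r ?exprn_ge0 ?nrm2_ge0//.
have -> : n.+1%:R / Num.sqrt n.+2%:R = n.+1%:R * n.+1%:R * (n.+1%:R * Num.sqrt n.+2%:R)^-1 :> R.
  rewrite invfM mulrA mulfK//.
by rewrite ler_wpM2l// mulr_ge0.
Qed.

Lemma integral_dAE (g : R * R -> R) :
  measurable_fun (disk R : set (plane R)) (g : plane R -> R) ->
  (forall w, disk R w -> 0 <= g w) ->
  (\int[dA R]_(w in disk R) (g w)%:E =
   (disk_area R)^-1%:E * \int[mu]_(w in disk R) (g w)%:E)%E.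
Proof.
move=> mg g0; rewrite /dA ge0_integral_mscale//.
- exact: measurable_disk.
- exact/measurable_EFinP.
Qed.

Lemma cont_bsum x N w : cont_at w (bsum1 x ^~ N) /\ cont_at w (bsum2 x ^~ N).
Proof.
rewrite /bsum1 /bsum2; elim: N => [|N [IH1 IH2]].
  by split; under eq_fun do rewrite big_ord0; exact: cont_cst.
have [c1 c2] := cont_pw x N w; split.
- have -> : (fun w => \sum_(n < N.+1) n.+1%:R * (pw x w n).1) = (fun w =>
     \sum_(n < N) n.+1%:R * (pw x w n).1 + N.+1%:R * (pw x w N).1).
    by apply/funext => v; rewrite big_ord_recr.
  by apply: contD => //; apply: contM => //; exact: cont_cst.
- have -> : (fun w => \sum_(n < N.+1) n.+1%:R * (pw x w n).2) = (fun w =>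
     \sum_(n < N) n.+1%:R * (pw x w n).2 + N.+1%:R * (pw x w N).2).
    by apply/funext => v; rewrite big_ord_recr.
  by apply: contD => //; apply: contM => //; exact: cont_cst.
Qed.

(** The integral of |K(x,w)|^2 h(w) dA(w) is at most c h(x) K(x,x), for h(x) = sqrt(1 - |x|^2)
    and c = sqrt(4/5): the weight makes the constant smaller than 1, whereas h = 1 would give
    exactly 1 by the reproducing property. Partial sums of the kernel on disks of radius tending
    to 1 converge pointwise, so Fatou's lemma applies. *)
Theorem bergman_schur x : disk R x ->
  (\int[dA R]_(w in disk R) ((mobq x w ^+ 2)^-1 * Num.sqrt (1 - nrm2 w))%:E <=
   (Num.sqrt (4 / 5) / Num.sqrt (1 - nrm2 x) ^+ 3)%:E)%E.
Proof.
move=> /diskE hx; have [A0 _ _] := disk_area_props R.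
pose f w := (mobq x w ^+ 2)^-1 * Num.sqrt (1 - nrm2 w).
have cf : cont_disk f.
  move=> w /diskE hw; rewrite -/(cont_at w f) /f; cont.
  - by rewrite expf_neq0// gt_eqF// mobq_gt0.
  - exact: cont_mobq.
  - apply: (@cont_comp _ _ (@Num.sqrt R)); first exact: sqrt_continuous.
    by rewrite /nrm2; cont.
have mf : measurable_fun (disk R : set (plane R)) (f : plane R -> R).
  exact: continuous_plane_measurable_fun (@open_disk R) cf.
have f0 w : disk R w -> 0 <= f w.
  by move=> _; rewrite mulr_ge0 ?sqrtr_ge0// invr_ge0 sqr_ge0.
rewrite integral_dAE// -lee_pdivlMl ?invr_gt0//.
pose a N : R := 1 - N.+2%:R^-1.
have a0 N : 0 < a N by rewrite subr_gt0 invf_lt1// ltr1n.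
have a1 N : a N < 1 by rewrite ltrBlDr ltrDl invr_gt0.
pose fN N w := radf (fun w => (bsum1 x w N ^+ 2 + bsum2 x w N ^+ 2) *
      Num.sqrt (1 - nrm2 w)) (0, 0) (indle (a N)) w.
have fN0 N w : 0 <= fN N w.
  rewrite /fN radf_0; case: ifP => // _; rewrite mulr_ge0 ?indleE//.
  by rewrite mulr_ge0 ?sqrtr_ge0// addr_ge0// sqr_ge0.
have mfN N : measurable_fun setT (EFin \o (fN N : plane R -> R)).
  apply/measurable_EFinP; apply: measurable_radf; [exact: nrm2_00| |exact: measurable_indle].
  move=> w Dw; set g := (X in {for w, continuous X}).
  rewrite -/(cont_at w g) /g; cont.
  - by have [] := cont_bsum x N w.
  - by have [] := cont_bsum x N w.
  - apply: (@cont_comp _ _ (@Num.sqrt R)); first exact: sqrt_continuous.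
    by rewrite /nrm2; cont.
have lim w : disk R w -> (fN N w)%:E @[N --> \oo] --> (f w)%:E.
  move=> /diskE hw; apply: cvg_EFin; first by near=> N.
  have r1 : nrm2 x * nrm2 w < 1.
    by apply: le_lt_trans hw; rewrite ler_piMl ?nrm2_ge0// ltW.
  have := cvg_bsum r1 (lt0r_neq0 (mobq_gt0 hx hw)) => H.
  have : (bsum1 x w N ^+ 2 + bsum2 x w N ^+ 2) * Num.sqrt (1 - nrm2 w) @[N --> \oo] --> f w.
    by apply: cvgM => //; exact: cvg_cst.
  apply: cvg_trans; apply: near_eq_cvg; near=> N.
  rewrite /fN /= radf_0 hw indleE.
  have -> : nrm2 w <= a N; last by rewrite mulr1.
  near: N.
  have [n hn] := ltr_add_invr hw; exists n => // N /= nN.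
  have : N.+2%:R^-1 <= n.+1%:R^-1 :> R by rewrite lef_pV2 ?posrE// ler_nat ltnS leqW.
  by move: hn; rewrite /a; move: (n.+1%:R^-1) (N.+2%:R^-1) => p q; lra.
rewrite (_ : \int[mu]_(w in disk R) (f w)%:E =
    \int[mu]_(w in disk R) limn_einf (fun N => (fN N w)%:E))%E; last first.
  apply: eq_integral => w; rewrite inE => Dw.
  have L := lim _ Dw; rewrite is_cvg_limn_einfE; last first.
    by apply/cvg_ex; exists (f w)%:E.
  by apply/esym/cvg_lim.
apply: le_trans (fatou _ _ _ _) _.
- exact: measurable_disk.
- by move=> N; exact: measurable_funTS (mfN N).
- by move=> N w _; rewrite lee_fin.
rewrite limn_einf_lim; apply: lime_le; first exact: is_cvg_einfs.
near=> N; apply: (@le_trans _ _ (\int[mu]_(w in disk R) (fN N w)%:E)%E).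
  by apply: ereal_inf_lbound; exists N => /=.
apply: (@le_trans _ _ (\int[mu]_w (fN N w)%:E)%E).
  apply: ge0_subset_integral.
  - exact: measurable_disk.
  - exact: measurableT.
  - exact: mfN.
  - by move=> w _; rewrite lee_fin; exact: fN0.
  - exact: subsetT.
by apply: le_trans (integral_bsum N hx (a0 N) (a1 N)) _; rewrite invrK EFinM.
Unshelve. all: by end_near.
Qed.

End Schur.

(** * Linear statistics and the first two correlation functions *)

Section LinearStatistics.
Import HBSimple.
Variable R : realType.
Implicit Types (X : configuration R) (g : R * R -> R).

Definition cball (r : R) : set (R * R) := [set w | nrm2 w <= r].

Lemma finite_points X (r : R) : r < 1 -> finite_set (points X `&` cball r).
Proof.
move=> r1; apply: points_locally_finite; first exact: compact_closed_disk.
by move=> w wr; apply/diskE; exact: le_lt_trans r1.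
Qed.

Definition lstat g X : R := \sum_(x \in points X) g x.

Lemma lstat_restrict g (r : R) X : (forall x, ~ cball r x -> g x = 0) ->
  lstat g X = \sum_(x \in points X `&` cball r) g x.
Proof.
move=> g0; rewrite /lstat; apply/esym/fsbig_widen; first exact: subIsetl.
by move=> x [Xx /not_andP[]//]; exact: g0.
Qed.

(** Preimages are countable unions of the events that generate the sigma-algebra of
    configurations. *)
Lemma measurable_count (B : set (plane R)) (r : R) : r < 1 -> measurable B ->
  B `<=` cball r ->
  measurable_fun setT (fun X : Conf R => \sum_(x \in points X `&` B) (1 : R)).
Proof.
move=> r1 mB Br _ D mD; rewrite setTI.
pose E n := [set X : configuration R | (points X `&` B #= `I_n)%card].
have E1 n X : E n X -> \sum_(x \in points X `&` B) (1 : R) = n%:R.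
  move=> En; rewrite fsbig_finite//=; last by exists n.
  by rewrite big_const_seq count_predT (card_fset_set En) iter_addr_0.
have -> : (fun X : Conf R => \sum_(x \in points X `&` B) (1 : R)) @^-1` D =
    \bigcup_(n in [set n | D n%:R]) (E n : set (Conf R)).
  apply/seteqP; split=> X /=.
    have : finite_set (points X `&` B).
      by apply: sub_finite_set (finite_points X r1) => x [? /Br].
    by case=> n En; rewrite (E1 n X En) => Dn; exists n.
  by case=> n Dn En; rewrite (E1 n X En).
apply: bigcup_measurable => n _; apply: sub_gen_smallest.
exists B, (cball r), n; split => //; first exact: compact_closed_disk.
by move=> w wr; apply/diskE; exact: le_lt_trans r1.
Qed.

(** A pointwise limit of linear statistics of simple functions, which are combinations of
    counts. *)
Lemma measurable_lstat g (r : R) : r < 1 -> measurable_fun setT (g : plane R -> R) ->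
  (forall x, ~ cball r x -> g x = 0) ->
  measurable_fun setT (lstat g : Conf R -> R).
Proof.
move=> r1 mg g0.
have mgE : measurable_fun setT (EFin \o (g : plane R -> R)) by exact/measurable_EFinP.
have [h hg] := approximation_sfun measurableT mgE.
refine (@measurable_fun_cvg _ (Conf R) R setT
    (fun n (X : Conf R) => \sum_(x \in points X `&` cball r) h n x) (lstat g) _ _).
  move=> n.
  have -> : (fun X : Conf R => \sum_(x \in points X `&` cball r) h n x) =
      (fun X : Conf R => \sum_(y <- finmap.enum_fset (fset_set (range (h n))))
         y * \sum_(x \in points X `&` (cball r `&` (h n @^-1` [set y]))) (1 : R)).
    apply/funext => X; have fX := finite_points X r1.
    under eq_fsbigr do rewrite fimfunE.
    rewrite exchange_fsbig//= fsbig_finite//=; apply: eq_bigr => y _.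
    rewrite -mulr_fsumr; congr (_ * _).
    rewrite setIA [RHS]fsbig_mkcondr.
    apply: (@eq_fsbigr R 0 +%R).
    move=> x _.
    by rewrite indicE; case: ifP.
  apply: measurable_sum => y; apply: measurable_funM; first exact: measurable_cst.
  apply: (measurable_count r1); last exact: subIsetl.
  by apply: measurableI; [exact: measurable_ball_nrm2|exact: measurable_sfunP].
move=> X _; rewrite (lstat_restrict _ g0).
have fX := finite_points X r1; rewrite fsbig_finite//=.
under eq_fun do rewrite fsbig_finite//=.
have hgx x : h n x @[n --> \oo] --> g x by have /fine_cvgP[] := hg x I.
have L l : \sum_(x <- l) h n x @[n --> \oo] --> \sum_(x <- l) g x.
  elim: l => [|x l IH].
    by rewrite big_nil; under eq_fun do rewrite big_nil; exact: cvg_cst.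
  rewrite big_cons (_ : (fun n => \sum_(y <- x :: l) h n y) =
    (fun n => h n x + \sum_(y <- l) h n y)); first exact: cvgD.
  by apply/funext => n; rewrite big_cons.
exact: L.
Qed.

Lemma esum_support (T : choiceType) (P Q : set T) (a : T -> \bar R) :
  Q `<=` P -> (forall k, P k -> ~ Q k -> a k = 0%E) ->
  (\esum_(k in P) a k = \esum_(k in Q) a k)%E.
Proof.
move=> QP a0; rewrite esum_mkcond [RHS]esum_mkcond; apply: eq_esum => k _.
have [Qk|Qk] := boolP (k \in Q); first by rewrite mem_set//; apply: QP; exact: set_mem.
case: ifPn => // /set_mem Pk; apply: a0 => // h.
by move: Qk; rewrite mem_set.
Qed.

Lemma esum_finite (T : choiceType) (F : set T) (a : T -> R) : finite_set F ->
  (forall k, F k -> 0 <= a k) ->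
  (\esum_(k in F) (a k)%:E = (\sum_(k \in F) a k)%:E)%E.
Proof.
move=> fF a0; rewrite esum_fset//; last by move=> k /set_mem Fk; rewrite lee_fin a0.
by rewrite !fsbig_finite//= sumEFin.
Qed.

Lemma esum_lstat g (r : R) X : r < 1 -> (forall x, ~ cball r x -> g x = 0) ->
  (forall x, 0 <= g x) -> (\esum_(x in points X) (g x)%:E = (lstat g X)%:E)%E.
Proof.
move=> r1 gs g0; have fX := finite_points X r1.
rewrite (lstat_restrict X gs) -esum_finite//.
apply: esum_support; first exact: subIsetl.
by move=> k Xk /not_andP[//|kr]; rewrite gs.
Qed.

(** Pairs of distinct points are all pairs minus the diagonal. *)
Lemma esum_pairs g h (r : R) X : r < 1 ->
  (forall x, ~ cball r x -> g x = 0) -> (forall x, 0 <= g x) ->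
  (forall x, ~ cball r x -> h x = 0) -> (forall x, 0 <= h x) ->
  (\esum_(t in [set t : 2.-tuple (plane R) |
       uniq t /\ forall i, points X (tnth t i)]) (g (tnth t ord0) * h (tnth t ord_max))%:E =
   (lstat g X * lstat h X - lstat (fun x => g x * h x) X)%:E)%E.
Proof.
move=> r1 gs g0 hs h0; have fX := finite_points X r1.
set F := points X `&` cball r in fX.
pose Q := F `*`` (fun x => F `\ x).
pose e (k : plane R * plane R) : 2.-tuple (plane R) := [tuple k.1; k.2].
have bij : set_bij (points X `*`` (fun x => points X `\ x)) [set t : 2.-tuple (plane R) |
       uniq t /\ forall i, points X (tnth t i)] e.
  split.
  - move=> [x y] /= [Xx [Xy xy]]; split.
      by rewrite inE andbT; apply/eqP => xy'; apply: xy; rewrite xy'.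
    by case=> -[|[|//]] i; rewrite (tnth_nth x).
  - by move=> [x y] [x' y'] _ _ /(congr1 val)/= [-> ->].
  - move=> t [ut Xt]; exists (tnth t ord0, tnth t ord_max) => /=.
      split; [exact: Xt|split; first exact: Xt].
      move=> /=; rewrite !(tnth_nth (0, 0)) /= => E.
      by have := (uniqP _ ut) 1%N 0%N; rewrite !inE size_tuple => /(_ _ isT isT E).
    apply: eq_from_tnth => i; case: i => -[|[|//]] i; rewrite (tnth_nth (0, 0)) /=;
      by congr (tnth t _); apply/val_inj.
rewrite (@reindex_esum _ _ _ _ _ e _ bij) (@esum_support _ _ Q)/=; last 2 first.
- by move=> [x y] [[/= Xx _] [[/= Xy _] xy]]; split => //=; split.
- move=> [x y] [/= Xx [Xy xy]] nQ; have [xr|xr] := pselect (cball r x); last first.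
    by rewrite /e (tnth_nth (0, 0))/= gs ?mul0r.
  have [yr|yr] := pselect (cball r y); last by rewrite /e [tnth _ ord_max](tnth_nth (0, 0))/= hs ?mulr0.
  by case: nQ; split.
have sumE x : F x -> \sum_(y \in F `\ x) g x * h y = g x * (lstat h X - h x).
  move=> Fx; rewrite -mulr_fsumr (lstat_restrict X hs) -/F.
  by rewrite [in RHS](fsbigD1 x)//=; ring.
transitivity (\esum_(x in F) (\esum_(y in F `\ x) (g x * h y)%:E))%E.
  rewrite esum_esum; last by move=> i j _ _; rewrite lee_fin mulr_ge0.
  apply: eq_esum => -[x y] _; rewrite /e /= (tnth_nth (0, 0)) /=.
  by rewrite (tnth_nth (0, 0)).
transitivity (\esum_(x in F) (g x * (lstat h X - h x))%:E)%E.
  apply: eq_esum => x Fx; rewrite esum_finite ?sumE//; first exact: finite_setD.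
  by move=> y _; rewrite mulr_ge0.
rewrite esum_finite//; last first.
  by move=> x Fx; rewrite -sumE//; apply: fsumr_ge0 => y _; rewrite mulr_ge0.
congr (_%:E); rewrite (lstat_restrict X gs) -/F.
rewrite (@lstat_restrict (fun x => g x * h x) r X); last by move=> x xr; rewrite gs ?mul0r.
rewrite -/F mulr_fsuml; apply/eqP; rewrite eq_sym subr_eq -fsbig_split//=.
by apply/eqP/eq_fsbigr => x _; ring.
Qed.

End LinearStatistics.

Section DiskMeasure.
Variable R : realType.

Lemma measurable_indic_disk :
  measurable_fun setT (\1_(disk R : set (plane R)) : plane R -> R).
Proof. by apply: measurable_indic; exact: measurable_disk. Qed.

Lemma indic_disk_ge0 (w : plane R) : 0 <= \1_(disk R : set (plane R)) w :> R.
Proof. by rewrite indicE ler0n. Qed.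

(** The restriction of [dA] to the disk, as a finite measure on the whole plane:
    this is the form in which Tonelli's theorem applies to it. *)
Definition diskm0 : {measure set (plane R) -> \bar R} :=
  @density _ _ R (dA R) _ measurable_indic_disk indic_disk_ge0.

Lemma integral_diskm0 (g : plane R -> \bar R) : measurable_fun setT g ->
  (forall w, 0 <= g w)%E ->
  (\int[dA R]_(w in disk R) g w = \int[diskm0]_w g w)%E.
Proof.
move=> mg g0; rewrite ge0_integral_density// [LHS]integral_mkcond.
apply: eq_integral => w _; rewrite patchE indicE.
by case: ifPn => _; rewrite ?mule1 ?mule0.
Qed.

Lemma dA_disk : dA R (disk R) = 1%E.
Proof.
have [A0 AE _] := disk_area_props R.
rewrite /dA /= /mscale /= AE -EFinM; congr (_%:E).
by rewrite mulVf// gt_eqF.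
Qed.

Lemma diskm0_setT : diskm0 setT = 1%E.
Proof.
transitivity (\int[diskm0]_w cst 1%E w)%E; first by rewrite integral_cst// mul1e.
rewrite -integral_diskm0// integral_cst ?mul1e ?dA_disk//; exact: measurable_disk.
Qed.

Lemma fin_num_diskm0 : fin_num_fun diskm0.
Proof.
move=> A mA; rewrite ge0_fin_numE//; apply: (@le_lt_trans _ _ (diskm0 setT)).
  by apply: le_measure; rewrite ?inE.
by rewrite diskm0_setT ltry.
Qed.

Definition diskm : set (plane R) -> \bar R := diskm0.
HB.instance Definition _ := Measure.on diskm.
HB.instance Definition _ := @Measure_isFinite.Build _ _ _ diskm fin_num_diskm0.

Lemma integral_diskm (g : plane R -> \bar R) : measurable_fun setT g ->
  (forall w, 0 <= g w)%E ->
  (\int[dA R]_(w in disk R) g w = \int[diskm]_w g w)%E.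
Proof. exact: integral_diskm0. Qed.

End DiskMeasure.

Lemma det_mx2 (F : comRingType) (M : 'M[F]_2) :
  \det M = M ord0 ord0 * M ord_max ord_max - M ord0 ord_max * M ord_max ord0.
Proof.
rewrite (expand_det_row _ ord0) !big_ord_recl big_ord0 /cofactor !det_mx11 !mxE /=.
have -> : lift ord0 (ord0 : 'I_1) = ord_max by apply/val_inj.
have -> : lift (ord_max : 'I_2) (ord0 : 'I_1) = ord0 by apply/val_inj.
by rewrite expr0 expr1 mul1r mulN1r mulrN addr0.
Qed.

Section Moments.
Local Open Scope complex_scope.
Local Open Scope ring_scope.
Variables (R : realType) (P : probability (Conf R) R).
Hypothesis hP : determinantal (@bergman_kernel R) P.
Local Notation diskm := (@diskm R).
Implicit Types x y : R * R.

(** K(x,x) and |K(x,y)|^2. *)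
Definition kernel_diag (x : R * R) : R := ((1 - nrm2 x) ^+ 2)^-1.
Definition kernel_sq (x y : R * R) : R := (mobq x y ^+ 2)^-1.

Lemma bergman_kernel_mul x y : bergman_kernel x y * bergman_kernel y x =
  (kernel_sq x y)%:C.
Proof.
have H : (1 - cplx x * (cplx y)^*) * (1 - cplx y * (cplx x)^*) = (mobq x y)%:C.
  by apply/eqP; rewrite eq_complex /=; apply/andP; split; apply/eqP; rewrite /mobq; ring.
by rewrite /bergman_kernel /kernel_sq -invfM -exprMn H -rmorphXn -fmorphV.
Qed.

Lemma bergman_kernel_diag x : bergman_kernel x x = (kernel_diag x)%:C.
Proof.
have H : 1 - cplx x * (cplx x)^* = (1 - nrm2 x)%:C.
  by apply/eqP; rewrite eq_complex /=; apply/andP; split; apply/eqP; rewrite /nrm2; ring.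
by rewrite /bergman_kernel /kernel_diag H -rmorphXn -fmorphV.
Qed.

Lemma kernel_diag_ge0 x : 0 <= kernel_diag x.
Proof. by rewrite invr_ge0 sqr_ge0. Qed.

Lemma kernel_sq_ge0 x y : 0 <= kernel_sq x y.
Proof. by rewrite invr_ge0 sqr_ge0. Qed.

Lemma kernel_sqC x y : kernel_sq x y = kernel_sq y x.
Proof. by rewrite /kernel_sq /mobq; congr (_ ^+ 2)^-1; ring. Qed.

Lemma mobq_ge x y : (1 - nrm2 x) * (1 - nrm2 y) <= mobq x y.
Proof.
have -> : mobq x y = (1 - nrm2 x) * (1 - nrm2 y) + ((x.1 - y.1) ^+ 2 + (x.2 - y.2) ^+ 2).
  by rewrite /mobq /nrm2; ring.
by rewrite lerDl addr_ge0// sqr_ge0.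
Qed.

(** Cauchy-Schwarz for the kernel: the second correlation function is nonnegative. *)
Lemma kernel_sq_le x y : disk R x -> disk R y -> kernel_sq x y <= kernel_diag x * kernel_diag y.
Proof.
move=> /diskE hx /diskE hy; rewrite /kernel_sq /kernel_diag -invfM -exprMn.
have p0 : 0 < (1 - nrm2 x) * (1 - nrm2 y) by rewrite mulr_gt0// subr_gt0.
rewrite lef_pV2 ?posrE ?exprn_gt0// ?(lt_le_trans p0 (mobq_ge x y))//.
by rewrite lerXn2r ?nnegrE ?(ltW p0)// ?(le_trans (ltW p0) (mobq_ge x y))// mobq_ge.
Qed.

Lemma first_correlation (g : R * R -> R) : measurable_fun setT (g : plane R -> R) ->
  (forall x, 0 <= g x) ->
  (\int[P]_X (\esum_(x in points X) (g x)%:E) = \int[dA R]_(x in disk R) (g x * kernel_diag x)%:E)%E.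
Proof.
move=> mg g0.
pose phi (t : 1.-tuple (plane R)) := (g (tnth t ord0))%:E.
have mphi : measurable_fun setT phi.
  apply/measurable_EFinP; apply: (measurableT_comp mg); exact: measurable_tnth.
have phi0 t : (0 <= phi t)%E by rewrite lee_fin.
have := hP (ltn0Sn 0) mphi phi0; rewrite /disk_iint => H.
transitivity (\int[P]_X (\esum_(t in [set t : 1.-tuple (plane R) |
         uniq t /\ forall i, points X (tnth t i)]) phi t))%E.
  apply: eq_integral => X _.
  pose e (x : plane R) : 1.-tuple (plane R) := [tuple x].
  rewrite (@reindex_esum _ _ _ (points X) _ e).
    by apply: eq_esum => x _; rewrite /phi /e (tnth_nth x).
  split.
  - by move=> x Xx; split => // i; rewrite ord1 (tnth_nth x).
  - by move=> x y _ _ /(congr1 val)/= [].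
  - move=> t [_ Xt]; exists (tnth t ord0); first exact: Xt.
    apply: eq_from_tnth => i; rewrite (ord1 i) /e.
    by rewrite [LHS](tnth_nth (0, 0)).
rewrite H; apply: eq_integral => x _; rewrite /phi det_mx11 mxE.
transitivity ((g x)%:E * (complex.Re (bergman_kernel x x))%:E)%E; first exact: erefl.
by rewrite bergman_kernel_diag -EFinM.
Qed.

Lemma second_correlation (g h : R * R -> R) :
  measurable_fun setT (g : plane R -> R) -> measurable_fun setT (h : plane R -> R) ->
  (forall x, 0 <= g x) -> (forall x, 0 <= h x) ->
  (\int[P]_X (\esum_(t in [set t : 2.-tuple (plane R) |
       uniq t /\ forall i, points X (tnth t i)]) (g (tnth t ord0) * h (tnth t ord_max))%:E) =
   \int[dA R]_(x in disk R) \int[dA R]_(y in disk R)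
     (g x * h y * (kernel_diag x * kernel_diag y - kernel_sq x y))%:E)%E.
Proof.
move=> mg mh g0 h0.
pose phi (t : 2.-tuple (plane R)) := (g (tnth t ord0) * h (tnth t ord_max))%:E.
have mphi : measurable_fun setT phi.
  apply/measurable_EFinP; apply: measurable_funM.
    by apply: (measurableT_comp mg); exact: measurable_tnth.
  by apply: (measurableT_comp mh); exact: measurable_tnth.
have phi0 t : (0 <= phi t)%E by rewrite lee_fin mulr_ge0.
have := hP (ltn0Sn 1) mphi phi0; rewrite /disk_iint => ->.
apply: eq_integral => x _; apply: eq_integral => y _.
rewrite /phi -EFinM !(tnth_nth x) /=; congr ((_ * _)%:E).
rewrite det_mx2 !mxE.
transitivity (complex.Re (bergman_kernel x x * bergman_kernel y y -
  bergman_kernel x y * bergman_kernel y x)); first exact: erefl.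
rewrite bergman_kernel_mul !bergman_kernel_diag.
by rewrite -rmorphM -rmorphB.
Qed.

End Moments.

(** * Variance of a linear statistic *)

Section Tame.
Variable R : realType.
Implicit Types (x y : R * R) (g h : R * R -> R) (X : configuration R).
Local Notation diskm := (@diskm R).

(** Linear statistics of such functions are finite sums over the points in a compact subdisk,
    and all their moments below are finite. *)
Definition tame g := measurable_fun setT (g : plane R -> R) /\
  exists r M : R, [/\ r < 1, (forall x, ~ cball r x -> g x = 0) & forall x, `|g x| <= M].

Lemma tameM g h : tame g -> tame h -> tame (fun x => g x * h x).
Proof.
move=> [mg [r [M [r1 gs gM]]]] [mh [_ [N [_ _ hN]]]]; split; first exact: measurable_funM.
exists r, (M * N); split => // [x xr|x]; first by rewrite gs// mul0r.
by rewrite normrM; apply: ler_pM.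
Qed.

Lemma tameN g : tame g -> tame (fun x => - g x).
Proof.
move=> [mg [r [M [r1 gs gM]]]]; split; first exact: measurable_funN.
by exists r, M; split => // x; [move=> /gs ->; rewrite oppr0|rewrite normrN].
Qed.

Lemma tameD g h : tame g -> tame h -> tame (fun x => g x + h x).
Proof.
move=> [mg [r [M [r1 gs gM]]]] [mh [r' [N [r'1 hs hN]]]]; split; first exact: measurable_funD.
exists (Num.max r r'), (M + N); split => [|x xm|x].
- by rewrite gt_max r1.
- by rewrite gs ?hs ?addr0// => xr; apply: xm; rewrite /cball /= le_max xr ?orbT.
- by apply: le_trans (ler_normD _ _) _; exact: lerD.
Qed.

Lemma tame_pos g : tame g -> tame (fun x => Num.max (g x) 0).
Proof.
move=> [mg [r [M [r1 gs gM]]]]; split.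
  by apply: measurable_maxr => //; exact: measurable_cst.
exists r, M; split => // x; first by move=> /gs ->; rewrite maxxx.
rewrite ger0_norm ?le_max ?lexx ?orbT// ge_max; apply/andP; split.
  by apply: le_trans (gM x); exact: ler_norm.
by apply: le_trans (gM x).
Qed.

Lemma tame_common_support g h : tame g -> tame h -> exists2 r : R, r < 1 &
  (forall x, ~ cball r x -> g x = 0) /\ (forall x, ~ cball r x -> h x = 0).
Proof.
move=> [_ [r [_ [r1 gs _]]]] [_ [r' [_ [r'1 hs _]]]].
exists (Num.max r r'); first by rewrite gt_max r1.
by split=> x xm; [apply: gs|apply: hs] => xr; apply: xm;
  rewrite /cball /= le_max xr ?orbT.
Qed.

Lemma measurable_tame_lstat g : tame g -> measurable_fun setT (lstat g : Conf R -> R).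
Proof. by move=> [mg [r [_ [r1 gs _]]]]; exact: (measurable_lstat r1). Qed.

Lemma measurable_invr_ge0 d (T : measurableType d) (f : T -> R) :
  measurable_fun setT f -> (forall t, 0 <= f t) ->
  measurable_fun setT (fun t => (f t)^-1).
Proof.
move=> mf f0; rewrite (_ : (fun t => _) = (fun t => f t `^ (-1))).
  exact: measurableT_comp (measurable_powR _) mf.
by apply/funext => t; rewrite powR_inv1.
Qed.

Lemma measurable_kernel_diag : measurable_fun setT (@kernel_diag R : plane R -> R).
Proof.
apply: measurable_invr_ge0; last by move=> t; exact: sqr_ge0.
by apply: measurable_funX; apply: measurable_funB => //; exact: measurable_nrm2.
Qed.

Lemma measurable_kernel_sq :
  measurable_fun setT (fun p : plane R * plane R => kernel_sq p.1 p.2).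
Proof.
apply: measurable_invr_ge0; last by move=> t; exact: sqr_ge0.
have m11 : measurable_fun setT (fun p : plane R * plane R => p.1.1).
  by apply: measurableT_comp; [exact: measurable_fst|exact: measurable_fst].
have m12 : measurable_fun setT (fun p : plane R * plane R => p.1.2).
  by apply: measurableT_comp; [exact: measurable_snd|exact: measurable_fst].
have m21 : measurable_fun setT (fun p : plane R * plane R => p.2.1).
  by apply: measurableT_comp; [exact: measurable_fst|exact: measurable_snd].
have m22 : measurable_fun setT (fun p : plane R * plane R => p.2.2).
  by apply: measurableT_comp; [exact: measurable_snd|exact: measurable_snd].
apply: measurable_funX; rewrite /mobq; apply: measurable_funD; apply: measurable_funX.
  by apply: measurable_funB; [apply: measurable_funB => //|]; exact: measurable_funM.
by apply: measurable_funB; exact: measurable_funM.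
Qed.

Lemma kernel_diag_le (r : R) x : r < 1 -> cball r x -> kernel_diag x <= ((1 - r) ^+ 2)^-1.
Proof.
move=> r1 xr; have h : 0 < 1 - r by rewrite subr_gt0.
have h2 : 1 - r <= 1 - nrm2 x by rewrite lerD2l lerN2.
have h3 := lt_le_trans h h2.
by rewrite /kernel_diag lef_pV2 ?posrE ?exprn_gt0// lerXn2r ?nnegrE// ltW.
Qed.

Lemma tame_integrable g : tame g -> diskm.-integrable setT (fun x => (g x * kernel_diag x)%:E).
Proof.
move=> [mg [r [M [r1 gs gM]]]].
apply: (@le_integrable _ _ _ _ _ _ _ (EFin \o cst (M * ((1 - r) ^+ 2)^-1))) => //.
- by apply/measurable_EFinP; apply: measurable_funM => //; exact: measurable_kernel_diag.
- move=> x _; rewrite lee_fin /= [leRHS]ger0_norm; last first.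
    by rewrite mulr_ge0 ?invr_ge0 ?sqr_ge0// (le_trans _ (gM x)).
  have [xr|xr] := pselect (cball r x); last first.
    by rewrite gs// mul0r normr0 mulr_ge0 ?invr_ge0 ?sqr_ge0// (le_trans _ (gM x)).
  by rewrite normrM ler_pM// ger0_norm ?kernel_diag_ge0// kernel_diag_le.
- exact: finite_measure_integrable_cst.
Qed.

(** [intensity g] is the expectation of the linear statistic of g, and [repulsion g h] the
    amount by which the expectation of the product of the statistics of g and h is smaller than
    for a Poisson process of the same intensity. *)
Definition intensity g : \bar R := (\int[diskm]_x (g x * kernel_diag x)%:E)%E.
Definition repulsion g h : \bar R :=
  (\int[diskm]_x \int[diskm]_y (g x * h y * kernel_sq x y)%:E)%E.

Lemma intensity_fin g : tame g -> intensity g \is a fin_num.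
Proof. by move=> tg; apply: integrable_fin_num => //; exact: tame_integrable. Qed.

Lemma intensity_ge0 g : (forall x, 0 <= g x) -> (0 <= intensity g)%E.
Proof. by move=> g0; apply: integral_ge0 => x _; rewrite lee_fin mulr_ge0 ?kernel_diag_ge0. Qed.

Lemma measurable_fun_repulsion g h : measurable_fun setT (g : plane R -> R) ->
  measurable_fun setT (h : plane R -> R) ->
  measurable_fun setT (fun p : plane R * plane R => (g p.1 * h p.2 * kernel_sq p.1 p.2)%:E).
Proof.
move=> mg mh; apply/measurable_EFinP; apply: measurable_funM; last exact: measurable_kernel_sq.
by apply: measurable_funM; apply: measurableT_comp => //.
Qed.

Lemma repulsion_ge0 g h : (forall x, 0 <= g x) -> (forall x, 0 <= h x) -> (0 <= repulsion g h)%E.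
Proof.
move=> g0 h0; apply: integral_ge0 => x _; apply: integral_ge0 => y _.
by rewrite lee_fin !mulr_ge0 ?kernel_sq_ge0.
Qed.

Lemma measurable_diskm_inner (k : plane R * plane R -> \bar R) :
  measurable_fun setT k -> (forall p, 0 <= k p)%E ->
  measurable_fun setT (fun x => \int[diskm]_y k (x, y))%E.
Proof.
exact: (@measurable_fun_fubini_tonelli_F _ _ _ _ R diskm).
Qed.

Let eta x := Num.sqrt (1 - nrm2 x).

Let measurable_eta : measurable_fun setT (eta : plane R -> R).
Proof.
have ms : measurable_fun setT (@Num.sqrt R).
  by apply: continuous_measurable_fun; exact: sqrt_continuous.
by apply: (measurableT_comp ms); apply: measurable_funB => //; exact: measurable_nrm2.
Qed.

Let schur_integrand_ge0 g x y : 0 <= g x ^+ 2 / eta x * (kernel_sq x y * eta y).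
Proof.
apply: mulr_ge0; last by apply: mulr_ge0; [exact: kernel_sq_ge0|exact: sqrtr_ge0].
by apply: mulr_ge0; [exact: sqr_ge0|rewrite invr_ge0 sqrtr_ge0].
Qed.

Let measurable_schur_integrand g : measurable_fun setT (g : plane R -> R) ->
  measurable_fun setT (fun p : plane R * plane R =>
    (g p.1 ^+ 2 / eta p.1 * (kernel_sq p.1 p.2 * eta p.2))%:E).
Proof.
move=> mg; apply/measurable_EFinP; apply: measurable_funM.
  apply: measurable_funM.
    by apply: measurable_funX; apply: measurableT_comp => //.
  apply: measurable_invr_ge0; last by move=> p; exact: sqrtr_ge0.
  by apply: measurableT_comp => //.
apply: measurable_funM; first exact: measurable_kernel_sq.
by apply: measurableT_comp => //.
Qed.

(** The Schur estimate, integrated against g^2 / eta, with eta = sqrt(1 - |x|^2). *)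
Let schur_half g : tame g ->
  (\int[diskm]_x \int[diskm]_y (g x ^+ 2 / eta x * (kernel_sq x y * eta y))%:E <=
   (Num.sqrt (4 / 5))%:E * intensity (fun x => (g x ^+ 2)%R))%E.
Proof.
move=> tg; have [mg [r [M [r1 gs gM]]]] := tg.
have m2 := measurable_schur_integrand mg.
have p2 (p : plane R * plane R) :
    (0 <= (g p.1 ^+ 2 / eta p.1 * (kernel_sq p.1 p.2 * eta p.2))%:E)%E.
  by rewrite lee_fin schur_integrand_ge0.
rewrite -ge0_integralZl//; last 2 first.
- apply/measurable_EFinP; apply: measurable_funM; last exact: measurable_kernel_diag.
  exact: measurable_funX.
- by move=> x _; rewrite lee_fin mulr_ge0 ?kernel_diag_ge0// sqr_ge0.
apply: ge0_le_integral => //.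
- by move=> x _; apply: integral_ge0 => y _; exact: (p2 (x, y)).
- exact: (measurable_diskm_inner m2 p2).
- apply: measurable_funeM; apply/measurable_EFinP; apply: measurable_funM; last exact: measurable_kernel_diag.
  exact: measurable_funX.
move=> x _; have [xr|xr] := pselect (cball r x); last first.
  rewrite integral0_eq.
    by rewrite -EFinM lee_fin mulr_ge0 ?sqrtr_ge0// mulr_ge0 ?kernel_diag_ge0 ?sqr_ge0.
  by move=> y _; rewrite gs// expr0n !mul0r.
have Dx : disk R x by apply/diskE; exact: le_lt_trans r1.
have mk : measurable_fun setT (fun y : plane R => kernel_sq x y * eta y).
  apply: measurable_funM => //.
  exact: (measurableT_comp measurable_kernel_sq (pair1_measurable x)).
under eq_integral do rewrite EFinM.
rewrite ge0_integralZl//; last 3 first.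
- exact/measurable_EFinP.
- by move=> y _; rewrite lee_fin mulr_ge0 ?kernel_sq_ge0 ?sqrtr_ge0.
- by rewrite lee_fin mulr_ge0 ?sqr_ge0// invr_ge0 sqrtr_ge0.
rewrite -integral_diskm; last 2 first.
- exact/measurable_EFinP.
- by move=> y; rewrite lee_fin mulr_ge0 ?kernel_sq_ge0 ?sqrtr_ge0.
apply: (@le_trans _ _ ((g x ^+ 2 / eta x)%:E * (Num.sqrt (4 / 5) / eta x ^+ 3)%:E)%E).
  apply: lee_wpmul2l; last exact: bergman_schur.
  by rewrite lee_fin mulr_ge0 ?sqr_ge0// invr_ge0 sqrtr_ge0.
have e0 : 0 < eta x by rewrite sqrtr_gt0 subr_gt0; exact/diskE.
have e2 : eta x ^+ 2 = 1 - nrm2 x by rewrite sqr_sqrtr// subr_ge0 ltW//; exact/diskE.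
rewrite -!EFinM lee_fin /kernel_diag -e2 le_eqVlt; apply/orP; left; apply/eqP.
by field; rewrite gt_eqF.
Qed.

Let weighted_amgm (a b k p q : R) : 0 < p -> 0 < q -> 0 <= k ->
  a * b * k + a * b * k <= a ^+ 2 / p * (k * q) + b ^+ 2 / q * (k * p).
Proof.
move=> p0 q0 k0; rewrite -subr_ge0.
have -> : a ^+ 2 / p * (k * q) + b ^+ 2 / q * (k * p) - (a * b * k + a * b * k) =
    k * (a * q - b * p) ^+ 2 / (p * q).
  by field; rewrite !gt_eqF.
by rewrite mulr_ge0 ?invr_ge0 ?(mulr_ge0 k0) ?sqr_ge0// ltW// mulr_gt0.
Qed.

(** The Schur test. The weighted inequality 2 a b <= a^2 q / p + b^2 p / q with p = eta(x) and
    q = eta(y) bounds the double integral by two halves, which are equal up to exchanging x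
    and y. *)
Lemma schur_repulsion g h : tame g -> tame h -> (forall x, 0 <= g x) -> (forall x, 0 <= h x) ->
  (repulsion g h + repulsion g h <= (Num.sqrt (4 / 5))%:E *
    (intensity (fun x => (g x ^+ 2)%R) + intensity (fun x => (h x ^+ 2)%R)))%E.
Proof.
move=> tg th g0 h0; have [mg _] := tg; have [mh _] := th.
have [r r1 [gs hs]] := tame_common_support tg th.
pose F x y := (g x ^+ 2 / eta x * (kernel_sq x y * eta y))%:E.
pose G x y := (h y ^+ 2 / eta y * (kernel_sq x y * eta x))%:E.
have mk := measurable_fun_repulsion mg mh.
have k0 (p : plane R * plane R) : (0 <= (g p.1 * h p.2 * kernel_sq p.1 p.2)%:E)%E.
  by rewrite lee_fin !mulr_ge0 ?kernel_sq_ge0.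
have mF : measurable_fun setT (fun p : plane R * plane R => F p.1 p.2).
  exact: measurable_schur_integrand.
have mG : measurable_fun setT (fun p : plane R * plane R => G p.1 p.2).
  apply: (eq_measurable_fun (fun p : plane R * plane R =>
    (h p.2 ^+ 2 / eta p.2 * (kernel_sq p.2 p.1 * eta p.1))%:E)).
    by move=> p _; rewrite /G kernel_sqC.
  have ms : measurable_fun setT (fun p : plane R * plane R => (p.2, p.1)).
    by apply: measurable_fun_pair; [exact: measurable_snd|exact: measurable_fst].
  exact: (measurableT_comp (measurable_schur_integrand mh) ms).
have F0 (p : plane R * plane R) : (0 <= F p.1 p.2)%E by rewrite lee_fin schur_integrand_ge0.
have G0 (p : plane R * plane R) : (0 <= G p.1 p.2)%E.
  by rewrite lee_fin kernel_sqC schur_integrand_ge0.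
apply: (@le_trans _ _ (\int[diskm]_x \int[diskm]_y F x y + \int[diskm]_x \int[diskm]_y G x y)%E).
  have iJ := measurable_diskm_inner mk k0.
  have iJ0 x : (0 <= \int[diskm]_y (g x * h y * kernel_sq x y)%:E)%E.
    by apply: integral_ge0 => y _; exact: (k0 (x, y)).
  rewrite /repulsion -(ge0_integralD diskm measurableT (fun x _ => iJ0 x) iJ (fun x _ => iJ0 x) iJ).
  have iF := measurable_diskm_inner mF F0.
  have iF0 x : (0 <= \int[diskm]_y F x y)%E.
    by apply: integral_ge0 => y _; exact: (F0 (x, y)).
  have iG := measurable_diskm_inner mG G0.
  have iG0 x : (0 <= \int[diskm]_y G x y)%E.
    by apply: integral_ge0 => y _; exact: (G0 (x, y)).
  rewrite -(ge0_integralD diskm measurableT (fun x _ => iF0 x) iF (fun x _ => iG0 x) iG).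
  have mk1 x : measurable_fun setT (fun y : plane R => (g x * h y * kernel_sq x y)%:E).
    exact: (measurableT_comp mk (pair1_measurable x)).
  have mF1 x : measurable_fun setT (fun y : plane R => F x y).
    exact: (measurableT_comp mF (pair1_measurable x)).
  have mG1 x : measurable_fun setT (fun y : plane R => G x y).
    exact: (measurableT_comp mG (pair1_measurable x)).
  apply: ge0_le_integral => [|x _|||x _].
  - exact: measurableT.
  - by apply: adde_ge0; exact: iJ0.
  - exact: emeasurable_funD.
  - exact: emeasurable_funD.
  rewrite -(ge0_integralD diskm measurableT (fun y _ => k0 (x, y)) (mk1 x)
    (fun y _ => k0 (x, y)) (mk1 x)).
  rewrite -(ge0_integralD diskm measurableT (fun y _ => F0 (x, y)) (mF1 x)
    (fun y _ => G0 (x, y)) (mG1 x)).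
  apply: ge0_le_integral => [|y _|||].
  - exact: measurableT.
  - by apply: adde_ge0; exact: (k0 (x, y)).
  - exact: emeasurable_funD (mk1 x) (mk1 x).
  - exact: emeasurable_funD (mF1 x) (mG1 x).
  move=> y _; rewrite /F /G -!EFinD lee_fin.
  have [xr|xr] := pselect (cball r x); last first.
    rewrite gs// !mul0r addr0 expr0n !mul0r add0r kernel_sqC.
    exact: schur_integrand_ge0.
  have [yr|yr] := pselect (cball r y); last first.
    rewrite hs// mulr0 !mul0r addr0 expr0n !mul0r addr0.
    exact: schur_integrand_ge0.
  by apply: weighted_amgm; [| |exact: kernel_sq_ge0];
    rewrite sqrtr_gt0 subr_gt0; exact: le_lt_trans r1.
rewrite ge0_muleDr ?intensity_ge0//; last 2 first.
- by move=> x; exact: sqr_ge0.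
- by move=> x; exact: sqr_ge0.
apply: leeD; first exact: schur_half.
rewrite (_ : \int[diskm]_x \int[diskm]_y G x y =
  \int[diskm]_y \int[diskm]_x (h y ^+ 2 / eta y * (kernel_sq y x * eta x))%:E)%E.
  exact: schur_half.
transitivity (\int[diskm]_y \int[diskm]_x G x y)%E.
  exact: (@fubini_tonelli _ _ _ _ R diskm diskm _ mG G0).
by apply: eq_integral => y _; apply: eq_integral => x _; rewrite /G kernel_sqC.
Qed.

End Tame.

Section Variance.
Variables (R : realType) (P : probability (Conf R) R).
Hypothesis hP : determinantal (@bergman_kernel R) P.
Implicit Types (x y : R * R) (g h : R * R -> R).
Local Notation diskm := (@diskm R).

Lemma lstat_ge0 g (X : configuration R) : (forall x, 0 <= g x) -> 0 <= lstat g X.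
Proof. by move=> g0; apply: fsumr_ge0 => x _. Qed.

Lemma lstat_moment1 g : tame g -> (forall x, 0 <= g x) ->
  (\int[P]_X (lstat g X)%:E = intensity g)%E.
Proof.
move=> [mg [r [M [r1 gs gM]]]] g0.
transitivity (\int[P]_X (\esum_(x in points X) (g x)%:E))%E.
  by apply: eq_integral => X _; rewrite (esum_lstat X r1 gs g0).
rewrite (first_correlation hP mg g0) integral_diskm//.
  by apply/measurable_EFinP; apply: measurable_funM => //; exact: measurable_kernel_diag.
by move=> x; rewrite lee_fin mulr_ge0 ?kernel_diag_ge0.
Qed.

(** The repulsion term is on the left so that all terms are nonnegative and Tonelli's theorem
    applies without integrability conditions. *)
Lemma lstat_moment2 g h : tame g -> tame h ->
  (forall x, 0 <= g x) -> (forall x, 0 <= h x) ->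
  (\int[P]_X (lstat g X * lstat h X)%:E + repulsion g h =
   intensity (fun x => (g x * h x)%R) + intensity g * intensity h)%E.
Proof.
move=> tg th g0 h0.
have [mg _] := tg; have [mh _] := th.
have [r r1 [gs hs]] := tame_common_support tg th.
pose pairs (X : Conf R) := lstat g X * lstat h X - lstat (fun x => g x * h x) X.
have pairsE X : (\esum_(t in [set t : 2.-tuple (plane R) |
       uniq t /\ forall i, points X (tnth t i)]) (g (tnth t ord0) * h (tnth t ord_max))%:E =
    (pairs X)%:E)%E by exact: (esum_pairs X r1 gs g0 hs h0).
have pairs0 X : 0 <= pairs X.
  by rewrite -lee_fin -pairsE; apply: esum_ge0 => t _; rewrite lee_fin mulr_ge0.
have mSg := measurable_tame_lstat tg; have mSh := measurable_tame_lstat th.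
have mSgh := measurable_tame_lstat (tameM tg th).
have mpairs : measurable_fun setT pairs.
  by apply: measurable_funB => //; exact: measurable_funM.
have -> : (\int[P]_X (lstat g X * lstat h X)%:E =
    \int[P]_X (pairs X)%:E + intensity (fun x => (g x * h x)%R))%E.
  rewrite -(lstat_moment1 (tameM tg th)); last by move=> x; exact: mulr_ge0.
  rewrite -ge0_integralD//.
  - by apply: eq_integral => X _; rewrite -EFinD /pairs subrK.
  - by move=> X _; rewrite lee_fin.
  - exact/measurable_EFinP.
  - by move=> X _; rewrite lee_fin; apply: lstat_ge0 => x; exact: mulr_ge0.
  - exact/measurable_EFinP.
have kk0 x y : (0 <= (g x * h y * (kernel_diag x * kernel_diag y - kernel_sq x y))%:E)%E.
  rewrite lee_fin.
  have [xr|/gs ->] := pselect (cball r x); last by rewrite !mul0r.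
  have [yr|/hs ->] := pselect (cball r y); last by rewrite mulr0 mul0r.
  rewrite mulr_ge0 ?mulr_ge0// subr_ge0.
  by apply: kernel_sq_le; apply/diskE; exact: le_lt_trans r1.
have mk1 : measurable_fun setT (fun x : plane R => kernel_diag x) := @measurable_kernel_diag R.
have mkk : measurable_fun setT (fun p : plane R * plane R =>
    (g p.1 * h p.2 * (kernel_diag p.1 * kernel_diag p.2 - kernel_sq p.1 p.2))%:E).
  apply/measurable_EFinP; apply: measurable_funM.
    by apply: measurable_funM; apply: measurableT_comp => //.
  apply: measurable_funB; last exact: measurable_kernel_sq.
  by apply: measurable_funM; apply: measurableT_comp => //.
have -> : (\int[P]_X (pairs X)%:E = \int[diskm]_x \int[diskm]_y
    (g x * h y * (kernel_diag x * kernel_diag y - kernel_sq x y))%:E)%E.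
  transitivity (\int[dA R]_(x in disk R) \int[dA R]_(y in disk R)
     (g x * h y * (kernel_diag x * kernel_diag y - kernel_sq x y))%:E)%E.
    rewrite -(second_correlation hP mg mh g0 h0).
    by apply: eq_integral => X _; rewrite pairsE.
  transitivity (\int[dA R]_(x in disk R) \int[diskm]_y
     (g x * h y * (kernel_diag x * kernel_diag y - kernel_sq x y))%:E)%E.
    apply: eq_integral => x _; apply: integral_diskm.
      exact: (measurableT_comp mkk (pair1_measurable x)).
    by move=> y; exact: kk0.
  apply: integral_diskm; first exact: (measurable_diskm_inner mkk (fun p => kk0 p.1 p.2)).
  by move=> x; apply: integral_ge0 => y _; exact: kk0.
have mJ := measurable_fun_repulsion mg mh.
have J0 x y : (0 <= (g x * h y * kernel_sq x y)%:E)%E by rewrite lee_fin !mulr_ge0 ?kernel_sq_ge0.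
rewrite addeAC [RHS]addeC; congr (_ + _)%E.
have i1 := measurable_diskm_inner mkk (fun p => kk0 p.1 p.2).
have i10 x : (0 <= \int[diskm]_y (g x * h y * (kernel_diag x * kernel_diag y - kernel_sq x y))%:E)%E.
  by apply: integral_ge0 => y _; exact: kk0.
have i2 := measurable_diskm_inner mJ (fun p => J0 p.1 p.2).
have i20 x : (0 <= \int[diskm]_y (g x * h y * kernel_sq x y)%:E)%E.
  by apply: integral_ge0 => y _; exact: J0.
rewrite /repulsion -(ge0_integralD diskm measurableT (fun x _ => i10 x) i1 (fun x _ => i20 x) i2).
have mhk : measurable_fun setT (fun y : plane R => (h y * kernel_diag y)%:E).
  by apply/measurable_EFinP; exact: measurable_funM.
have mgk : measurable_fun setT (fun y : plane R => (g y * kernel_diag y)%:E).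
  by apply/measurable_EFinP; exact: measurable_funM.
transitivity (\int[diskm]_x (intensity h * (g x * kernel_diag x)%:E))%E.
  apply: eq_integral => x _.
  have n1 : measurable_fun setT (fun y : plane R =>
      (g x * h y * (kernel_diag x * kernel_diag y - kernel_sq x y))%:E).
    exact: (measurableT_comp mkk (pair1_measurable x)).
  have n2 : measurable_fun setT (fun y : plane R => (g x * h y * kernel_sq x y)%:E).
    exact: (measurableT_comp mJ (pair1_measurable x)).
  rewrite -(ge0_integralD diskm measurableT (fun y _ => kk0 x y) n1 (fun y _ => J0 x y) n2).
  rewrite muleC /intensity -ge0_integralZl//; last 2 first.
  - by move=> y _; rewrite lee_fin mulr_ge0 ?kernel_diag_ge0.
  - by rewrite lee_fin mulr_ge0 ?kernel_diag_ge0.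
  by apply: eq_integral => y _; rewrite -EFinM -EFinD; congr (_%:E); ring.
rewrite ge0_integralZl ?intensity_ge0//; first by rewrite muleC.
by move=> y _; rewrite lee_fin mulr_ge0 ?kernel_diag_ge0.
Qed.

Lemma lstat_lin g h (k : R) (X : configuration R) : tame g -> tame h ->
  lstat (fun x => g x + k * h x) X = lstat g X + k * lstat h X.
Proof.
move=> tg th; have [r r1 [gs hs]] := tame_common_support tg th.
rewrite (lstat_restrict X gs) (lstat_restrict X hs) (@lstat_restrict _ _ r).
  by rewrite !fsbig_finite ?big_split ?mulr_sumr//; exact: finite_points.
by move=> x xr; rewrite gs// hs// mulr0 addr0.
Qed.

Lemma lstat_integrable_ge0 g : tame g -> (forall x, 0 <= g x) ->
  P.-integrable setT (EFin \o (lstat g : Conf R -> R)).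
Proof.
move=> tg g0; apply/integrableP; split.
  by apply/measurable_EFinP; exact: measurable_tame_lstat.
under eq_integral do rewrite /= ger0_norm ?lstat_ge0//.
by rewrite lstat_moment1// ltey_eq intensity_fin.
Qed.

Lemma repulsion_fin g h : tame g -> tame h -> (forall x, 0 <= g x) -> (forall x, 0 <= h x) ->
  repulsion g h \is a fin_num.
Proof.
move=> tg th g0 h0; rewrite ge0_fin_numE ?repulsion_ge0//.
apply: le_lt_trans (_ : _ <= repulsion g h + repulsion g h)%E _; first by rewrite leeDl// repulsion_ge0.
apply: le_lt_trans (schur_repulsion tg th g0 h0) _; rewrite ltey_eq fin_numM// fin_numD.
by apply/andP; split; apply: intensity_fin; [exact: (tameM tg tg)|exact: (tameM th th)].
Qed.

Lemma lstat_mul_integrable_ge0 g h : tame g -> tame h ->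
  (forall x, 0 <= g x) -> (forall x, 0 <= h x) ->
  P.-integrable setT (EFin \o (fun X : Conf R => lstat g X * lstat h X)).
Proof.
move=> tg th g0 h0; apply/integrableP; split.
  by apply/measurable_EFinP; apply: measurable_funM; exact: measurable_tame_lstat.
under eq_integral do rewrite /= ger0_norm ?mulr_ge0 ?lstat_ge0//.
apply: le_lt_trans (_ : _ <= \int[P]_X (lstat g X * lstat h X)%:E + repulsion g h)%E _.
  by rewrite leeDl// repulsion_ge0.
rewrite lstat_moment2// ltey_eq fin_numD intensity_fin ?fin_numM ?intensity_fin//.
exact: tameM.
Qed.

Lemma lstat_mean_ge0 g : tame g -> (forall x, 0 <= g x) ->
  \int[P]_X lstat g X = fine (intensity g).
Proof. by move=> tg g0; rewrite /Rintegral lstat_moment1. Qed.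

Lemma lstat_covariance_ge0 g h : tame g -> tame h ->
  (forall x, 0 <= g x) -> (forall x, 0 <= h x) ->
  \int[P]_X (lstat g X * lstat h X) = fine (intensity (fun x => g x * h x)) +
    fine (intensity g) * fine (intensity h) - fine (repulsion g h).
Proof.
move=> tg th g0 h0; have := lstat_moment2 tg th g0 h0.
have := integrable_fin_num measurableT (lstat_mul_integrable_ge0 tg th g0 h0) => /= f1.
rewrite /Rintegral -(fineK f1) -(fineK (repulsion_fin tg th g0 h0)) -(fineK (intensity_fin (tameM tg th))).
rewrite -(fineK (intensity_fin tg)) -(fineK (intensity_fin th)) -!EFinM -!EFinD /= => -[] <-.
by rewrite addrK.
Qed.

Lemma fine_intensityD g h : tame g -> tame h ->
  fine (intensity (fun x => g x + h x)) = fine (intensity g) + fine (intensity h).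
Proof.
move=> tg th; rewrite -[RHS](@RintegralD _ _ R diskm setT)//; try exact: tame_integrable.
by apply: eq_Rintegral => x _; rewrite mulrDl.
Qed.

Lemma integrable_lin (f1 f2 : Conf R -> R) (k : R) :
  P.-integrable setT (EFin \o f1) -> P.-integrable setT (EFin \o f2) ->
  P.-integrable setT (EFin \o (fun X => f1 X + k * f2 X)).
Proof.
move=> i1 i2; rewrite (_ : EFin \o _ =
    (EFin \o f1) \+ (fun X => k%:E * (EFin \o f2) X)%E)//.
by apply: integrableD => //; exact: integrableZl.
Qed.

Lemma Rintegral_lin (f1 f2 : Conf R -> R) (k : R) :
  P.-integrable setT (EFin \o f1) -> P.-integrable setT (EFin \o f2) ->
  \int[P]_X (f1 X + k * f2 X) = \int[P]_X f1 X + k * \int[P]_X f2 X.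
Proof.
move=> i1 i2; rewrite RintegralD ?RintegralZl//.
rewrite (_ : EFin \o _ = (fun X => k%:E * (EFin \o f2) X)%E)//.
exact: integrableZl.
Qed.

Lemma pos_negE g x : g x = Num.max (g x) 0 - Num.max (- g x) 0.
Proof.
case: (leP (g x) 0) => h; first by rewrite max_l ?oppr_ge0// sub0r opprK.
by rewrite max_r ?oppr_le0 ?ltW// subr0.
Qed.

(** For g = a - b the parts of positive and negative sign: p, q, r are the repulsion terms of
    (a,a), (a,b), (b,b), u and v the Poisson variances of a and b, and e and f their means. *)
Let variance_arith (p q r u v e f c : R) : 0 <= r -> r + r <= c * (v + v) ->
  0 <= q -> q + q <= c * (u + v) -> 0 <= p -> p + p <= c * (u + u) ->
  `|u + e * e - p + -2 * (0 + e * f - q) + 1 * (v + f * f - r) + -2 * (e - f) * e +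
    2 * (e - f) * f + (e - f) ^+ 2 * 1 - (u + v)| <= c * (u + v).
Proof. by move=> *; rewrite ler_norml; apply/andP; split; lra. Qed.

(** The variance differs from that of a Poisson process, which is the integral of g^2 K(x,x),
    by the repulsion term, and the Schur test makes this a fraction c < 1 of it. The
    correlation formulas are for nonnegative functions, so g is split into positive and negative
    parts, and the cross term is estimated by the Schur test as well. *)
Theorem lstat_variance g : tame g -> let m := \int[P]_X lstat g X in
  [/\ P.-integrable setT (EFin \o (lstat g : Conf R -> R)),
   P.-integrable setT (EFin \o (fun X : Conf R => (lstat g X - m) ^+ 2)),
   m = fine (intensity g) &
   `| \int[P]_X ((lstat g X - m) ^+ 2) - fine (intensity (fun x => g x ^+ 2)) | <=
     Num.sqrt (4 / 5) * fine (intensity (fun x => g x ^+ 2))].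
Proof.
move=> tg m; pose a x := Num.max (g x) 0; pose b x := Num.max (- g x) 0.
have ta : tame a by exact: tame_pos.
have tb : tame b by apply: tame_pos; exact: tameN.
have a0 x : 0 <= a x by rewrite le_max lexx orbT.
have b0 x : 0 <= b x by rewrite le_max lexx orbT.
have gE x : g x = a x - b x by exact: pos_negE.
have SE X : lstat g X = lstat a X + -1 * lstat b X.
  by rewrite -lstat_lin//; congr lstat; apply/funext => x; rewrite mulN1r.
have ia := lstat_integrable_ge0 ta a0; have ib := lstat_integrable_ge0 tb b0.
have iaa := lstat_mul_integrable_ge0 ta ta a0 a0.
have iab := lstat_mul_integrable_ge0 ta tb a0 b0.
have ibb := lstat_mul_integrable_ge0 tb tb b0 b0.
have iS : P.-integrable setT (EFin \o (lstat g : Conf R -> R)).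
  by apply: eq_integrable (integrable_lin (-1) ia ib) => // X _; rewrite /= SE.
have mE : m = fine (intensity a) - fine (intensity b).
  rewrite /m (eq_Rintegral _ (g := fun X : Conf R => lstat a X + -1 * lstat b X)).
    by rewrite Rintegral_lin// !lstat_mean_ge0// mulN1r.
  by move=> X _; rewrite SE.
have mI : m = fine (intensity g).
  rewrite mE (_ : intensity g = intensity (fun x => a x + - b x)); last first.
    by congr intensity; apply/funext => x; rewrite gE.
  rewrite fine_intensityD//; last exact: tameN.
  congr (_ + _); rewrite -mulN1r -[LHS](@RintegralZl _ _ R diskm setT)//.
    by apply: eq_Rintegral => x _; rewrite mulrA mulN1r.
  exact: tame_integrable.
have i1 : P.-integrable setT (EFin \o (fun X : Conf R => 1)).
  exact: finite_measure_integrable_cst.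
have QE X : (lstat g X - m) ^+ 2 = lstat a X * lstat a X + - 2 * (lstat a X * lstat b X)
    + 1 * (lstat b X * lstat b X) + (- 2 * m) * lstat a X + (2 * m) * lstat b X + m ^+ 2 * 1.
  by rewrite SE; ring.
have iQ := integrable_lin (m ^+ 2) (integrable_lin (2 * m) (integrable_lin (- 2 * m)
  (integrable_lin 1 (integrable_lin (- 2) iaa iab) ibb) ia) ib) i1.
split => //.
  by apply: eq_integrable iQ => // X _; rewrite /= QE.
rewrite (eq_Rintegral _ (g := fun X : Conf R => lstat a X * lstat a X + - 2 * (lstat a X * lstat b X)
    + 1 * (lstat b X * lstat b X) + (- 2 * m) * lstat a X + (2 * m) * lstat b X + m ^+ 2 * 1)); last first.
  by move=> X _; rewrite QE.
rewrite !Rintegral_lin//; do ?[apply: integrable_lin => //].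
have -> : \int[P]_X (1 : R) = 1 
  by rewrite Rintegral_cst// mul1r; exact: (congr1 fine (probability_setT P)).
rewrite !lstat_covariance_ge0// !lstat_mean_ge0//.
have ab0 : fine (intensity (fun x => a x * b x)) = 0.
  rewrite /intensity integral0_eq// => x _; rewrite /a /b.
  case: (leP (g x) 0) => h; first by rewrite mul0r mul0r.
  by rewrite [Num.max (- _) _]max_r ?oppr_le0 ?ltW// mulr0 mul0r.
have VE : fine (intensity (fun x => g x ^+ 2)) =
    fine (intensity (fun x => a x * a x)) + fine (intensity (fun x => b x * b x)).
  rewrite -fine_intensityD; [|exact: tameM|exact: tameM].
  congr (fine (intensity _)); apply/funext => x; rewrite gE /a /b.
  case: (leP (g x) 0) => h; first by ring.
  by rewrite [Num.max (- _) _]max_r ?oppr_le0 ?ltW//; ring.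
have sch u v : tame u -> tame v -> (forall x, 0 <= u x) -> (forall x, 0 <= v x) ->
    0 <= fine (repulsion u v) /\ fine (repulsion u v) + fine (repulsion u v) <= Num.sqrt (4 / 5) *
      (fine (intensity (fun x => u x * u x)) + fine (intensity (fun x => v x * v x))).
  move=> tu tv u0 v0; split; first by rewrite fine_ge0// repulsion_ge0.
  have := schur_repulsion tu tv u0 v0.
  rewrite -(fineK (repulsion_fin tu tv u0 v0)) -(fineK (intensity_fin (tameM tu tu))).
  by rewrite -(fineK (intensity_fin (tameM tv tv))) -!EFinD -EFinM lee_fin.
have [] := sch a a ta ta a0 a0; have [] := sch a b ta tb a0 b0.
have [] := sch b b tb tb b0 b0; rewrite VE ab0 /= mE.
exact: variance_arith.
Qed.

End Variance.

(** * Random series with summable weighted variances *)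

Section SeriesLimit.
Local Open Scope ereal_scope.
Variables (d : measure_display) (T : measurableType d) (R : realType).

(** Also where the sequence diverges, because [limn] has a constant default value there. *)
Lemma measurable_limn (u : nat -> T -> R) : (forall n, measurable_fun setT (u n)) ->
  measurable_fun setT (fun t => limn (u ^~ t)).
Proof.
move=> mu; pose v t n := (u n t)%:E.
have mv : measurable_fun setT (fun t => limn_esup (v t)).
  by apply: measurable_fun_limn_esup => n; exact/measurable_EFinP.
have mw : measurable_fun setT (fun t => limn_einf (v t)).
  apply: measurableT_comp => //.
  apply: (measurable_fun_limn_esup (f := fun n t => - v t n)) => n.
  by apply: measurableT_comp => //; exact/measurable_EFinP.
have mf : measurable_fun setT (fun t => fine (limn_esup (v t))).
  exact: measurableT_comp mv.
rewrite (_ : (fun t => _) = (fun t => if (limn_esup (v t) == limn_einf (v t)) &&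
  (limn_esup (v t) == (fine (limn_esup (v t)))%:E) then fine (limn_esup (v t)) else point)).
  apply: measurable_fun_ifT => //.
  apply: measurable_and; apply: measurable_fun_eqe => //; exact/measurable_EFinP.
apply/funext => t; have [cu|ncu] := pselect (cvgn (u ^~ t)).
  have vl : v t @ \oo --> (limn (u ^~ t))%:E by apply: cvg_EFin cu; near=> n.
  by have [-> ->] := cvg_limn_einf_sup vl; rewrite /= !eqxx.
rewrite dvgP//; case: ifPn => // /andP[/eqP SI /eqP Sf]; case: ncu.
have vl : v t @ \oo --> limn_esup (v t).
  apply: (@squeeze_cvge _ _ _ _ (einfs (v t)) (v t) (esups (v t))).
  - near=> n; apply/andP; split; [apply: ereal_inf_lbound|apply: ereal_sup_ubound];
      by exists n => /=.
  - rewrite SI limn_einf_lim; exact: is_cvg_einfs.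
  - rewrite limn_esup_lim; exact: is_cvg_esups.
move: vl; rewrite Sf => /fine_cvgP[_ ?]; apply/cvg_ex.
by exists (fine (limn_esup (v t))).
Unshelve. all: by end_near.
Qed.

End SeriesLimit.

Section L2Series.
Variables (d : measure_display) (T : measurableType d) (R : realType) (P : probability T R).
Implicit Types (Z W : nat -> T -> R).

Lemma sum_sq_le (z a : nat -> R) N : (forall k, 0 < a k) ->
  (\sum_(k < N) z k) ^+ 2 <= (\sum_(k < N) (a k)^-1) * \sum_(k < N) (a k * z k ^+ 2).
Proof.
move=> a0; elim: N => [|N IH]; first by rewrite !big_ord0 expr0n mul0r.
rewrite !big_ord_recr /=; move: IH.
have A0 : 0 <= \sum_(k < N) (a k)^-1 by apply: sumr_ge0 => k _; rewrite invr_ge0 ltW.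
have H0 : 0 <= \sum_(k < N) (a k * z k ^+ 2).
  by apply: sumr_ge0 => k _; rewrite mulr_ge0 ?sqr_ge0// ltW.
move: (\sum_(k < N) z k) (\sum_(k < N) (a k)^-1) A0 (\sum_(k < N) (a k * z k ^+ 2)) H0.
move=> S A A0 H H0 SAH; have := a0 N; move: (a N) (z N) => b x b0.
have -> : (A + b^-1) * (H + b * x ^+ 2) = A * H + x ^+ 2 + (H / b + A * b * x ^+ 2).
  by field; rewrite gt_eqF.
suff : 2 * (S * x) <= H / b + A * b * x ^+ 2 by move=> h; nra.
have p0 : 0 <= H / b + A * b * x ^+ 2.
  apply: addr_ge0; first by rewrite divr_ge0// ltW.
  by apply: mulr_ge0; [rewrite mulr_ge0// ltW|exact: sqr_ge0].
apply: le_trans (ler_norm _) _; rewrite -(@ler_pXn2r _ 2)// ?nnegrE//.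
rewrite real_normK ?num_real//.
apply: (@le_trans _ _ (4 * (A * H * x ^+ 2))).
  by rewrite !exprMn; have := ler_wpM2r (sqr_ge0 x) SAH; lra.
have -> : A * H * x ^+ 2 = (H / b) * (A * b * x ^+ 2) by field; rewrite gt_eqF.
by move: (H / b) (A * b * x ^+ 2) => p q; have := sqr_ge0 (p - q); nra.
Qed.

(** The weights a_k produce a domination: by the weighted Cauchy-Schwarz inequality every
    squared partial sum of the centred terms is at most A H, where H, the sum of a_k Z_k^2, has
    expectation at most B. Where H is finite the series converges absolutely, so that the
    default value in the definition of Y matters on a null set only, and dominated convergence
    yields the mean of Y and the limit of the variances. *)
Theorem L2_series_limit (W : nat -> T -> R) (m v a : nat -> R) (A B : R) :
  (forall k, P.-integrable setT (EFin \o W k)) ->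
  (forall k, m k = \int[P]_t W k t) ->
  (forall k, (\int[P]_t ((W k t - m k) ^+ 2)%:E <= (v k)%:E)%E) ->
  (forall k, 0 < a k) ->
  (forall N, \sum_(k < N) (a k)^-1 <= A) ->
  (forall N, \sum_(k < N) a k * v k <= B) ->
  cvgn (series m) ->
  let Y t := limn (series (W ^~ t)) in
  measurable_fun setT Y /\
  (\int[P]_t ((\sum_(k < N) (W k t - m k)) ^+ 2)%:E @[N --> \oo] -->
   \int[P]_t ((Y t - fine 'E_P[Y]) ^+ 2)%:E)%E.
Proof.
move=> iW mE Zv a0 hA hB cm Y.
have mW k : measurable_fun setT (W k) by apply/measurable_EFinP; exact: measurable_int (iW k).
pose Z k t := W k t - m k.
have mZ k : measurable_fun setT (Z k) by exact: measurable_funB.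
have mY : measurable_fun setT Y.
  apply: (@measurable_limn _ _ _ (fun N t => series (W ^~ t) N)) => N.
  by rewrite /series /=; apply: measurable_sum.
split => //.
have A0 : 0 <= A by apply: le_trans (hA 0%N); rewrite big_ord0.
pose h k t := (a k * Z k t ^+ 2)%:E.
have mh k : measurable_fun setT (h k).
  by apply/measurable_EFinP; apply: measurable_funM => //; exact: measurable_funX.
have h0 k t : (0 <= h k t)%E by rewrite lee_fin mulr_ge0 ?sqr_ge0// ltW.
pose H t := (\sum_(k <oo) h k t)%E.
have H0 t : (0 <= H t)%E by apply: nneseries_ge0.
have mH : measurable_fun setT H by apply: ge0_emeasurable_sum.
have iH : P.-integrable setT H.
  apply/integrableP; split => //.
  under eq_integral do rewrite gee0_abs//.
  rewrite integral_nneseries//.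
  apply: le_lt_trans (_ : _ <= B%:E)%E _; last exact: ltry.
  apply: lime_le; first by apply: is_cvg_nneseries => k _ _; exact: integral_ge0.
  apply: nearW => N; rewrite big_mkord.
  apply: le_trans (_ : _ <= \sum_(k < N) (a k * v k)%:E)%E _; last by rewrite sumEFin lee_fin.
  apply: lee_sum => k _; rewrite /h; under eq_integral do rewrite EFinM.
  rewrite ge0_integralZl//.
  - by rewrite EFinM; apply: lee_wpmul2l; [rewrite lee_fin ltW|exact: Zv].
  - by apply/measurable_EFinP; exact: measurable_funX.
  - by move=> t _; rewrite lee_fin sqr_ge0.
  - by rewrite lee_fin ltW.
pose S N t := \sum_(k < N) Z k t.
have mS N : measurable_fun setT (S N) by exact: measurable_sum.
have finH t : H t \is a fin_num -> forall N, \sum_(k < N) (a k * Z k t ^+ 2) <= fine (H t).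
  move=> fH N; rewrite -lee_fin fineK// -sumEFin -(big_mkord xpredT (fun k => h k t)).
  by apply: nneseries_lim_ge.
have S2 t : H t \is a fin_num -> forall N, S N t ^+ 2 <= A * fine (H t).
  move=> fH N; apply: le_trans (sum_sq_le (Z ^~ t) N a0) _.
  apply: ler_pM; rewrite ?hA ?finH//; first by apply: sumr_ge0 => k _; rewrite invr_ge0 ltW.
  by apply: sumr_ge0 => k _; rewrite mulr_ge0 ?sqr_ge0// ltW.
pose Zoo t := limn (S ^~ t).
have mZoo : measurable_fun setT Zoo by exact: measurable_limn.
have cS t : H t \is a fin_num -> S ^~ t @ \oo --> Zoo t.
  move=> fH; have : cvgn (series (Z ^~ t)).
    apply: normed_cvg; apply: nondecreasing_is_cvgn.
      by apply: nondecreasing_series => n _ _; exact: normr_ge0.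
    exists (A + fine (H t)) => _ [N _ <-].
    rewrite [leLHS](_ : _ = \sum_(k < N) `|Z k t|); last exact: big_mkord.
    apply: le_trans (_ : _ <= \sum_(k < N) ((a k)^-1 + a k * Z k t ^+ 2)) _; last first.
      by rewrite big_split /=; apply: lerD; [exact: hA|exact: finH].
    apply: ler_sum => k _; have := a0 k; move: (a k) (Z k t) => b x b0.
    (* |x| <= 1 / b + b x^2, by completing the square *)
    rewrite -subr_ge0.
    have -> : b^-1 + b * x ^+ 2 - `|x| = b^-1 * ((b * `|x| - 2^-1) ^+ 2 + 3 / 4).
      by rewrite -(real_normK (num_real x)); field; rewrite gt_eqF.
    by rewrite mulr_ge0 ?invr_ge0 ?(ltW b0)// addr_ge0 ?sqr_ge0// divr_ge0.
  rewrite /Zoo /S /series /=.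
  by under eq_fun do rewrite big_mkord.
have YE t : H t \is a fin_num -> Y t = Zoo t + limn (series m).
  move=> fH; apply/cvg_lim => //.
  rewrite (_ : series (W ^~ t) = (fun N => S N t + series m N)).
    by apply: cvgD; [exact: cS|exact: cm].
  apply/funext => N; rewrite /series /S /= !big_mkord -big_split /=.
  by apply: eq_bigr => k _; rewrite /Z subrK.
have aeH : (\forall t \ae P, setT t -> H t \is a fin_num).
  exact: integrable_ae.
have i1 : P.-integrable setT (cst 1%E : T -> \bar R).
  exact: finite_measure_integrable_cst.
have iAH : P.-integrable setT (fun t => A%:E * H t)%E by exact: integrableZl.
have iAH1 : P.-integrable setT (fun t => 1 + A%:E * H t)%E by exact: integrableD.
have iZ k : P.-integrable setT (EFin \o Z k).
  rewrite (_ : EFin \o Z k = (EFin \o W k) \- (EFin \o cst (m k)))%E//.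
  by apply: integrableB => //; exact: finite_measure_integrable_cst.
have EZ k : (\int[P]_t (Z k t)%:E = 0)%E.
  under eq_integral do rewrite EFinB.
  rewrite integralB_EFin//; last exact: finite_measure_integrable_cst.
  have fW := integrable_fin_num measurableT (iW k).
  by rewrite integral_cst//= probability_setT mule1 mE /Rintegral fineK ?subee.
have [iZoo _ lZ] : [/\ P.-integrable setT (EFin \o Zoo),
    (\int[P]_t `|(S N t)%:E - (Zoo t)%:E| @[N --> \oo] --> 0)%E &
    (\int[P]_t (S N t)%:E @[N --> \oo] --> \int[P]_t (Zoo t)%:E)%E].
  apply: (@dominated_convergence _ _ _ P setT measurableT (fun N t => (S N t)%:E)
    (EFin \o Zoo) (fun t => 1 + A%:E * H t)%E) => //.
  - by move=> N; exact/measurable_EFinP.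
  - exact/measurable_EFinP.
  - by apply: filterS aeH => t /(_ I) fH _; apply: cvg_EFin; [near=> N|exact: cS].
  - apply: filterS aeH => t /(_ I) fH N _ /=.
    rewrite -(fineK fH) -EFinM -EFinD lee_fin; have := S2 t fH N.
    rewrite -(real_normK (num_real (S N t))); move: (`|S N t|) (A * _) => p q pq.
    by have := sqr_ge0 (p - 2^-1); nra.
have EZoo : (\int[P]_t (Zoo t)%:E = 0)%E.
  apply: (cvg_unique _ lZ) => //.
  have -> : (fun N => \int[P]_t (S N t)%:E)%E = (fun=> 0%E).
    apply/funext => N; rewrite /S; under eq_integral do rewrite -sumEFin.
    rewrite integral_sum//; last by move=> k; exact: iZ.
    by apply: big1 => k _; exact: EZ.
  exact: cvg_cst.
have EY : ('E_P[Y] = (limn (series m))%:E)%E.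
  rewrite unlock; transitivity (\int[P]_t (Zoo t + limn (series m))%:E)%E.
    apply: ae_eq_integral => //.
    - exact/measurable_EFinP.
    - by apply/measurable_EFinP; exact: measurable_funD.
    - by apply: filterS aeH => t /(_ I) fH _ /=; rewrite YE.
  under eq_integral do rewrite EFinD.
  rewrite integralD_EFin//; last exact: finite_measure_integrable_cst.
  by rewrite EZoo add0e integral_cst//= probability_setT mule1.
rewrite EY /=.
rewrite (_ : \int[P]_t _ = \int[P]_t (Zoo t ^+ 2)%:E)%E; last first.
  apply: ae_eq_integral => //.
  - by apply/measurable_EFinP; apply: measurable_funX; exact: measurable_funB.
  - by apply/measurable_EFinP; exact: measurable_funX.
  - by apply: filterS aeH => t /(_ I) fH _ /=; rewrite YE// addrK.
have [|||||_ _ //] := @dominated_convergence _ _ _ P setT measurableT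
    (fun N t => (S N t ^+ 2)%:E) (fun t => (Zoo t ^+ 2)%:E) (fun t => A%:E * H t)%E.
- by move=> N; apply/measurable_EFinP; exact: measurable_funX.
- by apply/measurable_EFinP; exact: measurable_funX.
- apply: filterS aeH => t /(_ I) fH _; apply: cvg_EFin; first by near=> N.
  by apply: cvgM; exact: cS.
- exact: iAH.
- apply: filterS aeH => t /(_ I) fH N _ /=.
  by rewrite -(fineK fH) -EFinM lee_fin ger0_norm ?sqr_ge0// S2.
Unshelve. all: by end_near.
Qed.

End L2Series.

(** * Hyperbolic distance and hyperbolic shells *)

Section Hyperbolic.
Variable R : realType.
Implicit Types (z w : R * R) (t s : R) (k : nat).

(** At t = |phi_z(w)|^2 this is exp(-d), for d the hyperbolic distance from z to w. *)
Definition expd t : R := (1 - Num.sqrt t) / (1 + Num.sqrt t).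

Let sqrt1_gt0 t : 0 < 1 + Num.sqrt t.
Proof. by rewrite ltr_wpDr// sqrtr_ge0. Qed.

Lemma expd_bounds t : 0 <= t -> t < 1 ->
  [/\ (1 - t) / 4 <= expd t, expd t <= 1 - t & 0 < expd t].
Proof.
move=> t0 t1; rewrite /expd; have := sqrt1_gt0 t; have := sqrtr_ge0 t.
have : Num.sqrt t < 1 by rewrite -[ltRHS]sqrtr1 ltr_sqrt.
have -> : 1 - t = (1 - Num.sqrt t) * (1 + Num.sqrt t).
  by rewrite -{1}(sqr_sqrtr t0); ring.
move: (Num.sqrt t) => r r1 r0 h; split.
- rewrite ler_pdivlMr// -subr_ge0.
  have -> : 1 - r - (1 - r) * (1 + r) / 4 * (1 + r) = (1 - r) ^+ 2 * (3 + r) / 4 by field.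
  by rewrite divr_ge0// mulr_ge0 ?sqr_ge0// addr_ge0.
- by rewrite ler_pdivrMr//; nra.
- by rewrite divr_gt0// subr_gt0.
Qed.

Lemma expd_le1 t : 0 <= t -> t < 1 -> expd t <= 1.
Proof. by move=> t0 t1; have [_ h _] := expd_bounds t0 t1; apply: le_trans h _; rewrite gerBl. Qed.

Lemma cmod_mobius z w : cmod (mobius z w) = Num.sqrt (mobT z w).
Proof.
rewrite /mobius /cmod Normc.normcM Normc.normcV /mobT sqrtrM ?addr_ge0 ?sqr_ge0// sqrtrV; last first.
  by rewrite addr_ge0// sqr_ge0.
congr (_ / _).
by rewrite /Normc.normc /= /mobq; congr Num.sqrt; ring.
Qed.

Lemma poincare_distE z w : nrm2 z < 1 -> nrm2 w < 1 ->
  poincare_dist z w = - ln (expd (mobT z w)).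
Proof.
move=> hz hw; have [_ _ e0] := expd_bounds (mobT_ge0 z w) (mobT_lt1 hz hw).
by rewrite -lnV ?posrE// /expd invf_div /poincare_dist cmod_mobius.
Qed.

Lemma expR_dist s z w : nrm2 z < 1 -> nrm2 w < 1 ->
  expR (- s * poincare_dist z w) = expd (mobT z w) `^ s.
Proof.
move=> hz hw; have [_ _ e0] := expd_bounds (mobT_ge0 z w) (mobT_lt1 hz hw).
by rewrite poincare_distE// mulrNN /powR gt_eqF.
Qed.

Lemma annulusE k z w : nrm2 z < 1 -> annulus k z w <-> nrm2 w < 1 /\
  expR (- k.+1%:R) < expd (mobT z w) <= expR (- k%:R).
Proof.
move=> hz; rewrite /annulus /=; split=> -[].
  move=> /diskE hw; rewrite poincare_distE//.
  have [_ _ e0] := expd_bounds (mobT_ge0 z w) (mobT_lt1 hz hw).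
  move=> /andP[h1 h2]; split=> //; rewrite -(lnK e0) ltr_expR ler_expR.
  by apply/andP; split; lra.
move=> hw /andP[]; have [_ _ e0] := expd_bounds (mobT_ge0 z w) (mobT_lt1 hz hw).
rewrite -(lnK e0) ltr_expR ler_expR => h1 h2; split; first exact/diskE.
by rewrite poincare_distE// -{1}(lnK e0) expRK; apply/andP; split; lra.
Qed.

(** By 1 - |phi_z(w)|^2 = (1 - |z|^2) (1 - |w|^2) / |1 - conj z w|^2 the quantity exp(-d(z,w))
    is comparable with 1 - |w|^2. These constants, to the fourth power, enter the theorem. *)
Lemma expd_mobT_bounds z w : nrm2 z < 1 -> nrm2 w < 1 ->
  (1 - nrm2 z) / 16 * (1 - nrm2 w) <= expd (mobT z w) /\
  expd (mobT z w) <= 4 / (1 - nrm2 z) * (1 - nrm2 w).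
Proof.
move=> hz hw; have [h1 h2 _] := expd_bounds (mobT_ge0 z w) (mobT_lt1 hz hw).
have q0 := mobq_gt0 hz hw; have ql := mobq_lb hz hw; have qu := mobq_ub hz hw.
move: h1 h2; rewrite onem_mobT//.
have a0 : 0 < 1 - nrm2 z by rewrite subr_gt0.
have b0 : 0 < 1 - nrm2 w by rewrite subr_gt0.
move: (1 - nrm2 z) (1 - nrm2 w) a0 b0 (mobq z w) q0 ql qu => a b a0 b0 q q0 ql qu h1 h2.
split.
  apply: le_trans h1; rewrite -subr_ge0.
  have -> : a * b / q / 4 - a / 16 * b = a * b * (4 - q) / (16 * q) by field; rewrite gt_eqF.
  by rewrite divr_ge0 ?mulr_ge0// ?subr_ge0// ltW.
apply: le_trans h2 _; rewrite -subr_ge0.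
have -> : 4 / a * b - a * b / q = 4 * b * (q - a ^+ 2 / 4) / (a * q) by field; rewrite !gt_eqF.
by rewrite divr_ge0 ?mulr_ge0// ?subr_ge0// ltW.
Qed.

Lemma expd_annulus_unique j k t : 0 <= t -> t < 1 ->
  expR (- j.+1%:R) < expd t <= expR (- j%:R) ->
  expR (- k.+1%:R) < expd t <= expR (- k%:R) -> j = k.
Proof.
move=> t0 t1 /andP[j1 j2] /andP[k1 k2].
have := lt_le_trans j1 k2; have := lt_le_trans k1 j2.
by rewrite !ltr_expR !ltrN2 !ltr_nat !ltnS => h1 h2; apply/eqP; rewrite eqn_leq h1 h2.
Qed.

Lemma bigcup_annulus z : nrm2 z < 1 -> \bigcup_k annulus k z = disk R.
Proof.
move=> hz; apply/seteqP; split=> w; first by move=> [k _] [].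
move=> Dw; exists (Num.truncn (poincare_dist z w)) => //; split => //.
apply: truncn_itv; have /diskE hw := Dw; rewrite poincare_distE// oppr_ge0.
by apply: ln_le0; exact: expd_le1 (mobT_ge0 z w) (mobT_lt1 hz hw).
Qed.

Lemma trivIset_annulus z : nrm2 z < 1 -> trivIset setT (fun k => annulus k z).
Proof.
move=> hz; apply/trivIsetP => j k _ _ /eqP jk; rewrite -subset0 => w [].
move=> /(annulusE _ _ hz)[hw j1] /(annulusE _ _ hz)[_ k1]; apply: jk.
exact: expd_annulus_unique (mobT_ge0 z w) (mobT_lt1 hz hw) j1 k1.
Qed.

Lemma measurable_expd : measurable_fun setT expd.
Proof.
have ms : measurable_fun setT (@Num.sqrt R).
  by apply: continuous_measurable_fun; exact: sqrt_continuous.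
apply: measurable_funM; first exact: measurable_funB.
by apply: measurable_invr_ge0; [exact: measurable_funD|move=> t; exact: ltW].
Qed.

Lemma mobT0E z w : nrm2 w < 1 -> mobT0 z w = mobT z w.
Proof. by move=> hw; rewrite /mobT0 patch_diskE hw. Qed.

Lemma measurable_annulus k z : nrm2 z < 1 -> measurable (annulus k z : set (plane R)).
Proof.
move=> hz.
have -> : annulus k z = disk R `&` ((expd \o mobT0 z) @^-1` `]expR (- k.+1%:R), expR (- k%:R)]%classic).
  apply/seteqP; split=> w.
    move=> /(annulusE _ _ hz)[hw h]; split; first exact/diskE.
    by rewrite /= in_itv /= mobT0E.
  move=> [/diskE hw] /=; rewrite in_itv /= mobT0E// => h.
  by apply/(annulusE _ _ hz).
apply: measurableI; first exact: measurable_disk.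
rewrite -[X in measurable X]setTI.
have m : measurable_fun setT (expd \o mobT0 z : plane R -> R).
  by apply: measurableT_comp measurable_expd _; exact: measurable_mobT0.
by apply: m => //; exact: measurable_itv.
Qed.

(** Each shell is relatively compact in the disk. *)
Lemma annulus_cball k z w : nrm2 z < 1 -> annulus k z w ->
  cball (mobr (1 - expR (- k.+1%:R)) z) w.
Proof.
move=> hz /(annulusE _ _ hz)[hw /andP[h1 _]]; apply: mobT_le_nrm2 => //.
have [_ h2 _] := expd_bounds (mobT_ge0 z w) (mobT_lt1 hz hw).
by rewrite lerBrDl -lerBrDr; apply/ltW/(lt_le_trans h1).
Qed.

End Hyperbolic.

(** * The terms of the series and their expectations *)

Section ShellTestFunctions.
Variable R : realType.
Local Notation mu := (plane_lebesgue R).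
Local Notation diskm := (@diskm R).
Implicit Types (z w : R * R) (k : nat).

Lemma nneseries_le_geometric (f : nat -> \bar R) (M q : R) :
  0 <= M -> 0 < q -> q < 1 -> (forall k, (0 <= f k)%E) ->
  (forall k, (f k <= (M * q ^+ k)%:E)%E) ->
  (\sum_(k <oo) f k <= (M / (1 - q))%:E)%E.
Proof.
move=> M0 q0 q1 f0 fM; apply: lime_le; first by apply: is_cvg_nneseries => k _ _.
apply: nearW => N; apply: (@le_trans _ _ (\sum_(0 <= k < N) (M * q ^+ k)%:E)%E).
  by apply: lee_sum => k _; exact: fM.
rewrite sumEFin lee_fin; apply: geometric_le_lim => //.
by rewrite ger0_norm// ltW.
Qed.

(** For signed g, the same as the scaling of Lebesgue measure in the definition of dA. *)
Lemma intensity_plane (g : R * R -> R) : tame g ->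
  (intensity g = (disk_area R)^-1%:E * \int[mu]_w (g w * kernel_diag w)%:E)%E.
Proof.
move=> tg; have [A0 _ _] := disk_area_props R; have [mg [r [M [r1 gs gM]]]] := tg.
have ig := tame_integrable tg.
pose f (w : plane R) := (g w * kernel_diag w)%:E.
have mf : measurable_fun setT f.
  by apply/measurable_EFinP; apply: measurable_funM => //; exact: measurable_kernel_diag.
have f0 w : ~ disk R w -> f w = 0%E.
  move=> Dw; rewrite /f gs ?mul0r// => wr; apply: Dw; apply/diskE.
  exact: le_lt_trans r1.
have key h : measurable_fun setT h -> (forall w, 0 <= h w)%E ->
    (forall w, ~ disk R w -> h w = 0%E) ->
    (\int[diskm]_w h w = (disk_area R)^-1%:E * \int[mu]_w h w)%E.
  move=> mh h0 hs; rewrite -integral_diskm// /dA ge0_integral_mscale//; first last.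
  - exact: measurable_funS mh.
  - exact: measurable_disk.
  congr (_ * _)%E; rewrite integral_mkcond; apply: eq_integral => w _.
  rewrite patchE; case: ifPn => //; rewrite notin_setE => /hs.
  by [].
have kp : (\int[diskm]_w (f^\+ w) = (disk_area R)^-1%:E * \int[mu]_w (f^\+ w))%E.
  apply: key => //; first exact: measurable_funepos.
  by move=> w /f0 fw; rewrite funeposE fw maxxx.
have kn : (\int[diskm]_w (f^\- w) = (disk_area R)^-1%:E * \int[mu]_w (f^\- w))%E.
  apply: key => //; first exact: measurable_funeneg.
  by move=> w /f0 fw; rewrite funenegE fw oppe0 maxxx.
have fn := integrable_fin_num measurableT (integrable_funeneg measurableT ig).
transitivity (\int[diskm]_w (f^\+ w) - \int[diskm]_w (f^\- w))%E; first exact: integralE.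
rewrite -/f in fn; rewrite kn in fn; rewrite kp kn.
transitivity ((disk_area R)^-1%:E * (\int[mu]_w (f^\+ w) - \int[mu]_w (f^\- w)))%E; last first.
  by congr (_ * _)%E; apply/esym; exact: integralE.
rewrite [RHS]muleBr//; apply: fin_num_adde_defl; rewrite fin_numN.
move: fn; case: (\int[mu]_w (f^\- w))%E => [//||].
  by rewrite gt0_muley// lte_fin invr_gt0.
by rewrite gt0_muleNy// lte_fin invr_gt0.
Qed.

Variables (z : R * R) (u : R * R -> R) (s : R).
Hypotheses (hz : nrm2 z < 1) (cu : cont_disk u) (s1 : 1 < s) (s2 : s <= 2).

(** The function whose linear statistic over the k-th shell is the k-th term of the series;
    it is 0 outside of the disk. *)
Definition gfun w := expd (mobT0 z w) `^ s * (u \_ (disk R)) w.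
Definition gshell k := gfun \_ (annulus k z).

Let disk_bounds w : nrm2 w < 1 ->
  [/\ 0 < expd (mobT z w), expd (mobT z w) <= 1 & expd (mobT z w) <= 1 - mobT z w].
Proof.
move=> hw; have [_ h1 h2] := expd_bounds (mobT_ge0 z w) (mobT_lt1 hz hw).
by split => //; exact: expd_le1 (mobT_ge0 z w) (mobT_lt1 hz hw).
Qed.

Lemma measurable_u0 : measurable_fun setT (u \_ (disk R) : plane R -> R).
Proof.
apply/(measurable_restrictT _ (@measurable_disk R)).
exact: measurable_cont_disk.
Qed.

Lemma measurable_expd_powR (p : R) :
  measurable_fun setT (fun w : plane R => expd (mobT0 z w) `^ p).
Proof.
apply: (measurableT_comp (measurable_powR p)).
exact: (measurableT_comp (@measurable_expd R) (measurable_mobT0 hz)).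
Qed.

Lemma measurable_gfun : measurable_fun setT (gfun : plane R -> R).
Proof. apply: measurable_funM; [exact: measurable_expd_powR|exact: measurable_u0]. Qed.

Lemma gshellE k w : nrm2 w < 1 ->
  gshell k w = if w \in annulus k z then expd (mobT z w) `^ s * u w else 0.
Proof. by move=> hw; rewrite /gshell patchE /gfun mobT0E// patch_diskE hw. Qed.

Lemma tame_gshell k : tame (gshell k).
Proof.
split.
  apply/(measurable_restrictT _ (measurable_annulus k hz)).
  exact: measurable_funS measurable_gfun.
pose r := mobr (1 - expR (- k.+1%:R)) z.
have r1 : r < 1 by apply: mobr_lt1 => //; rewrite gtrBl expR_gt0.
have [M M0 uM] := cont_disk_bounded cu r1.
exists r, M; split => // [w wr|w]; rewrite /gshell patchE; case: ifPn => //.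
- by rewrite inE => /(annulus_cball hz).
- rewrite inE => Aw; have wr := annulus_cball hz Aw.
  have hw : nrm2 w < 1 by exact: le_lt_trans r1.
  have [e0 e1 _] := disk_bounds hw.
  rewrite /gfun mobT0E// patch_diskE hw normrM -[leRHS]mul1r; apply: ler_pM => //.
    rewrite ger0_norm ?powR_ge0//; apply: (@le_trans _ _ (1 `^ s)); last by rewrite powR1.
    by apply: ge0_ler_powR => //; rewrite ?nnegrE ?(ltW e0)// (le_trans _ (ltW s1)).
  exact: uM.
- by rewrite normr0.
Qed.

Lemma lstat_gshell k (X : configuration R) :
  lstat (gshell k) X = \sum_(x \in points X `&` annulus k z)
    expR (- s * poincare_dist z x) * u x.
Proof.
rewrite fsbig_mkcondr; apply: eq_fsbigr => w /set_mem/points_disk/diskE hw.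
by rewrite gshellE// expR_dist.
Qed.

(** By the mean value property, the expectation of the k-th term is a constant times the
    integral of exp(-s d) (1 - t)^(-2) over the interval of values of t = |phi_z|^2 on the
    shell. There exp(-d) and 1 - t are of order exp(-k), and the interval has length of that
    order as well. With |u| in place of u the expectations need not be summable. *)
Lemma gshell_mean_bound : slice_harmonic u ->
  exists2 C, 0 <= C & forall k, `|fine (intensity (gshell k))| <= C * expR (- (s - 1)) ^+ k.
Proof.
move=> hu; have [C HC] := radial_integral hz hu.
have [A0 _ _] := disk_area_props R.
exists ((disk_area R)^-1 * `|C| * (4 * expR (2 - s))).
  by rewrite !mulr_ge0 ?expR_ge0// invr_ge0 ltW.
move=> k; pose e := expR (- k.+1%:R) : R; pose a := 1 - e.
(* exp(-d) <= 1 - t, so the shell lies in the hyperbolic disk T <= a *)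
have e0 : 0 < e by exact: expR_gt0.
have e1 : e < 1 by rewrite -[ltRHS]expR0 ltr_expR oppr_lt0.
have a0 : 0 < a by rewrite subr_gt0.
have a1 : a < 1 by rewrite gtrBl.
pose I := `]e, expR (- k%:R)]%classic : set R.
pose F t := expd t `^ s * ((1 - t) ^+ 2)^-1 * \1_I (expd t).
have mF : measurable_fun setT F.
  apply: measurable_funM; first apply: measurable_funM.
  - exact: (measurableT_comp (measurable_powR s) (@measurable_expd R)).
  - apply: measurable_invr_ge0; last by move=> t; exact: sqr_ge0.
    by apply: measurable_funX; exact: measurable_funB.
  - apply: (measurableT_comp _ (@measurable_expd R)).
    by apply: measurable_indic; exact: measurable_itv.
have F0 t : 0 <= F t.
  by rewrite !mulr_ge0 ?powR_ge0 ?invr_ge0 ?sqr_ge0// indicE.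
(* (1 - t) / 4 <= exp(-d), so t >= b on the shell *)
pose b := 1 - 4 * expR (- k%:R) : R.
pose K := expR ((2 - s) * k.+1%:R).
have FK t : 0 <= t <= a -> F t <= K * \1_(`[b, 1]%classic : set R) t.
  move=> /andP[t0 ta]; have t1 : t < 1 by exact: le_lt_trans a1.
  have [h1 h2 h3] := expd_bounds t0 t1.
  rewrite /F !indicE mem_setE in_itv /=; have [/andP[h4 h5]|_] := boolP (_ < _ <= _); last first.
    by rewrite mulr0 mulr_ge0 ?expR_ge0.
  rewrite mem_setE in_itv /= (ltW t1) andbT.
  have -> : b <= t by rewrite /b; move: h5 h1; move: (expR _) (expd t) => p q; lra.
  rewrite !mulr1 /K.
  apply: (@le_trans _ _ (expd t `^ s * (expd t ^+ 2)^-1)).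
    rewrite ler_wpM2l ?powR_ge0// lef_pV2 ?posrE ?exprn_gt0 ?subr_gt0//.
    by rewrite lerXn2r ?nnegrE ?(ltW h3)// subr_ge0 ltW.
  have -> : expd t `^ s * (expd t ^+ 2)^-1 = expR ((2 - s) * - ln (expd t)).
    rewrite -{2}(lnK h3) -expRM_natl -expRN /powR gt_eqF// -expRD; congr expR.
    by ring.
  rewrite ler_expR ler_wpM2l ?subr_ge0// lerNl.
  by move: h4; rewrite /e -[in X in X -> _](lnK h3) ltr_expR => /ltW.
have k1 : 4 * expR (- k%:R) = 1 - b by rewrite /b opprB addrC subrK.
have b1 : b < 1 by rewrite gtrBl mulr_gt0// expR_gt0.
have IF : (\int[lebesgue_measure]_(t in `[0%R, a]) (F t)%:E <= (K * (4 * expR (- k%:R)))%:E)%E.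
  apply: (@le_trans _ _ (\int[lebesgue_measure]_(t in `[0%R, a])
      (K * \1_(`[b, 1]%classic : set R) t)%:E)%E).
    apply: ge0_le_integral => //.
    - by move=> t _; rewrite lee_fin.
    - by apply/measurable_EFinP; exact: measurable_funS mF.
    - apply/measurable_EFinP; apply: measurable_funM => //;
      by apply: measurable_indic; exact: measurable_itv.
  apply: (@le_trans _ _ (\int[lebesgue_measure]_t (K * \1_(`[b, 1]%classic : set R) t)%:E)%E).
    apply: ge0_subset_integral => //.
    - apply/measurable_EFinP; apply: measurable_funM => //;
      by apply: measurable_indic; exact: measurable_itv.
    - by move=> t _; rewrite lee_fin mulr_ge0 ?expR_ge0// indicE.
  under eq_integral do rewrite EFinM.
  rewrite ge0_integralZl//; last 2 first.
  - by apply/measurable_EFinP; apply: measurable_indic; exact: measurable_itv.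
  - by rewrite lee_fin expR_ge0.
  rewrite integral_indic// setIT.
  have L : (lebesgue_measure (`[b, 1%R]%classic : set (measurableTypeR R)) = (1 - b)%:E)%E.
    by rewrite lebesgue_measure_itv /= lte_fin b1.
  by rewrite k1 EFinM -L.
have Fp : (0 <= \int[lebesgue_measure]_(t in `[0%R, a]) (F t)%:E)%E.
  by apply: integral_ge0 => t _; rewrite lee_fin.
have [_ e2] := HC a F a0 a1 mF F0 (le_lt_trans IF (ltry _)).
have E w : (F (mobT0 z w) * radf u z (indle a) w)%:E = (gshell k w * kernel_diag w)%:E.
  congr (_%:E); rewrite /radf patch_diskE; case: ifPn => hw; last first.
    rewrite mulr0 /gshell patchE; case: ifPn; rewrite ?mul0r// inE => -[/diskE].
    by rewrite (negPf hw).
  rewrite gshellE// mobT0E// /F indicE mem_setE in_itv /=.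
  have [_ _ e3] := disk_bounds hw.
  have q0 := mobq_gt0 hz hw.
  have -> : (w \in annulus k z) = (e < expd (mobT z w) <= expR (- k%:R)).
    apply/idP/idP; first by rewrite inE => /(annulusE _ _ hz)[].
    by move=> h; rewrite inE; apply/(annulusE _ _ hz).
  case: ifPn => h; last by rewrite mulr0 !mul0r.
  rewrite indleE; have -> : mobT z w <= a.
    by rewrite /a; move/andP: h e3 => [h _]; move: h; move: (expd _) => p; lra.
  rewrite !mulr1 onem_mobT// /mobJ /kernel_diag.
  have a2 : 0 < 1 - nrm2 z by rewrite subr_gt0.
  have b2 : 0 < 1 - nrm2 w by rewrite subr_gt0.
  move: (1 - nrm2 z) (1 - nrm2 w) (mobq z w) (expd (mobT z w) `^ s) (u w) a2 b2 q0.
  by move=> p q r x y p0 q0 r0; field; rewrite !gt_eqF.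
have := intensity_plane (tame_gshell k); under eq_integral do rewrite -E.
rewrite e2 => ->.
have fI : (\int[lebesgue_measure]_(t in `[0%R, a]) (F t)%:E)%E \is a fin_num.
  by rewrite ge0_fin_numE// (le_lt_trans IF (ltry _)).
rewrite -(fineK fI) -!EFinM /= mulrA normrM normrM [`|(disk_area R)^-1|]gtr0_norm ?invr_gt0//.
rewrite -[leRHS]mulrA; apply: ler_wpM2l.
  by apply: mulr_ge0; rewrite ?normr_ge0// invr_ge0 ltW.
rewrite ger0_norm ?fine_ge0//.
have : fine (\int[lebesgue_measure]_(t in `[0%R, a]) (F t)%:E)%E <= K * (4 * expR (- k%:R)).
  by rewrite -lee_fin fineK.
move=> /le_trans; apply; rewrite -expRM_natl /K.
rewrite mulrCA -!mulrA ler_wpM2l// -!expRD ler_expR -natr1.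
by rewrite le_eqVlt; apply/orP; left; apply/eqP; ring.
Qed.

End ShellTestFunctions.

(** * Weighted norms *)

Section WeightedNorms.
Variable R : realType.
Implicit Types (z w : R * R) (k : nat) (p s : R).
Local Notation diskm := (@diskm R).

(** exp(-p d(z,w)) u(w)^2 K(w,w): for p = 2 s its integral is the Poisson variance of the
    series. *)
Definition weighted_density z (u : R * R -> R) p w := expd (mobT0 z w) `^ p * (u \_ (disk R)) w ^+ 2 * kernel_diag w.

Definition weighted_int z u p : \bar R := (\int[dA R]_(w in disk R) (weighted_density z u p w)%:E)%E.

Lemma weighted_density_ge0 z u p w : 0 <= weighted_density z u p w.
Proof.
apply: mulr_ge0; last exact: kernel_diag_ge0.
by apply: mulr_ge0; [exact: powR_ge0|exact: sqr_ge0].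
Qed.

Lemma measurable_weighted_density z u p : nrm2 z < 1 -> cont_disk u ->
  measurable_fun setT (weighted_density z u p : plane R -> R).
Proof.
move=> hz cu; apply: measurable_funM; last exact: measurable_kernel_diag.
apply: measurable_funM; first exact: measurable_expd_powR.
by apply: measurable_funX; exact: measurable_u0.
Qed.

Lemma weighted_int_shells z u p : nrm2 z < 1 -> cont_disk u ->
  (weighted_int z u p = \sum_(k <oo) \int[dA R]_(w in annulus k z) (weighted_density z u p w)%:E)%E.
Proof.
move=> hz cu; rewrite /weighted_int -(bigcup_annulus hz) ge0_integral_bigcup//.
- by move=> k; exact: measurable_annulus.
- by apply/measurable_EFinP; apply: measurable_funTS; exact: measurable_weighted_density.
- by move=> w _; rewrite lee_fin weighted_density_ge0.
- exact: trivIset_annulus.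
Qed.

Lemma le_weighted_int z z' u v p p' (C : R) : nrm2 z < 1 -> nrm2 z' < 1 -> cont_disk u ->
  cont_disk v -> 0 <= C ->
  (forall w, nrm2 w < 1 -> weighted_density z u p w <= C * weighted_density z' v p' w) ->
  (weighted_int z u p <= C%:E * weighted_int z' v p')%E.
Proof.
move=> hz hz' cu cv C0 h; rewrite /weighted_int -ge0_integralZl//; last 3 first.
- exact: measurable_disk.
- by apply/measurable_EFinP; apply: measurable_funTS; exact: measurable_weighted_density.
- by move=> w _; rewrite lee_fin weighted_density_ge0.
apply: ge0_le_integral => //.
- exact: measurable_disk.
- by move=> w _; rewrite lee_fin weighted_density_ge0.
- by apply/measurable_EFinP; apply: measurable_funTS; exact: measurable_weighted_density.
- apply: measurable_funeM; apply/measurable_EFinP; apply: measurable_funTS.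
  exact: measurable_weighted_density.
- by move=> w /diskE hw; rewrite -EFinM lee_fin h.
Qed.

(** On the k-th shell about the origin, exp(-(s + 1) k) against L_k exp(2 k) leaves
    L_k exp(-(s - 1) k), and sub-exponential growth of L is absorbed by half of this exponent.
    Moving the centre from 0 to z costs a bounded factor, as the weights exp(-d) for the two
    centres are comparable. *)
Lemma weighted_int_lty z u s (L : nat -> R) : nrm2 z < 1 -> cont_disk u -> 1 < s ->
  sub_exponential L ->
  (forall k, \int[dA R]_(w in annulus k (0%R, 0%R)) (u w ^+ 2 * kernel_diag w)%:E <=
     (L k * expR (2 * k%:R))%:E)%E ->
  (weighted_int z u (s + 1)%R < +oo)%E.
Proof.
move=> hz cu s1 [L0 hL] hG; have p0 : 0 <= s + 1 by lra.
have h0 := nrm2_00 R.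
pose K : R := (16 / (1 - nrm2 z)) `^ (s + 1).
have a0 : 0 < 1 - nrm2 z by rewrite subr_gt0.
have W0 : (weighted_int (0%R, 0%R) u (s + 1)%R < +oo)%E.
  have : exists2 M, 0 <= M & forall k, `|L k * expR (- ((s - 1) / 2) * k%:R)| <= M.
    have /hL/cvgP/cvg_seq_bounded/pinfty_ex_gt0[M M0 hM] : 0 < (s - 1) / 2 by lra.
    by exists M; [exact: ltW|move=> k; exact: hM].
  move=> [M M0 hM]; pose q : R := expR (- ((s - 1) / 2)).
  have q0 : 0 < q by exact: expR_gt0.
  have q1 : q < 1 by rewrite /q -[ltRHS]expR0 ltr_expR; lra.
  rewrite weighted_int_shells//; apply: (@le_lt_trans _ _ (M / (1 - q))%:E); last exact: ltry.
  apply: nneseries_le_geometric => //.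
    by move=> k; apply: integral_ge0 => w _; rewrite lee_fin weighted_density_ge0.
  move=> k; apply: (@le_trans _ _ (\int[dA R]_(w in annulus k (0%R, 0%R))
     ((expR (- k%:R * (s + 1)))%:E * (u w ^+ 2 * kernel_diag w)%:E))%E).
    have mA := measurable_annulus k h0.
    have AD : annulus k (0, 0) `<=` disk R by move=> w [].
    have mu := measurable_cont_disk cu AD.
    apply: ge0_le_integral => //.
    - by move=> w _; rewrite lee_fin weighted_density_ge0.
    - by apply/measurable_EFinP; apply: measurable_funTS; exact: measurable_weighted_density.
    - apply: measurable_funeM; apply/measurable_EFinP; apply: measurable_funM.
        exact: measurable_funX.
      by apply: measurable_funTS; exact: measurable_kernel_diag.
    - move=> w Aw; have /(annulusE _ _ h0)[hw /andP[_ h1]] := Aw.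
      rewrite -EFinM lee_fin /weighted_density mobT0E// patch_diskE hw -mulrA ler_wpM2r//.
        by rewrite mulr_ge0 ?sqr_ge0 ?kernel_diag_ge0.
      have [_ _ e0] := expd_bounds (mobT_ge0 (0, 0) w) (mobT_lt1 h0 hw).
      rewrite expRM; apply: ge0_ler_powR => //; rewrite nnegrE ?expR_ge0//.
      exact: ltW.
  rewrite ge0_integralZl//; last 3 first.
  - exact: measurable_annulus.
  - have AD : annulus k (0, 0) `<=` disk R by move=> w [].
    apply/measurable_EFinP; apply: measurable_funM.
      by apply: measurable_funX; exact: measurable_cont_disk.
    by apply: measurable_funTS; exact: measurable_kernel_diag.
  - by move=> w _; rewrite lee_fin mulr_ge0 ?sqr_ge0 ?kernel_diag_ge0.
  apply: le_trans (lee_wpmul2l _ (hG k)) _; first by rewrite lee_fin expR_ge0.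
  rewrite -EFinM lee_fin mulrCA -expRD.
  have -> : - k%:R * (s + 1) + 2 * k%:R = - ((s - 1) / 2) * k%:R + k%:R * - ((s - 1) / 2).
    by field.
  rewrite expRD mulrA expRM_natl -/q ler_wpM2r ?exprn_ge0 ?(ltW q0)//.
  by apply: le_trans (hM k); exact: ler_norm.
apply: le_lt_trans (_ : _ <= K%:E * weighted_int (0%R, 0%R) u (s + 1)%R)%E _; last first.
  by rewrite lte_mul_pinfty// lee_fin powR_ge0.
apply: le_weighted_int => //; first exact: powR_ge0.
move=> w hw; rewrite /weighted_density [leRHS]mulrA ler_wpM2r ?kernel_diag_ge0// [leRHS]mulrA ler_wpM2r ?sqr_ge0//.
have [l0 _ e0] := expd_bounds (mobT_ge0 (0, 0) w) (mobT_lt1 h0 hw).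
have [_ _ ez] := expd_bounds (mobT_ge0 z w) (mobT_lt1 hz hw).
rewrite !mobT0E// /K -powRM ?(ltW e0)//; last by rewrite divr_ge0// ltW.
apply: ge0_ler_powR => //; rewrite ?nnegrE ?(ltW ez)//.
  by rewrite mulr_ge0 ?(ltW e0)// divr_ge0// ltW.
have [_ h] := expd_mobT_bounds hz hw; apply: le_trans h _.
move: l0; rewrite mobT_0//; move: (expd _) => e l0.
have -> : 16 / (1 - nrm2 z) * e = 4 / (1 - nrm2 z) * (4 * e) by field; rewrite gt_eqF.
by rewrite ler_wpM2l ?divr_ge0 ?(ltW a0)//; lra.
Qed.

Definition norm2 (u : R * R -> R) s : \bar R :=
  (\int[dA R]_(w in disk R) (u w ^+ 2 * (1 - nrm2 w) `^ (2 * s - 2))%:E)%E.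

Lemma measurable_norm2_integrand u s : cont_disk u ->
  measurable_fun (disk R : set (plane R))
    (fun w : plane R => (u w ^+ 2 * (1 - nrm2 w) `^ (2 * s - 2))%:E).
Proof.
move=> cu; apply/measurable_EFinP; apply: measurable_funM.
  by apply: measurable_funX; exact: measurable_cont_disk.
apply: (measurableT_comp (measurable_powR _)); apply: measurable_funB => //.
by apply: measurable_funTS; exact: measurable_nrm2.
Qed.

Lemma norm2_ge0 u s : (0 <= norm2 u s)%E.
Proof.
by apply: integral_ge0 => w _; rewrite lee_fin mulr_ge0 ?sqr_ge0 ?powR_ge0.
Qed.

(** K(w,w) exp(-2 s d(z,w)) is comparable with (1 - |w|^2)^(2 s - 2). The comparison constants
    for exp(-d) are at most 1 and at least 1 respectively, and 2 s <= 4: their fourth power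
    serves for all s. *)
Lemma weighted_int_bounds z u s : nrm2 z < 1 -> cont_disk u -> 1 < s -> s <= 2 ->
  ((((1 - nrm2 z) / 16) ^+ 4)%:E * norm2 u s <= weighted_int z u (2 * s)%R /\
   weighted_int z u (2 * s)%R <= ((4 / (1 - nrm2 z)) ^+ 4)%:E * norm2 u s)%E.
Proof.
move=> hz cu s1 s2; have a0 : 0 < 1 - nrm2 z by rewrite subr_gt0.
have a1 : 1 - nrm2 z <= 1 by rewrite gerBl nrm2_ge0.
have mV := measurable_norm2_integrand s cu.
have V0 w : disk R w -> (0 <= (u w ^+ 2 * (1 - nrm2 w) `^ (2 * s - 2))%:E)%E.
  by move=> _; rewrite lee_fin mulr_ge0 ?sqr_ge0 ?powR_ge0.
have mW : measurable_fun (disk R : set (plane R)) (fun w : plane R => (weighted_density z u (2 * s) w)%:E).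
  by apply/measurable_EFinP; apply: measurable_funTS; exact: measurable_weighted_density.
have mD := @measurable_disk R.
have E w : nrm2 w < 1 ->
    weighted_density z u (2 * s) w = u w ^+ 2 * (kernel_diag w * expd (mobT z w) `^ (2 * s)).
  by move=> hw; rewrite /weighted_density mobT0E// patch_diskE hw; ring.
have E2 w : nrm2 w < 1 -> (1 - nrm2 w) `^ (2 * s - 2) = kernel_diag w * (1 - nrm2 w) `^ (2 * s).
  move=> hw; have b0 : 0 < 1 - nrm2 w by rewrite subr_gt0.
  rewrite /kernel_diag -powR_mulrn ?(ltW b0)// -powRN -powRD; last by rewrite (gt_eqF b0) implybT.
  by congr (_ `^ _); ring.
have s0 : 0 <= 2 * s by lra.
split.
  rewrite /norm2 /weighted_int -ge0_integralZl//; last by rewrite lee_fin exprn_ge0// divr_ge0// ltW.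
  apply: ge0_le_integral => //.
  - by move=> w Dw; rewrite mule_ge0 ?V0// lee_fin exprn_ge0// divr_ge0// ltW.
  - exact: measurable_funeM.
  move=> w /diskE hw; rewrite -EFinM lee_fin E// mulrCA ler_wpM2l ?sqr_ge0//.
  rewrite E2// mulrCA ler_wpM2l ?kernel_diag_ge0//.
  have b0 : 0 < 1 - nrm2 w by rewrite subr_gt0.
  have [h _] := expd_mobT_bounds hz hw.
  have c0 : 0 < (1 - nrm2 z) / 16 by rewrite divr_gt0.
  apply: (@le_trans _ _ (((1 - nrm2 z) / 16 * (1 - nrm2 w)) `^ (2 * s))).
    rewrite powRM ?(ltW c0) ?(ltW b0)// ler_wpM2r ?powR_ge0//.
    rewrite -powR_mulrn ?(ltW c0)//; apply: ger_powR; last by lra.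
    by rewrite c0 /=; lra.
  apply: ge0_ler_powR => //; rewrite nnegrE; first by rewrite mulr_ge0 ?(ltW c0)// ltW.
  by apply: le_trans h; rewrite mulr_ge0 ?(ltW c0)// ltW.
have c1 : 1 <= 4 / (1 - nrm2 z) by rewrite ler_pdivlMr// mul1r; lra.
have c0 := lt_le_trans ltr01 c1.
rewrite /norm2 /weighted_int -ge0_integralZl//; last by rewrite lee_fin exprn_ge0// ltW.
apply: ge0_le_integral => //.
- by move=> w _; rewrite lee_fin weighted_density_ge0.
- exact: measurable_funeM.
move=> w /diskE hw; rewrite -EFinM lee_fin E// [leRHS]mulrCA ler_wpM2l ?sqr_ge0//.
rewrite E2// [leRHS]mulrCA ler_wpM2l ?kernel_diag_ge0//.
have b0 : 0 < 1 - nrm2 w by rewrite subr_gt0.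
have [_ h] := expd_mobT_bounds hz hw.
have [_ _ e0] := expd_bounds (mobT_ge0 z w) (mobT_lt1 hz hw).
apply: (@le_trans _ _ ((4 / (1 - nrm2 z) * (1 - nrm2 w)) `^ (2 * s))).
  by apply: ge0_ler_powR => //; rewrite nnegrE ?(ltW e0)// mulr_ge0 ?(ltW c0)// ltW.
rewrite powRM ?(ltW c0) ?(ltW b0)// ler_wpM2r ?powR_ge0//.
by rewrite -powR_mulrn ?(ltW c0)//; apply: ler_powR => //; lra.
Qed.

End WeightedNorms.

(** * Variance of the series for a real harmonic function *)

Section ShellSeries.
Variables (R : realType) (P : probability (Conf R) R).
Hypothesis hP : determinantal (@bergman_kernel R) P.
Variables (z : R * R) (u : R * R -> R) (s : R) (L : nat -> R).
Hypotheses (hz : nrm2 z < 1) (cu : cont_disk u) (hu : slice_harmonic u).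
Hypotheses (s1 : 1 < s) (s2 : s <= 2) (hL : sub_exponential L).
Hypothesis hG : forall k,
  (\int[dA R]_(w in annulus k (0%R, 0%R)) (u w ^+ 2 * kernel_diag w)%:E <=
     (L k * expR (2 * k%:R))%:E)%E.
Implicit Types (w : R * R) (k : nat) (X : configuration R).
Local Notation diskm := (@diskm R).
Local Notation g := (gshell z u s).
Local Notation c := (Num.sqrt (4 / 5 : R)).

Let tg k : tame (g k) := tame_gshell hz cu s1 k.

Lemma gshell_off k w : nrm2 w < 1 = false -> g k w = 0.
Proof.
move=> hw; rewrite /gshell patchE; case: ifPn => //; rewrite inE => -[/diskE].
by rewrite hw.
Qed.

Lemma gshell_disjoint j k w : j != k -> g j w * g k w = 0.
Proof.
move=> jk; have [hw|/negbTE hw] := boolP (nrm2 w < 1); last by rewrite gshell_off ?mul0r.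
rewrite !gshellE//; case: ifPn; rewrite ?mul0r//; case: ifPn; rewrite ?mulr0//.
rewrite !inE => /(annulusE _ _ hz)[_ h1] /(annulusE _ _ hz)[_ h2].
have := expd_annulus_unique (mobT_ge0 z w) (mobT_lt1 hz hw) h1 h2.
by move/eqP; rewrite eq_sym (negPf jk).
Qed.

Lemma gshell_sqE k w : g k w ^+ 2 * kernel_diag w = (weighted_density z u (2 * s) \_ (annulus k z)) w.
Proof.
rewrite /gshell !patchE; case: ifPn => _; last by rewrite expr0n mul0r.
rewrite /gfun /weighted_density exprMn mulrC [in RHS]mulrC [2 * s]mulrC powRrM powR_mulrn//.
exact: powR_ge0.
Qed.

Lemma intensity_gshell_sq k : (intensity (fun w => (g k w ^+ 2)%R) =
  \int[dA R]_(w in annulus k z) (weighted_density z u (2 * s) w)%:E)%E.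
Proof.
have AD : annulus k z = disk R `&` annulus k z.
  by apply/seteqP; split=> w; [move=> Aw; split=> //; case: Aw|move=> []].
rewrite AD integral_mkcondr integral_diskm; last 2 first.
- apply/(measurable_restrictT _ (measurable_annulus k hz)).
  by apply/measurable_EFinP; apply: measurable_funTS; exact: measurable_weighted_density.
- by move=> w; rewrite patchE; case: ifP => // _; rewrite lee_fin weighted_density_ge0.
by apply: eq_integral => w _; rewrite gshell_sqE !patchE; case: ifP.
Qed.

(** Poisson variance of the first N terms, expectation of the k-th term, and the test function
    of the first N terms. *)
Let V N := \sum_(k < N) fine (intensity (fun w => g k w ^+ 2)).
Let m k := fine (intensity (g k)).
Let gsum N w := \sum_(k < N) g k w.

Let gsumS N : gsum N.+1 = (fun w => gsum N w + g N w).
Proof. by apply/funext => w; rewrite /gsum big_ord_recr. Qed.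

Let tame_gsum N : tame (gsum N).
Proof.
elim: N => [|N IH]; last by rewrite gsumS; exact: tameD.
split; last by exists 0, 0; split => // [w _|w]; rewrite /gsum big_ord0 ?normr0.
by rewrite (_ : gsum 0 = fun=> 0)//; apply/funext => w; rewrite /gsum big_ord0.
Qed.

Let lstat_gsum N X : lstat (gsum N) X = \sum_(k < N) lstat (g k) X.
Proof.
elim: N => [|N IH].
  rewrite big_ord0 /lstat fsbig1// => w _; exact: big_ord0.
rewrite big_ord_recr /= -IH -[X in _ + X]mul1r -lstat_lin//; congr lstat.
by rewrite gsumS; apply/funext => w; rewrite mul1r.
Qed.

Let intensity_gsum N : fine (intensity (gsum N)) = \sum_(k < N) m k.
Proof.
elim: N => [|N IH].
  rewrite big_ord0 /intensity integral0_eq// => w _; by rewrite /gsum big_ord0 mul0r.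
by rewrite big_ord_recr /= -IH gsumS fine_intensityD.
Qed.

(** The shells are disjoint, so cross terms vanish. *)
Let intensity_gsum_sq N : fine (intensity (fun w => gsum N w ^+ 2)) = V N.
Proof.
elim: N => [|N IH].
  rewrite /V big_ord0 /intensity integral0_eq// => w _; by rewrite /gsum big_ord0 expr0n mul0r.
rewrite /V big_ord_recr /= -/(V N) -IH -fine_intensityD; last 2 first.
- exact: (tameM (tame_gsum N) (tame_gsum N)).
- exact: (tameM (tg N) (tg N)).
congr (fine (intensity _)); apply/funext => w; rewrite gsumS.
have h : gsum N w * g N w = 0.
  rewrite /gsum mulr_suml big1// => k _; apply: gshell_disjoint.
  by rewrite neq_ltn ltn_ord.
by rewrite sqrrD h mul0rn addr0.
Qed.

Let w1 : (weighted_int z u (s + 1)%R < +oo)%E := weighted_int_lty hz cu s1 hL hG.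

Let weighted_density_le (p p' : R) w : p' <= p -> nrm2 w < 1 -> weighted_density z u p w <= 1 * weighted_density z u p' w.
Proof.
move=> pp hw; rewrite mul1r /weighted_density mobT0E//; apply: ler_wpM2r; first exact: kernel_diag_ge0.
apply: ler_wpM2r; first exact: sqr_ge0.
have [_ _ e0] := expd_bounds (mobT_ge0 z w) (mobT_lt1 hz hw).
apply: ger_powR => //; rewrite e0 /=.
exact: expd_le1 (mobT_ge0 z w) (mobT_lt1 hz hw).
Qed.

Lemma weighted_int2_lty : (weighted_int z u (2 * s)%R < +oo)%E.
Proof.
apply: le_lt_trans w1; rewrite -[leRHS]mul1e; apply: le_weighted_int => // w hw.
by apply: weighted_density_le => //; have := s1; lra.
Qed.

Let V_fin : weighted_int z u (2 * s)%R \is a fin_num.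
Proof.
rewrite ge0_fin_numE ?weighted_int2_lty//; apply: integral_ge0 => w _.
by rewrite lee_fin weighted_density_ge0.
Qed.

Let cvg_V : (V N)%:E @[N --> \oo] --> weighted_int z u (2 * s)%R.
Proof.
rewrite weighted_int_shells//.
rewrite (_ : (fun N => _) = (fun N => \sum_(0 <= k < N)
    \int[dA R]_(w in annulus k z) (weighted_density z u (2 * s) w)%:E)%E).
  apply: is_cvg_nneseries => k _ _; apply: integral_ge0 => w _.
  by rewrite lee_fin weighted_density_ge0.
apply/funext => N; rewrite big_mkord /V -sumEFin; apply: eq_bigr => k _.
rewrite -intensity_gshell_sq fineK//; exact: (intensity_fin (tameM (tg k) (tg k))).
Qed.

Let q : R := expR (- (s - 1)).

Let q0 : 0 < q. Proof. exact: expR_gt0. Qed.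
Let q1 : q < 1. Proof. by rewrite /q -[ltRHS]expR0 ltr_expR; have := s1; lra. Qed.

Let geometric_sum N : \sum_(k < N) q ^+ k <= 1 / (1 - q).
Proof.
rewrite (_ : \sum_(k < N) _ = series (geometric 1 q) N); last first.
  by rewrite /series /= big_mkord; apply: eq_bigr => k _; rewrite mul1r.
by apply: geometric_le_lim => //; rewrite ger0_norm// (ltW q0).
Qed.

Let cvg_m : cvgn (series m).
Proof.
have [C C0 hC] := gshell_mean_bound hz cu s1 s2 hu.
apply: normed_cvg; apply: nondecreasing_is_cvgn.
  by apply: nondecreasing_series => n _ _; exact: normr_ge0.
exists (C * (1 / (1 - q))) => _ [N _ <-].
rewrite [leLHS](_ : _ = \sum_(k < N) `|m k|); last exact: big_mkord.
apply: le_trans (_ : _ <= \sum_(k < N) C * q ^+ k) _; first by apply: ler_sum => k _; exact: hC.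
by rewrite -mulr_sumr; apply: ler_wpM2l => //; exact: geometric_sum.
Qed.

(** On the k-th shell exp(-(s - 1) d) <= q^k, which turns the exponent 2 s into s + 1; the
    integral with exponent s + 1 is finite because the growth condition leaves room for it
    when s > 1. *)
Let weighted_V N : \sum_(k < N) (q ^+ k)^-1 * fine (intensity (fun w => g k w ^+ 2)) <=
  fine (weighted_int z u (s + 1)).
Proof.
have fw : weighted_int z u (s + 1)%R \is a fin_num.
  rewrite ge0_fin_numE ?w1//; apply: integral_ge0 => w _.
  by rewrite lee_fin weighted_density_ge0.
rewrite -lee_fin fineK// weighted_int_shells// -sumEFin.
apply: (@le_trans _ _ (\sum_(0 <= k < N)
    \int[dA R]_(w in annulus k z) (weighted_density z u (s + 1) w)%:E)%E); last first.
  apply: nneseries_lim_ge => k _ _; apply: integral_ge0 => w _.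
  by rewrite lee_fin weighted_density_ge0.
rewrite big_mkord; apply: lee_sum => k _; rewrite EFinM fineK; last first.
  exact: (intensity_fin (tameM (tg k) (tg k))).
rewrite intensity_gshell_sq -ge0_integralZl//; last 4 first.
- exact: measurable_annulus.
- by apply/measurable_EFinP; apply: measurable_funTS; exact: measurable_weighted_density.
- by move=> w _; rewrite lee_fin weighted_density_ge0.
- by rewrite lee_fin invr_ge0 exprn_ge0// ltW.
apply: ge0_le_integral => //.
- exact: measurable_annulus.
- by move=> w _; rewrite -EFinM lee_fin mulr_ge0 ?weighted_density_ge0// invr_ge0 exprn_ge0// ltW.
- apply: measurable_funeM; apply/measurable_EFinP; apply: measurable_funTS.
  exact: measurable_weighted_density.
- by apply/measurable_EFinP; apply: measurable_funTS; exact: measurable_weighted_density.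
move=> w /(annulusE _ _ hz)[hw /andP[_ h]]; rewrite -EFinM lee_fin /weighted_density mobT0E//.
have [_ _ e0] := expd_bounds (mobT_ge0 z w) (mobT_lt1 hz hw).
rewrite [leLHS]mulrA ler_wpM2r ?kernel_diag_ge0// [leLHS]mulrA ler_wpM2r ?sqr_ge0//.
rewrite ler_pdivrMl ?exprn_gt0//.
have -> : 2 * s = (s - 1) + (s + 1) by ring.
rewrite powRD; last by rewrite (gt_eqF e0) implybT.
rewrite ler_wpM2r ?powR_ge0// /q -expRM_natl.
have -> : k%:R * - (s - 1) = - k%:R * (s - 1) by ring.
rewrite expRM; apply: ge0_ler_powR => //; rewrite ?nnegrE ?expR_ge0 ?(ltW e0)//.
by rewrite subr_ge0 ltW.
Qed.

(** The two-sided bound holds for the variance of every partial sum, which is a linear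
    statistic of a bounded function with compact support, and it passes to the limit. *)
Theorem shell_series_variance :
  let Y X := limn (series (fun k => \sum_(x \in points X `&` annulus k z)
    expR (- s * poincare_dist z x) * u x)) in
  [/\ measurable_fun setT (Y : Conf R -> R),
   ((1 - c)%:E * weighted_int z u (2 * s)%R <= \int[P]_X ((Y X - fine 'E_P[Y]) ^+ 2)%:E)%E &
   (\int[P]_X ((Y X - fine 'E_P[Y]) ^+ 2)%:E <= (1 + c)%:E * weighted_int z u (2 * s)%R)%E].
Proof.
move=> Y; pose W k (X : Conf R) := lstat (g k) X.
have YE : Y = (fun X => limn (series (W ^~ X))).
  apply/funext => X; rewrite /Y; congr (limn (series _)); apply/funext => k.
  by rewrite /W lstat_gshell.
have c0 : 0 <= c by exact: sqrtr_ge0.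
have vE (h : R * R -> R) : tame h -> let m := \int[P]_X lstat h X in
    exists2 v, (\int[P]_X ((lstat h X - m) ^+ 2)%:E = v%:E)%E &
      `|v - fine (intensity (fun x => h x ^+ 2))| <= c * fine (intensity (fun x => h x ^+ 2)).
  move=> th; have [_ i2 _ b] := lstat_variance hP th.
  exists (\int[P]_X ((lstat h X - \int[P]_X lstat h X) ^+ 2)) => //.
  by rewrite /Rintegral fineK//; exact: (integrable_fin_num measurableT i2).
have [|k|k|k|N|N||mY lim] := @L2_series_limit _ _ R P W m
  (fun k => (1 + c) * fine (intensity (fun w => g k w ^+ 2))) (fun k => (q ^+ k)^-1)
  (1 / (1 - q)) ((1 + c) * fine (weighted_int z u (s + 1))).
- by move=> k; have [] := lstat_variance hP (tg k).
- by have [_ _ ->] := lstat_variance hP (tg k).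
- have [_ _ mE _] := lstat_variance hP (tg k); rewrite /m -mE.
  have [v -> b] := vE _ (tg k); rewrite lee_fin.
  by rewrite mulrDl mul1r -lerBlDl; apply: le_trans b; exact: ler_norm.
- by rewrite invr_gt0 exprn_gt0.
- by under eq_bigr do rewrite invrK; exact: geometric_sum.
- under eq_bigr do rewrite mulrCA.
  rewrite -mulr_sumr; apply: ler_wpM2l; first by rewrite addr_ge0.
  exact: weighted_V.
- exact: cvg_m.
have {}mY : measurable_fun setT (Y : Conf R -> R) by rewrite YE.
have {}lim : (\int[P]_X ((\sum_(k < N) (W k X - m k)) ^+ 2)%:E @[N --> \oo] -->
    \int[P]_X ((Y X - fine 'E_P[Y]) ^+ 2)%:E)%E by rewrite YE.
have xE N : exists2 x, (\int[P]_X ((\sum_(k < N) (W k X - m k)) ^+ 2)%:E = x%:E)%E &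
    (1 - c) * V N <= x <= (1 + c) * V N.
  have [_ _ mE _] := lstat_variance hP (tame_gsum N).
  have [x xx b] := vE _ (tame_gsum N); exists x.
    rewrite -xx; apply: eq_integral => X _; rewrite mE intensity_gsum lstat_gsum.
    by rewrite sumrB.
  move: b; rewrite intensity_gsum_sq ler_norml => /andP[b1 b2].
  by apply/andP; split; move: b1 b2; move: (c) (V N) => *; lra.
have cvV (r : R) : (r * V N)%:E @[N --> \oo] --> (r%:E * weighted_int z u (2 * s)%R)%E.
  by under eq_fun do rewrite EFinM; apply: cvgeZl.
split => //.
- rewrite -(cvg_lim _ lim)// -(cvg_lim _ (cvV _))//; apply: lee_lim.
  + by apply/cvg_ex; eexists; exact: cvV.
  + by apply/cvg_ex; eexists; exact: lim.
  + by apply: nearW => N; have [x -> /andP[h _]] := xE N; rewrite lee_fin.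
- rewrite -(cvg_lim _ lim)// -(cvg_lim _ (cvV _))//; apply: lee_lim.
  + by apply/cvg_ex; eexists; exact: lim.
  + by apply/cvg_ex; eexists; exact: cvV.
  + by apply: nearW => N; have [x -> /andP[_ h]] := xE N; rewrite lee_fin.
Qed.

End ShellSeries.

(** * Complex harmonic functions *)

Section Assembly.
Variable R : realType.
Implicit Types (z w : R * R) (s : R).

(** The exponent 2 s - 2 is at most 2, so near w0 the integrand is bounded below by a
    continuous function that is positive at w0. *)
Lemma norm2_gt0 u s w0 : cont_disk u -> s <= 2 -> disk R w0 -> u w0 != 0 ->
  (0 < norm2 u s)%E.
Proof.
move=> cu s2 D0 u0; have /diskE h0 := D0.
pose G w := u w ^+ 2 * (1 - nrm2 w) ^+ 2.
have G0 : 0 < G w0.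
  apply: mulr_gt0; last by rewrite exprn_gt0// subr_gt0.
  by rewrite lt0r sqr_ge0 andbT expf_neq0.
have cG : cont_at w0 G.
  have := cu _ D0; rewrite -/(cont_at w0 u) => c0.
  by rewrite /G /nrm2; cont; exact: c0.
have : \forall w \near w0, disk R w /\ G w0 / 2 < G w.
  apply: filterI; first exact: open_nbhs_nbhs (conj (@open_disk R) D0).
  by have /cvgr_gt := cG; apply; lra.
move=> /nbhs_ballP[e /= e0 he].
pose I (a : R) := `]a - e, a + e[%classic : set (measurableTypeR R).
pose B := I w0.1 `*` I w0.2.
have mI a : measurable (I a) by exact: measurable_itv.
have BE w : B w -> disk R w /\ G w0 / 2 < G w.
  move=> [/= h1 h2]; apply: he; split; rewrite /ball /= ltr_distlC.
    by move: h1; rewrite /I /= in_itv.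
  by move: h2; rewrite /I /= in_itv.
have mB : measurable (B : set (plane R)) by exact: measurableX.
have BD : B `<=` disk R by move=> w /BE[].
have [A0 _ _] := disk_area_props R.
have dB : dA R B = ((disk_area R)^-1 * ((e + e) * (e + e)))%:E.
  rewrite /dA /= /mscale /= /plane_lebesgue /= product_measure1E//.
  have LI a : (lebesgue_measure (I a) = (e + e)%:E)%E.
    rewrite /I lebesgue_measure_itv /= lte_fin.
    have -> : a - e < a + e by lra.
    by rewrite -EFinD; congr (_%:E); ring.
  rewrite [X in (_ * X)%E](_ : _ = ((e + e)%:E * (e + e)%:E)%E); first by rewrite -!EFinM.
  by congr (_ * _)%E; exact: LI.
apply: (@lt_le_trans _ _ ((G w0 / 2)%:E * dA R B)%E).
  have e2 : 0 < e + e by rewrite addr_gt0.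
  rewrite dB -EFinM lte_fin; apply: mulr_gt0; first exact: divr_gt0.
  by apply: mulr_gt0; [rewrite invr_gt0|exact: mulr_gt0].
rewrite -integral_cst//.
apply: (@le_trans _ _ (\int[dA R]_(w in B) (u w ^+ 2 * (1 - nrm2 w) `^ (2 * s - 2))%:E)%E).
  apply: ge0_le_integral => //.
  - by move=> w _; rewrite lee_fin divr_ge0// ltW.
  - by apply: measurable_funS BD _; [exact: measurable_disk|exact: measurable_norm2_integrand].
  move=> w /BE[/diskE hw h]; rewrite lee_fin; apply: le_trans (ltW h) _.
  rewrite /G ler_wpM2l ?sqr_ge0//.
  have b0 : 0 < 1 - nrm2 w by rewrite subr_gt0.
  rewrite -powR_mulrn ?(ltW b0)//; apply: ger_powR; last by lra.
  by rewrite b0 gerBl nrm2_ge0.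
apply: ge0_subset_integral => //; first exact: measurable_disk.
  exact: measurable_norm2_integrand.
by move=> w _; rewrite lee_fin mulr_ge0 ?sqr_ge0 ?powR_ge0.
Qed.

Lemma cmod2 (a : R[i]) : cmod a ^+ 2 = complex.Re a ^+ 2 + complex.Im a ^+ 2.
Proof. by case: a => x y; rewrite /cmod /Normc.normc /= sqr_sqrtr// addr_ge0// sqr_ge0. Qed.

Lemma cmod_cplx w : cmod (cplx w) ^+ 2 = nrm2 w.
Proof. by rewrite cmod2. Qed.

Lemma Re_Im_g_term s z (f : R * R -> R[i]) (X : configuration R) k : nrm2 z < 1 ->
  complex.Re (g_term s z f X k) = \sum_(x \in points X `&` annulus k z)
    expR (- s * poincare_dist z x) * complex.Re (f x) /\
  complex.Im (g_term s z f X k) = \sum_(x \in points X `&` annulus k z)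
    expR (- s * poincare_dist z x) * complex.Im (f x).
Proof.
move=> hz; have fX : finite_set (points X `&` annulus k z).
  have r1 : mobr (1 - expR (- k.+1%:R)) z < 1 by apply: mobr_lt1 => //; rewrite gtrBl expR_gt0.
  apply: sub_finite_set (finite_points X r1) => x [Xx Ax]; split => //.
  exact: annulus_cball hz Ax.
rewrite /g_term !fsbig_finite//=; elim: (finmap.enum_fset _) => [|x l [IH1 IH2]].
  by rewrite !big_nil.
rewrite !big_cons; move: IH1 IH2; case: (\sum_(_ <- l) _) => a b /= <- <-.
by case: (f x) => p q /=; split; ring.
Qed.

End Assembly.

(** The variance and the weighted norm of f are the sums of those of its real and imaginary
    parts, whose ratios lie in the same interval; the norm is neither 0 nor infinite, which
    gives the quotient its usual meaning. *)
Theorem proposition1p5 (R : realType) (P : probability (Conf R) R)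
    (hP : determinantal (@bergman_kernel R) P) (z : R * R) (hz : disk R z) :
  exists c1 c2 : R, [/\ 0 < c1, 0 < c2 &
    forall (f : R * R -> R[i]) (s : R),
      harmonic_on_disk f ->
      (exists w, disk R w /\ f w <> 0) ->
      sub_exponential_mean_growth f ->
      1 < s <= 2 ->
      (c1%:E <= cvariance P (fun X => g_series s z f X) / weighted_norm2 s f)%E
      /\
      (cvariance P (fun X => g_series s z f X) / weighted_norm2 s f <= c2%:E)%E].
Proof.
have /diskE z1 := hz; have a0 : 0 < 1 - nrm2 z by rewrite subr_gt0.
pose c : R := Num.sqrt (4 / 5).
have c1 : c < 1 by rewrite /c -[ltRHS]sqrtr1 ltr_sqrt//; lra.
have c0 : 0 <= c by exact: sqrtr_ge0.
pose k1 := ((1 - nrm2 z) / 16) ^+ 4; pose k2 := (4 / (1 - nrm2 z)) ^+ 4.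
have k10 : 0 < k1 by rewrite exprn_gt0// divr_gt0.
have k20 : 0 < k2 by rewrite exprn_gt0// divr_gt0.
exists ((1 - c) * k1), ((1 + c) * k2); split; [by rewrite mulr_gt0// subr_gt0|
  by rewrite mulr_gt0// ltr_wpDr|].
move=> f s [h1 h2] [w0 [D0 f0]] [L [hL hG]] /andP[s1 s2].
have real_case (u : R * R -> R) : real_harmonic u ->
    (forall w, u w ^+ 2 <= cmod (f w) ^+ 2) ->
    let Y X := limn (series (fun k => \sum_(x \in points X `&` annulus k z)
      expR (- s * poincare_dist z x) * u x)) in
    [/\ measurable_fun setT (Y : Conf R -> R), norm2 u s \is a fin_num,
     (((1 - c) * k1)%:E * norm2 u s <= \int[P]_X ((Y X - fine 'E_P[Y]) ^+ 2)%:E)%E &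
     (\int[P]_X ((Y X - fine 'E_P[Y]) ^+ 2)%:E <= ((1 + c) * k2)%:E * norm2 u s)%E].
  move=> hu uf Y; have cu : cont_disk u by case: hu => -[].
  have sh := real_harmonic_slice hu.
  have n0 := nrm2_00 R.
  have hGu k : (\int[dA R]_(w in annulus k (0%R, 0%R)) (u w ^+ 2 * kernel_diag w)%:E <=
      (L k * expR (2 * k%:R))%:E)%E.
    apply: le_trans (hG k); have AD : annulus k (0, 0) `<=` disk R by move=> w [].
    have mA := measurable_annulus k n0.
    have msq (v : R * R -> R) : real_harmonic v ->
        measurable_fun (annulus k (0, 0) : set (plane R)) (fun w : plane R => v w ^+ 2).
      by move=> [[cv _] _]; apply: measurable_funX; exact: measurable_cont_disk.
    have mk : measurable_fun (annulus k (0, 0) : set (plane R)) (fun w : plane R => kernel_diag w).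
      by apply: measurable_funTS; exact: measurable_kernel_diag.
    have E w : cmod (f w) ^+ 2 / (1 - cmod (cplx w) ^+ 2) ^+ 2 =
        (complex.Re (f w) ^+ 2 + complex.Im (f w) ^+ 2) * kernel_diag w.
      by rewrite cmod2 cmod_cplx.
    apply: ge0_le_integral => //.
    - by move=> w _; rewrite lee_fin mulr_ge0 ?sqr_ge0 ?kernel_diag_ge0.
    - by apply/measurable_EFinP; apply: measurable_funM => //; exact: msq.
    - under eq_fun do rewrite E.
      apply/measurable_EFinP; apply: measurable_funM => //.
      exact: (measurable_funD (msq _ h1) (msq _ h2)).
    - move=> w _; rewrite lee_fin cmod_cplx ler_wpM2r// -/(kernel_diag w); exact: kernel_diag_ge0.
  have [mY lo hi] := shell_series_variance hP z1 cu sh s1 s2 hL hGu.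
  have [b1 b2] := weighted_int_bounds z1 cu s1 s2.
  have wl := weighted_int2_lty z1 cu s1 hL hGu.
  split => //.
  - move: (norm2_ge0 u s) b1; case: (norm2 u s) => [//|_|//].
    by rewrite gt0_muley ?lte_fin// leye_eq => /eqP E; move: wl; rewrite E.
  - apply: le_trans lo; rewrite EFinM -muleA; apply: lee_wpmul2l => //.
    by rewrite lee_fin subr_ge0 ltW.
  - apply: le_trans hi _; rewrite EFinM -muleA; apply: lee_wpmul2l => //.
have sqRe w : complex.Re (f w) ^+ 2 <= cmod (f w) ^+ 2 by rewrite cmod2 lerDl sqr_ge0.
have sqIm w : complex.Im (f w) ^+ 2 <= cmod (f w) ^+ 2 by rewrite cmod2 lerDr sqr_ge0.
have [mY1 fin1 lo1 hi1] := real_case _ h1 sqRe.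
have [mY2 fin2 lo2 hi2] := real_case _ h2 sqIm.
have cRe : cont_disk (fun w => complex.Re (f w)) by case: h1 => -[].
have cIm : cont_disk (fun w => complex.Im (f w)) by case: h2 => -[].
have NE : (weighted_norm2 s f = norm2 (fun w => complex.Re (f w)) s +
    norm2 (fun w => complex.Im (f w)) s)%E.
  rewrite /weighted_norm2 /norm2 -ge0_integralD//.
  - by apply: eq_integral => w _; rewrite cmod2 cmod_cplx mulrDl EFinD.
  - exact: measurable_disk.
  - by move=> w _; rewrite lee_fin mulr_ge0 ?sqr_ge0 ?powR_ge0.
  - exact: measurable_norm2_integrand.
  - by move=> w _; rewrite lee_fin mulr_ge0 ?sqr_ge0 ?powR_ge0.
  - exact: measurable_norm2_integrand.
have Npos : (0 < weighted_norm2 s f)%E.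
  have : complex.Re (f w0) != 0 \/ complex.Im (f w0) != 0.
    have [e1|] := eqVneq (complex.Re (f w0)) 0; last by left.
    right; apply/eqP => e2; apply: f0; apply/eqP; rewrite eq_complex e1 e2 /=.
    by rewrite !eqxx.
  rewrite NE => -[] e.
    apply: lt_le_trans (norm2_gt0 cRe s2 D0 e) _.
    by rewrite leeDl// norm2_ge0.
  apply: lt_le_trans (norm2_gt0 cIm s2 D0 e) _.
  by rewrite leeDr// norm2_ge0.
pose Y1 X := limn (series (fun k => \sum_(x \in points X `&` annulus k z)
      expR (- s * poincare_dist z x) * complex.Re (f x))).
pose Y2 X := limn (series (fun k => \sum_(x \in points X `&` annulus k z)
      expR (- s * poincare_dist z x) * complex.Im (f x))).
have YE X : g_series s z f X = (Y1 X +i* Y2 X)%C.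
  rewrite /g_series; congr (_ +i* _)%C; congr (limn (series _)); apply/funext => k.
    by have [] := Re_Im_g_term s f X k z1.
  by have [] := Re_Im_g_term s f X k z1.
have VE : (cvariance P (fun X => g_series s z f X) =
    \int[P]_X ((Y1 X - fine 'E_P[Y1]) ^+ 2)%:E + \int[P]_X ((Y2 X - fine 'E_P[Y2]) ^+ 2)%:E)%E.
  have -> : (fun X => g_series s z f X) = (fun X => (Y1 X +i* Y2 X)%C) by apply/funext.
  transitivity (\int[P]_X (cmod ((Y1 X +i* Y2 X)%C -
      cexpectation P (fun X => (Y1 X +i* Y2 X)%C)) ^+ 2)%:E)%E.
    by rewrite /cvariance unlock.
  rewrite -ge0_integralD//.
  - by apply: eq_integral => X _; rewrite cmod2 EFinD.
  - by move=> X _; rewrite lee_fin sqr_ge0.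
  - by apply/measurable_EFinP; apply: measurable_funX; exact: measurable_funB.
  - by move=> X _; rewrite lee_fin sqr_ge0.
  - by apply/measurable_EFinP; apply: measurable_funX; exact: measurable_funB.
have lo := leeD lo1 lo2; have hi := leeD hi1 hi2.
move: lo hi Npos; rewrite -/Y1 -/Y2 -VE NE -(fineK fin1) -(fineK fin2).
move: (fine (norm2 _ _)) (fine (norm2 _ _)) (cvariance _ _) => n1 n2 v.
rewrite -!EFinM -!EFinD -!mulrDr lte_fin => lo hi n0.
rewrite inver gt_eqF// lee_pdivlMr// lee_pdivrMr//.
Qed.
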